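(* Assume (A1)–(A4) and run Algorithm SC with event-triggered coefficients $\nu_{ij}=\nu_{ji}\in[0,1/2)$ for all $(i,j)\in\mathcal{E}$ (and arbitrary $b_{ij}=b_{ji}>0$). Then there exist step-size sequences $\{\alpha_{ij,k}\}$ (with $\alpha_{ij,k}=\alpha_{ji,k}>0$) and $\{\beta_{i,k}\}$ (positive) satisfying (i) $\sum_k\alpha_{ij,k}^2<\infty$ and $\sup_k\alpha_{ij,k+1}/\alpha_{ij,k}<\infty$ for all $(i,j)\in\mathcal{E}$; (ii) $\sum_k\beta_{i,k}^2<\infty$ and $\sup_k\beta_{i,k+1}/\beta_{i,k}<\infty$ for all $i$; (iii) $\sum_k\min\{\alpha_{ij,k}/k^{\nu_{ij}},(i,j)\in\mathcal{E};\beta_{i,k},i\in\mathcal{V}\}=\infty$, such that for every $i\in\mathcal{V}$, $\tilde\theta_{i,k}=O\!\left(\sqrt{\ln k}/k^{1/2-\bar\nu/2}\right)$ almost surely, where $\bar\nu=\max_{(i,j)\in\mathcal{E}}\nu_{ij}$.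
   Context: Network: undirected weighted graph with sensor set $\mathcal{V}=\{1,\dots,N\}$, symmetric nonnegative weights $a_{ij}=a_{ji}$, with $a_{ij}>0$ iff $(i,j)\in\mathcal{E}$; the edge set $\mathcal{E}$ is regarded as a set of ordered pairs that is symmetric ($(i,j)\in\mathcal{E}\iff(j,i)\in\mathcal{E}$), $M=|\mathcal{E}|/2$ is the number of undirected edges, and $\mathcal{N}_i=\{j:(i,j)\in\mathcal{E}\}$. The Laplacian is $\mathcal{L}=\mathcal{D}-\mathcal{A}$ with $\mathcal{A}=(a_{ij})$, $\mathcal{D}=\mathrm{diag}(\sum_{j\in\mathcal{N}_i}a_{ij})$; $\lambda_2(\mathcal{L})$ is its second smallest eigenvalue. Observations: unknown $\theta\in\mathbb{R}^n$; sensor $i$ observes $y_{i,k}=H_{i,k}\theta+w_{i,k}$, $k\ge1$, with deterministic $H_{i,k}\in\mathbb{R}^{m_i\times n}$ and noise $w_{i,k}\in\mathbb{R}^{m_i}$. Let $d_{i,k}$ ($i\in\mathcal{V},k\ge1$) be the dithering noises used below, $\mathcal{F}_k=\sigma(w_{i,t},d_{i,t}: i\in\mathcal{V},1\le t\le k)$ and $\mathcal{F}^w_k=\sigma(w_{i,t}: i\in\mathcal{V},1\le t\le k)$. Assumptions. (A1) There is $\bar H>0$ with $\|H_{i,k}\|\le\bar H$ for all $i,k$, and there are a positive integer $p$ and $\delta>0$ with $\frac1p\sum_{t=k}^{k+p-1}\sum_{i=1}^N H_{i,t}^\top H_{i,t}\ge\delta I_n$ for all $k\ge1$. (A2) $\{w_{i,k},\mathcal{F}_k\}$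 is a martingale difference sequence and $\sup_{i,k}\mathbb{E}[\|w_{i,k}\|^\rho\mid\mathcal{F}^w_{k-1}]<\infty$ a.s. for some $\rho>2$. (A3) The graph is connected, i.e. $\mathrm{rank}(\mathcal{L})=N-1$. (A4) The $d_{i,k}$ are i.i.d. with the Laplace distribution $\mathrm{Lap}(0,1)$ (density $f(x)=\frac12e^{-|x|}$, distribution function $F$), mutually independent over all $(i,k)$, and independent of all $w_{j,t}$. Algorithm SC. Inputs: deterministic initial estimates $\hat\theta_{i,0}\in\mathbb{R}^n$; event-triggered coefficients $\nu_{ij}=\nu_{ji}\ge0$; noise coefficients $b_{ij}=b_{ji}>0$; step sizes $\alpha_{ij,k}=\alpha_{ji,k}>0$ ($(i,j)\in\mathcal{E}$) and $\beta_{i,k}>0$. For $k=1,2,\dots$: let $\varphi_k\in\mathbb{R}^n$ be the $l$-th standard basis vector, where $k=nq+l$ with $q\in\mathbb{N}\cup\{0\}$, $l\in\{1,\dots,n\}$; set $x_{i,k}=\varphi_k^\top\hat\theta_{i,k-1}$; set $C_{ij,k}=\nu_{ij}b_{ij}\ln k$; set $s_{ij,k}=1$ if $x_{i,k}+b_{ij}d_{i,k}>0$ and $s_{ij,k}=-1$ otherwise. Sensor $i$ sends the one-bit message $s_{ij,k}$ to neighbor $j$ iff $|x_{i,k}+b_{ij}d_{i,k}|>C_{ij,k}$; sensor $i$ sets $\hat s_{ji,k}=s_{ji,k}$ if it received $s_{ji,k}$ from $j$, and $\hat s_{ji,k}=0$ otherwise. With $G_{ij,k}(x)=F((x-C_{ij,k})/b_{ij})-F((-x-C_{ij,k})/b_{ij})$,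 update $\check\theta_{i,k}=\hat\theta_{i,k-1}+\varphi_k\sum_{j\in\mathcal{N}_i}\alpha_{ij,k}a_{ij}(\hat s_{ji,k}-G_{ij,k}(x_{i,k}))$, $\hat\theta_{i,k}=\check\theta_{i,k}+\beta_{i,k}H_{i,k}^\top(y_{i,k}-H_{i,k}\hat\theta_{i,k-1})$. Write $\tilde\theta_{i,k}=\hat\theta_{i,k}-\theta$. ''$X_k=O(r_k)$ a.s.'' means $\sup_k\|X_k\|/r_k<\infty$ almost surely. *)

(* Defs.v *)
From mathcomp Require Import all_boot all_order all_algebra.
From mathcomp Require Import all_classical all_reals all_analysis.
Set Implicit Arguments. Unset Strict Implicit. Unset Printing Implicit Defensive.
Import Order.TTheory GRing.Theory Num.Theory numFieldNormedType.Exports.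
Local Open Scope ring_scope.
Local Open Scope classical_set_scope.

Section SCDefs.
Variable R : realType.

Definition vnorm (n : nat) (x : 'cV[R]_n) : R := Num.sqrt (\sum_(l < n) x l 0 ^+ 2).

Definition frob (p q : nat) (A : 'M[R]_(p, q)) : R :=
  Num.sqrt (\sum_(r < p) \sum_(c < q) A r c ^+ 2).

Definition loewner_ge (n : nat) (M : 'M[R]_n) (c : R) : Prop :=
  forall x : 'cV[R]_n, c * (x^T *m x) 0 0 <= (x^T *m M *m x) 0 0.

Definition laplacian (N : nat) (a : 'M[R]_N) : 'M[R]_N :=
  diag_mx (\row_(i < N) \sum_(j < N | 0 < a i j) a i j) - a.

(* distribution function of Lap(0,1) *)
Definition lapF (x : R) : R :=
  if x < 0 then expR x / 2 else 1 - expR (- x) / 2.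

(* phi_k = l-th standard basis vector where k = n q + l, l in {1..n};
   0-based index (k-1) mod n *)
Definition phi (n k : nat) : 'cV[R]_n :=
  \col_(l < n) ((l : nat) == (k.-1 %% n)%N)%:R.

Definition seqmin (s : seq R) : R := \big[Num.min/head 0 s]_(x <- s) x.

(* nu_bar = max over edges of nu_ij (0 if there are no edges; nu_ij >= 0) *)
Definition nubar (N : nat) (a nu : 'M[R]_N) : R :=
  \big[Num.max/0]_(i < N) \big[Num.max/0]_(j < N | 0 < a i j) nu i j.

Definition minstep (N : nat) (a nu : 'M[R]_N)
  (alpha : 'I_N -> 'I_N -> nat -> R) (beta : 'I_N -> nat -> R) (k : nat) : R :=
  seqmin ([seq beta i k | i <- enum 'I_N] ++
          [seq alpha i j k / powR (k%:R) (nu i j)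
             | i <- enum 'I_N, j <- [seq j <- enum 'I_N | 0 < a i j]]).

(* One step k of Algorithm SC, given the estimates prev = hat theta_{.,k-1},
   realized noises w_{.,k} and dithers dd_{.,k}. *)
Definition sc_update (N n : nat) (m : 'I_N -> nat) (a nu b : 'M[R]_N)
  (alpha : 'I_N -> 'I_N -> nat -> R) (beta : 'I_N -> nat -> R)
  (H : forall i : 'I_N, nat -> 'M[R]_(m i, n)) (theta : 'cV[R]_n)
  (w : forall i : 'I_N, nat -> 'cV[R]_(m i)) (dd : 'I_N -> nat -> R)
  (k : nat) (prev : 'I_N -> 'cV[R]_n) (i : 'I_N) : 'cV[R]_n :=
  let x (j : 'I_N) := ((phi n k)^T *m prev j) 0 0 in
  let C (j l : 'I_N) := nu j l * b j l * ln (k%:R) in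
  let z (j l : 'I_N) := x j + b j l * dd j k in
  let s (j l : 'I_N) : R := if 0 < z j l then 1 else -1 in
  (* message received by l from j: s_{jl,k} if sent, 0 otherwise *)
  let shat (j l : 'I_N) : R := if C j l < `|z j l| then s j l else 0 in
  let G (j l : 'I_N) (u : R) :=
    lapF ((u - C j l) / b j l) - lapF ((- u - C j l) / b j l) in
  let check := prev i +
    (\sum_(j < N | 0 < a i j) alpha i j k * a i j * (shat j i - G i j (x i)))
      *: phi n k in
  let y := H i k *m theta + w i k in
  check + beta i k *: ((H i k)^T *m (y - H i k *m prev i)).

Fixpoint sc_est (N n : nat) (m : 'I_N -> nat) (a nu b : 'M[R]_N)
  (alpha : 'I_N -> 'I_N -> nat -> R) (beta : 'I_N -> nat -> R)
  (H : forall i : 'I_N, nat -> 'M[R]_(m i, n)) (theta : 'cV[R]_n)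
  (w : forall i : 'I_N, nat -> 'cV[R]_(m i)) (dd : 'I_N -> nat -> R)
  (th0 : 'I_N -> 'cV[R]_n) (k : nat) : 'I_N -> 'cV[R]_n :=
  match k with
  | 0 => th0
  | k'.+1 => @sc_update N n m a nu b alpha beta H theta w dd k'.+1
               (sc_est a nu b alpha beta H theta w dd th0 k')
  end.

Context {d : measure_display} {T : measurableType d}.

Definition filtF (N : nat) (m : 'I_N -> nat)
  (w : forall i : 'I_N, nat -> T -> 'cV[R]_(m i)) (dd : 'I_N -> nat -> T -> R)
  (k : nat) : set (set T) :=
  <<s [set A | (exists (i : 'I_N) (t : nat) (j : 'I_(m i)) (B : set R),
                  [/\ (1 <= t <= k)%N, measurable B &
                      A = (fun om => w i t om j 0) @^-1` B]) \/
               (exists (i : 'I_N) (t : nat) (B : set R),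
                  [/\ (1 <= t <= k)%N, measurable B & A = dd i t @^-1` B])] >>.

Definition filtFw (N : nat) (m : 'I_N -> nat)
  (w : forall i : 'I_N, nat -> T -> 'cV[R]_(m i)) (k : nat) : set (set T) :=
  <<s [set A | exists (i : 'I_N) (t : nat) (j : 'I_(m i)) (B : set R),
                  [/\ (1 <= t <= k)%N, measurable B &
                      A = (fun om => w i t om j 0) @^-1` B]] >>.

Definition sigmaW (N : nat) (m : 'I_N -> nat)
  (w : forall i : 'I_N, nat -> T -> 'cV[R]_(m i)) : set (set T) :=
  <<s [set A | exists (i : 'I_N) (t : nat) (j : 'I_(m i)) (B : set R),
                  [/\ (1 <= t)%N, measurable B &
                      A = (fun om => w i t om j 0) @^-1` B]] >>.

End SCDefs.

(* Main.v *)
From HB Require Import structures.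
Require Import Defs.
From mathcomp Require Import all_boot all_order all_algebra.
From mathcomp Require Import all_classical all_reals all_analysis.
From mathcomp Require Import measurable_realfun ring lra.
Import Order.TTheory GRing.Theory Num.Theory numFieldNormedType.Exports.
Local Open Scope ring_scope.
Local Open Scope classical_set_scope.

(* Take beta_k = (1 + ln k)^ep / k and alpha_{ij,k} = beta_k k^{nu_ij}: the effective coupling
   gain alpha_{ij,k} G_{ij,k}' is then of order beta_k, and the dither contributes a conditional
   variance of order beta_k^2 k^{nubar}.  Let V be the sum of the squared errors.

   First, ln (1 + V) is a supermartingale up to a summable error, because the drift is monotone;
   a maximal inequality for such processes bounds V almost surely.

   On {V <= K} the drift contracts along Q_k, the sum of the squared disagreements in the
   coordinate phi_k and of the |H_{i,k} x_i|^2.  A single Q_k is degenerate, but connectivity and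
   persistent excitation bound a window sum of L = n + p of them below by a multiple of V.  The
   form W_k = V - c beta_k sum_{s < L} (L - s) Q_{k+s}, equivalent to V, therefore satisfies
   E W_{k+1} <= (1 - c' beta_k) W_k + noise.  With 1 < q <= min(rho/2, 3/2) the weighted power
   (W_k k^{1-nubar} / (1 + ln k))^q is again a supermartingale up to an error of order
   1 / (k (1 + ln k)^{1+s}), s > 0: the factor (1 + ln k)^ep in beta_k makes the contraction beat
   the growth of the weight although c' depends on K.  Its boundedness is the claimed rate. *)

(** * Power inequalities *)

(** The exponent q is forced. With q = 1 the weighted error is of order beta_k^2 k / (1 + ln k) = (1
    + ln k)^{2 ep - 1} / k, whose sum diverges. For q > 1, half of the contraction is spent through
    Young's inequality and the error becomes (1 + ln k)^{ep (1 + q) - q} / k, which is summable once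
    ep (1 + q) < q - 1. The choice ep = (q - 1) / 4 meets this because q < 3, and q <= rho / 2 is
    what the moments of w allow.

    Conditional expectations are never formed. A martingale difference is an integrable function
    whose integral over each event of the past is zero; a supermartingale is a pathwise inequality
    whose noise is a sum of products X Y, with X measurable for the past and Y a martingale
    difference. Accordingly the centred sending events enter as martingale differences of their own:
    a bit has size 1 whenever it is sent, and only its conditional mean is small.

    The contraction constants depend on the bound of V along the path, hence on chance. They are
    made deterministic on events indexed by integer bounds, and countably many such events cover
    almost every path. *)

Section RealInequalities.
Variable R : realType.
Implicit Types (x y v r m q : R).

Lemma ln_le_subr1 x : 0 < x -> ln x <= x - 1.
Proof.
by move=> x0; have := @le_ln1Dx R (x - 1); rewrite (_ : 1 + (x - 1) = x); [apply; lra|ring].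
Qed.

(** Concavity of ln without derivatives: with u the right-hand side, use ln z <= z - 1 at z = y / u
    with weight [a] and at z = 1 / u with weight [1 - a]; the two upper bounds cancel. *)
Lemma powR_le_Bernoulli y a : 0 <= a <= 1 -> 0 <= y -> y `^ a <= 1 + a * (y - 1).
Proof.
move=> /andP[a0 a1]; rewrite le_eqVlt => /predU1P[<-|y0].
  rewrite /powR eqxx; case: eqP => [->|/eqP aN0] /=; lra.
set u := 1 + a * (y - 1).
have u0 : 0 < u.
  rewrite /u; have [->|aN1] := eqVneq a 1; first lra.
  have : a < 1 by rewrite lt_neqAle aN1.
  nra.
rewrite /powR gt_eqF// -[leRHS]lnK ?posrE// ler_expR.
have h1 : ln y - ln u <= y / u - 1.
  by rewrite -ln_div ?posrE//; apply/ln_le_subr1/divr_gt0.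
have h2 : - ln u <= u^-1 - 1.
  by rewrite -lnV ?posrE//; apply/ln_le_subr1; rewrite invr_gt0.
have h3 : a * (y / u - 1) + (1 - a) * (u^-1 - 1) = 0.
  rewrite (_ : _ + _ = (1 + a * (y - 1)) / u - 1); last by field; rewrite gt_eqF.
  by rewrite -/u divff ?subrr// gt_eqF.
have h1' : a * (ln y - ln u) <= a * (y / u - 1) by rewrite ler_wpM2l.
have h2' : (1 - a) * (- ln u) <= (1 - a) * (u^-1 - 1).
  by rewrite ler_wpM2l// subr_ge0.
lra.
Qed.

(** Split off one factor: (1 + t) (1 + t)^(q - 1) <= (1 + t) (1 + (q - 1) t), and q - 1 <= 1 bounds
    the quadratic coefficient. *)
Lemma powR_le_quadratic t q : 1 <= q <= 2 -> -1 <= t ->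
  (1 + t) `^ q <= 1 + q * t + t ^+ 2.
Proof.
move=> /andP[q1 q2] t1; have t0 : 0 <= 1 + t by lra.
rewrite (_ : q = 1 + (q - 1)); last ring.
rewrite powRD; last first.
  by apply/implyP => /eqP ?; exfalso; lra.
rewrite powRr1//.
have q01 : 0 <= q - 1 <= 1 by apply/andP; split; lra.
have /(ler_wpM2l t0) := @powR_le_Bernoulli (1 + t) (q - 1) q01 t0.
have : 0 <= t ^+ 2 by exact: sqr_ge0.
set p := _ `^ _; nra.
Qed.

Lemma powR_pred q v : 1 < q -> 0 <= v -> v `^ q = v `^ (q - 1) * v.
Proof.
move=> q1 v0; rewrite -[X in _ * X]powRr1// -powRD; first by congr powR; ring.
by apply/implyP => /eqP ?; exfalso; lra.
Qed.

Lemma ler_powRl q x y : 0 <= q -> 0 <= x -> x <= y -> x `^ q <= y `^ q.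
Proof.
by move=> q0 x0 xy; apply: ge0_ler_powR; rewrite ?nnegrE//; exact: le_trans xy.
Qed.

(** Here [m] stands for a martingale term and [r] for the squared noise that controls it, so the
    first-order term in [m] must be kept exactly. If r <= v, expand at [v]: the remainder v^(q-2) (m
    + r)^2 is of order v^(q-1) r. If v < r, then |m| <= c r and every term is of order r^q. *)
Lemma powR_perturb (c : R) q v m r : 1 < q <= 2 -> 0 <= c -> 0 <= v -> 0 <= r ->
  m ^+ 2 <= c ^+ 2 * (v * r) -> 0 <= v + m + r ->
  (v + m + r) `^ q <= v `^ q + q * v `^ (q - 1) * m
     + ((2 + c) ^+ 2 + 2 * c ^+ 2 + 2 * c + 4) * (v `^ (q - 1) * r + r `^ q).
Proof.
move=> /andP[q1 q2] c0 v0 r0 hm s0.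
have q0 : 0 <= q by lra.
have pv := powR_ge0 v (q - 1); have pr := powR_ge0 r q.
have [rv|vr] := leP r v.
  have [v_eq0|vN0] := eqVneq v 0.
    have r00 : r = 0 by apply/le_anti; rewrite r0 andbT -v_eq0.
    have m0 : m = 0 by apply/eqP; rewrite -sqrf_eq0 eq_le sqr_ge0 andbT (le_trans hm)// r00 !mulr0.
    by rewrite r00 m0 v_eq0 !addr0 !mulr0 !addr0 powR0 ?mulr0 ?addr0//; lra.
  have vp : 0 < v by rewrite lt_neqAle eq_sym vN0.
  pose t := (m + r) / v.
  have vt : v * t = m + r by rewrite /t mulrCA divff// mulr1.
  have t1 : -1 <= t by rewrite -(ler_pM2l vp) vt; lra.
  have -> : v + m + r = v * (1 + t) by rewrite mulrDr vt mulr1 addrA.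
  rewrite powRM//; last lra.
  have /(ler_wpM2l (powR_ge0 v q)) := @powR_le_quadratic t q (introT andP (conj (ltW q1) q2)) t1.
  move=> /le_trans; apply.
  rewrite (@powR_pred q v)//.
  set p := v `^ (q - 1) in pv *.
  have -> : p * v * (1 + q * t + t ^+ 2) = p * (v + q * (v * t) + (v * t) * t) by ring.
  rewrite vt.
  have h : (m + r) * t <= (2 * c ^+ 2 + 2) * r.
    rewrite -(ler_pM2l vp) (_ : v * _ = (m + r) * (v * t)); last ring.
    rewrite vt.
    have : r * r <= v * r by rewrite ler_wpM2r.
    have := sqr_ge0 (m - r); nra.
  have := ler_wpM2l pv h.
  have prr : 0 <= p * r by rewrite mulr_ge0.
  have : 0 <= ((2 + c) ^+ 2 + 2 * c) * (p * r) by rewrite mulr_ge0// addr_ge0 ?sqr_ge0//; lra.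
  have : 0 <= ((2 + c) ^+ 2 + 2 * c ^+ 2 + 2 * c + 4) * r `^ q.
    by rewrite mulr_ge0// !addr_ge0 ?sqr_ge0 ?mulr_ge0 ?sqr_ge0//; lra.
  nra.
have mb : `|m| <= c * r.
  rewrite -(@ler_sqr R) ?nnegrE ?mulr_ge0//  real_normK ?num_real//.
  rewrite (le_trans hm)// exprMn ler_wpM2l ?sqr_ge0// expr2 ler_wpM2r// ltW//.
have [m1 m2] : m <= c * r /\ - m <= c * r by split; rewrite (le_trans _ mb)// ?ler_norm// -normrN ler_norm.
have h1 : (v + m + r) `^ q <= (2 + c) ^+ 2 * r `^ q.
  apply: (@le_trans _ _ (((2 + c) * r) `^ q)); first by apply: ler_powRl => //; nra.
  rewrite powRM//; last lra.
  rewrite ler_wpM2r// -powR_mulrn; last lra.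
  by apply: ler_powR => //; lra.
have h2 : - (q * v `^ (q - 1) * m) <= 2 * c * r `^ q.
  rewrite -mulrN (@le_trans _ _ (q * v `^ (q - 1) * (c * r)))//.
    by rewrite ler_wpM2l// mulr_ge0.
  rewrite (@powR_pred q r)//.
  have : v `^ (q - 1) <= r `^ (q - 1) by apply: ler_powRl => //; [lra|exact: ltW].
  set p := v `^ (q - 1) in pv *; set p' := r `^ (q - 1) => pp.
  have e1 : p * (c * r) <= p' * (c * r) by rewrite ler_wpM2r// mulr_ge0.
  have e0 : 0 <= p * (c * r) by rewrite !mulr_ge0.
  have : q * (p * (c * r)) <= 2 * (p * (c * r)) by rewrite ler_wpM2r.
  nra.
have : 0 <= v `^ q by exact: powR_ge0.
have : 0 <= v `^ (q - 1) * r by rewrite mulr_ge0.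
set p := v `^ (q - 1) in pv h2 *; set pq := r `^ q in pr h1 h2 *.
have : 0 <= (2 + c) ^+ 2 by exact: sqr_ge0.
have : 0 <= c ^+ 2 by exact: sqr_ge0.
move: ((2 + c) ^+ 2) (c ^+ 2) h1 => C1 C2; nra.
Qed.

(** According to whether y <= eta v or not, one of the two terms on the right is already enough. *)
Lemma young_powR q v y (eta : R) : 1 < q -> 0 <= v -> 0 <= y -> 0 < eta ->
  v `^ (q - 1) * y <= eta * v `^ q + eta `^ (1 - q) * y `^ q.
Proof.
move=> q1 v0 y0 e0.
have pv := powR_ge0 v (q - 1).
have [h|h] := leP y (eta * v).
  apply: (@le_trans _ _ (eta * v `^ q)); last by rewrite lerDl mulr_ge0 ?powR_ge0.
  by rewrite (@powR_pred q v)// mulrCA ler_wpM2l.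
have vb : v <= y / eta by rewrite ler_pdivlMr// mulrC ltW.
apply: (@le_trans _ _ (eta `^ (1 - q) * y `^ q)); last by rewrite lerDr mulr_ge0 ?powR_ge0 ?ltW.
rewrite (@powR_pred q y)// mulrA ler_wpM2r//.
apply: (@le_trans _ _ ((y / eta) `^ (q - 1))); first by apply: ler_powRl => //; lra.
rewrite powRM ?invr_ge0 ?(ltW e0)// mulrC ler_wpM2r ?powR_ge0//.
by rewrite -powR_inv1 ?(ltW e0)// -powRrM (_ : -1 * (q - 1) = 1 - q)//; ring.
Qed.

Lemma powR_add_le q x y : 1 <= q <= 2 -> 0 <= x -> 0 <= y ->
  (x + y) `^ q <= 4 * (x `^ q + y `^ q).
Proof.
move=> /andP[q1 q2] x0 y0; have q0 : 0 <= q by lra.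
have two : (2 : R) `^ q <= 4.
  rewrite (@le_trans _ _ ((2 : R) `^ 2%:R))//; first by apply: ler_powR; lra.
  by rewrite powR_mulrn//; lra.
wlog xy : x y x0 y0 / x <= y.
  move=> H; have [/H|/ltW/H] := leP x y; first exact.
  by rewrite addrC [X in 4 * X]addrC; apply.
apply: (@le_trans _ _ ((2 * y) `^ q)); first by apply: ler_powRl => //; lra.
rewrite powRM//.
apply: (@le_trans _ _ (4 * y `^ q)); first by rewrite ler_wpM2r ?powR_ge0.
by rewrite ler_wpM2l// lerDr powR_ge0.
Qed.

Lemma powR_sum_le (I : finType) q (x : I -> R) : 1 <= q <= 2 -> (forall i, 0 <= x i) ->
  (\sum_i x i) `^ q <= #|I|%:R ^+ 2 * \sum_i x i `^ q.
Proof.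
move=> /andP[q1 q2] x0; have q0 : 0 <= q by lra.
have [i0 _|I0] := pickP (@predT I); last first.
  rewrite !big_pred0// mulr0 powR0//; lra.
pose j := [arg max_(i > i0) x i]%O.
have jmax i : x i <= x j by rewrite /j; case: arg_maxP => // k _; apply.
have sj : \sum_i x i <= #|I|%:R * x j.
  apply: (@le_trans _ _ (\sum_(i : I) x j)); first exact: ler_sum.
  by rewrite sumr_const mulr_natl.
have c1 : 1 <= #|I|%:R :> R by rewrite ler1n; apply/card_gt0P; exists i0.
apply: (@le_trans _ _ ((#|I|%:R * x j) `^ q)); first by apply: ler_powRl => //; exact: sumr_ge0.
rewrite powRM//; apply: ler_pM; rewrite ?powR_ge0//.
  by rewrite -powR_mulrn//; apply: ler_powR.
by rewrite (bigD1 j)//= lerDl sumr_ge0// => i _; exact: powR_ge0.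
Qed.

(** Convexity of z^(-s), with the tangent at the larger point [y]; the left side is then a term of a
    Riemann sum taken at right end points, and the right side telescopes. *)
Lemma subpow_le (s x y : R) : 0 < s -> 0 < x -> x <= y ->
  s * (y - x) * y `^ (- 1 - s) <= x `^ (- s) - y `^ (- s).
Proof.
move=> s0 x0 xy; have y0 : 0 < y := lt_le_trans x0 xy.
have yE : y `^ (- s) = y * y `^ (- 1 - s).
  rewrite -[X in X * _]powRr1 ?(ltW y0)// -powRD; first by congr powR; ring.
  by rewrite (gt_eqF y0) implybT.
have xE : x `^ (- s) = y `^ (- s) * expR (s * (ln y - ln x)).
  rewrite /powR !gt_eqF// -expRD; congr expR; ring.
have h : 1 + s * (1 - x / y) <= expR (s * (ln y - ln x)).
  apply: le_trans (expR_ge1Dx _); rewrite lerD2l ler_wpM2l ?(ltW s0)//.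
  have : ln (x / y) <= x / y - 1 by apply: ln_le_subr1; exact: divr_gt0.
  by rewrite ln_div ?posrE//; lra.
have h' := ler_wpM2l (powR_ge0 y (- s)) h.
rewrite xE; apply: (@le_trans _ _ (y `^ (- s) * (1 + s * (1 - x / y)) - y `^ (- s))); last lra.
rewrite yE le_eqVlt; apply/orP; left; apply/eqP; field; rewrite gt_eqF//.
Qed.

End RealInequalities.

(** * The Laplace distribution function *)

Section Laplace.
Variable R : realType.
Implicit Types (t x y K : R).

Lemma addr_inv_ge2 x : 0 < x -> 2 <= x + x^-1.
Proof.
move=> x0; have xV : x * x^-1 = 1 by rewrite divff ?gt_eqF.
rewrite -(ler_pM2l x0) [leRHS]mulrDr xV; have := sqr_ge0 (x - 1); nra.
Qed.

Lemma lapF_ge0 x : 0 <= lapF x.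
Proof.
rewrite /lapF; case: ltP => [_|x0]; first by rewrite divr_ge0 ?expR_ge0.
have : expR (- x) <= 1 by rewrite expR_le1; lra.
lra.
Qed.

Lemma lapF_le1 x : lapF x <= 1.
Proof.
rewrite /lapF; case: ltP => [/ltW x0|_]; last by have := expR_ge0 (- x); lra.
have : expR x <= 1 by rewrite expR_le1.
lra.
Qed.

Lemma lapF_le_expR x : lapF x <= expR x / 2.
Proof.
rewrite /lapF; case: ltP => // x0.
have := addr_inv_ge2 (expR x) (expR_gt0 x); rewrite expRN; lra.
Qed.

(** The density is at most e^x / 2. Comparing with increments of the exponential, rather than with y
    - x, lets a shift by the threshold come out later as a factor. *)
Lemma lapF_diff x y : x <= y -> 0 <= lapF y - lapF x <= (expR y - expR x) / 2.
Proof.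
move=> xy.
have xp := expR_gt0 x; have yp := expR_gt0 y.
have exy : expR x <= expR y by rewrite ler_expR.
rewrite /lapF; case: (ltP x 0) => x0; case: (ltP y 0) => y0; rewrite ?expRN.
- by apply/andP; split; lra.
- have := addr_inv_ge2 (expR y) yp.
  have : expR x < 1 by rewrite expR_lt1.
  have : (expR y)^-1 <= 1 by rewrite -expRN expR_le1; lra.
  by move=> *; apply/andP; split; lra.
- lra.
- have y1 : (expR y)^-1 <= 1 by rewrite -expRN expR_le1; lra.
  have x1 : (expR x)^-1 <= 1 by rewrite -expRN expR_le1; lra.
  have y10 : 0 <= (expR y)^-1 by rewrite invr_ge0 ltW.
  have x10 : 0 <= (expR x)^-1 by rewrite invr_ge0 ltW.
  have -> : 1 - (expR y)^-1 / 2 - (1 - (expR x)^-1 / 2) =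
    (expR y - expR x) / 2 * ((expR y)^-1 * (expR x)^-1) by field; rewrite !gt_eqF.
  have d0 : 0 <= (expR y - expR x) / 2 by lra.
  apply/andP; split; first by rewrite mulr_ge0// mulr_ge0.
  by rewrite ler_piMr// mulr_ile1.
Qed.

(** The ratio of the density to e^x / 2 is 1 for negative x and e^(-2x) otherwise, hence at least
    e^(-2K) up to K. *)
Lemma lapF_diff_lb K x y : 0 <= K -> x <= y -> y <= K ->
  expR (- (2 * K)) * ((expR y - expR x) / 2) <= lapF y - lapF x.
Proof.
move=> K0 xy yK.
have xp := expR_gt0 x; have yp := expR_gt0 y.
have exy : expR x <= expR y by rewrite ler_expR.
have k1 : expR (- (2 * K)) <= 1 by rewrite expR_le1; lra.
have k0 := expR_gt0 (- (2 * K)).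
rewrite /lapF; case: (ltP x 0) => x0; case: (ltP y 0) => y0.
- have -> : expR y / 2 - expR x / 2 = (expR y - expR x) / 2 by ring.
  by rewrite ler_piMl//; lra.
- have e1 : expR x < 1 by rewrite expR_lt1.
  have e2 : expR (- (2 * K)) <= expR (- y) by rewrite ler_expR; lra.
  have e3 : 1 - expR (- y) = (expR y - 1) * expR (- y).
    by rewrite mulrBl expRxMexpNx_1; ring.
  have e4 : 0 <= expR y - 1 by rewrite subr_ge0 -(@expR0 R) ler_expR.
  nra.
- lra.
- have e2 : expR (- (2 * K)) <= expR (- y) * expR (- x) by rewrite -expRD ler_expR; lra.
  have -> : 1 - expR (- y) / 2 - (1 - expR (- x) / 2) =
    expR (- y) * expR (- x) * ((expR y - expR x) / 2).
    by rewrite !expRN; field; rewrite !gt_eqF.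
  by rewrite ler_wpM2r//; lra.
Qed.

(** In units of [b], with threshold [t = nu * ln k]: [scG t y] is the mean of the received bit,
    counted as 0 when nothing is sent, and [sendp t y] is the probability that a bit is sent. *)
Definition scG t y := lapF (y - t) - lapF (- y - t).
Definition sendp t y := lapF (y - t) + lapF (- y - t).

Lemma sendp_ge0 t y : 0 <= sendp t y.
Proof. by rewrite addr_ge0 ?lapF_ge0. Qed.

Lemma scG_sqr_le t y : scG t y ^+ 2 <= sendp t y.
Proof.
rewrite /scG /sendp; have := lapF_ge0 (y - t); have := lapF_ge0 (- y - t).
have := lapF_le1 (y - t); have := lapF_le1 (- y - t); nra.
Qed.

Lemma scG_norm_le1 t y : `|scG t y| <= 1.
Proof.
rewrite ler_norml /scG; have := lapF_ge0 (y - t); have := lapF_ge0 (- y - t).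
have := lapF_le1 (y - t); have := lapF_le1 (- y - t).
by move=> *; apply/andP; split; lra.
Qed.

Lemma sendp_le2 t y : sendp t y <= 2.
Proof. by rewrite /sendp; have := lapF_le1 (y - t); have := lapF_le1 (- y - t); lra. Qed.

(** For t = nu ln k the factor [expR (- t)] is k^(-nu). This rarity of messages turns the variance
    alpha^2 = beta^2 k^(2 nu) into beta^2 k^nu. *)
Lemma sendp_ub K t y : `|y| <= K -> sendp t y <= expR K * expR (- t).
Proof.
rewrite ler_norml => /andP[y1 y2].
have h1 := lapF_le_expR (y - t); have h2 := lapF_le_expR (- y - t).
have : expR (y - t) <= expR K * expR (- t) by rewrite -expRD ler_expR; lra.
have : expR (- y - t) <= expR K * expR (- t) by rewrite -expRD ler_expR; lra.
rewrite /sendp; lra.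
Qed.

Lemma scG_homo t x y : x <= y -> scG t x <= scG t y.
Proof.
move=> xy; rewrite /scG.
have /andP[+ _] : 0 <= lapF (y - t) - lapF (x - t) <= (expR (y - t) - expR (x - t)) / 2.
  by apply: lapF_diff; lra.
have /andP[+ _] : 0 <= lapF (- x - t) - lapF (- y - t) <= (expR (- x - t) - expR (- y - t)) / 2.
  by apply: lapF_diff; lra.
lra.
Qed.

Lemma scG_monotone t x y : 0 <= (y - x) * (scG t y - scG t x).
Proof.
have [xy|/ltW yx] := leP x y; first by apply: mulr_ge0; rewrite subr_ge0//; exact: scG_homo.
rewrite -(opprB x y) -(opprB (scG t x)) mulrNN; apply: mulr_ge0; rewrite subr_ge0//; exact: scG_homo.
Qed.

Lemma expR_diff_ub K x y : x <= y -> y <= K -> expR y - expR x <= expR K * (y - x).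
Proof.
move=> xy yK; have -> : expR y - expR x = expR y * (1 - expR (x - y)).
  by rewrite mulrBr mulr1 -expRD addrCA subrr addr0.
have := expR_ge1Dx (x - y); have : expR y <= expR K by rewrite ler_expR.
have := expR_gt0 y.
set E := expR (x - y); set e := expR y; set F := expR K => e0 eF h.
apply: (@le_trans _ _ (e * (y - x))); first by rewrite ler_pM2l//; lra.
by rewrite ler_wpM2r// subr_ge0.
Qed.

Lemma expR_diff_lb K x y : x <= y -> - K <= x -> expR (- K) * (y - x) <= expR y - expR x.
Proof.
move=> xy Kx; have -> : expR y - expR x = expR x * (expR (y - x) - 1).
  by rewrite mulrBr mulr1 -expRD addrCA subrr addr0.
have := expR_ge1Dx (y - x); have : expR (- K) <= expR x by rewrite ler_expR.
move=> e1 e2; apply: (@le_trans _ _ (expR x * (y - x))).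
  by rewrite ler_wpM2r// subr_ge0.
by rewrite ler_pM2l ?expR_gt0//; lra.
Qed.

Lemma scG_lipschitz K t x y : `|x| <= K -> `|y| <= K ->
  `|scG t y - scG t x| <= expR K * expR (- t) * `|y - x|.
Proof.
wlog xy : x y / x <= y.
  move=> H hx hy; have [xy|/ltW yx] := leP x y; first exact: H.
  by rewrite distrC [X in _ * X]distrC; exact: H.
rewrite ler_norml => /andP[x1 x2]; rewrite ler_norml => /andP[y1 y2].
rewrite !ger0_norm ?subr_ge0 ?scG_homo//.
have /andP[_ h1] : 0 <= lapF (y - t) - lapF (x - t) <= (expR (y - t) - expR (x - t)) / 2.
  by apply: lapF_diff; lra.
have /andP[_ h2] : 0 <= lapF (- x - t) - lapF (- y - t) <= (expR (- x - t) - expR (- y - t)) / 2.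
  by apply: lapF_diff; lra.
have h3 : expR (y - t) - expR (x - t) <= expR (K - t) * (y - t - (x - t)).
  by apply: expR_diff_ub; lra.
have h4 : expR (- x - t) - expR (- y - t) <= expR (K - t) * (- x - t - (- y - t)).
  by apply: expR_diff_ub; lra.
have eE : expR K * expR (- t) = expR (K - t) by rewrite -expRD.
rewrite eE /scG; move: h1 h2 h3 h4; set E := expR (K - t).
set a := lapF (y - t); set b := lapF (x - t); set c := lapF (- y - t); set d := lapF (- x - t).
set a' := expR (y - t); set b' := expR (x - t); set c' := expR (- y - t); set d' := expR (- x - t).
lra.
Qed.

(** Together with [scG_lipschitz]: on [-K, K] the slope of [scG t] is of exact order [expR (- t)].
    The constant collects e^(-2K) from [lapF_diff_lb] and e^(-K) from [expR_diff_lb]; t >= 0 keeps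
    the shifted arguments below K. *)
Lemma scG_strong_monotone K t x y : 0 <= t -> `|x| <= K -> `|y| <= K ->
  expR (- (3 * K)) * expR (- t) * (y - x) ^+ 2 <= (y - x) * (scG t y - scG t x).
Proof.
move=> t0.
wlog xy : x y / x <= y.
  move=> H hx hy; have [xy|/ltW yx] := leP x y; first exact: H.
  by rewrite -(opprB x y) -(opprB (scG t x)) mulrNN sqrrN; exact: H.
rewrite ler_norml => /andP[x1 x2]; rewrite ler_norml => /andP[y1 y2].
have K0 : 0 <= K by lra.
have h1 : expR (- (2 * K)) * ((expR (y - t) - expR (x - t)) / 2) <= lapF (y - t) - lapF (x - t).
  by apply: lapF_diff_lb; lra.
have h2 : expR (- (2 * K)) * ((expR (- x - t) - expR (- y - t)) / 2) <= lapF (- x - t) - lapF (- y - t).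
  by apply: lapF_diff_lb; lra.
have h3 : expR (- (K + t)) * (y - t - (x - t)) <= expR (y - t) - expR (x - t).
  by apply: expR_diff_lb; lra.
have h4 : expR (- (K + t)) * (- x - t - (- y - t)) <= expR (- x - t) - expR (- y - t).
  by apply: expR_diff_lb; lra.
have eE : expR (- (3 * K)) * expR (- t) = expR (- (2 * K)) * expR (- (K + t)).
  by rewrite -!expRD; congr expR; ring.
have k0 := expR_gt0 (- (2 * K)).
rewrite eE expr2 (_ : _ * _ * (_ * _) = (y - x) * (expR (- (2 * K)) * expR (- (K + t)) * (y - x))); last ring.
rewrite ler_wpM2l ?subr_ge0//.
have h3' := ler_wpM2l (ltW k0) h3; have h4' := ler_wpM2l (ltW k0) h4.
rewrite /scG; nra.
Qed.

End Laplace.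

(** * Convergent sums of Riemann and Bertrand type *)

Section Sums.
Variable R : realType.

(** Telescoping of [subpow_le] along a nondecreasing sequence; [l k = k + 1] gives the Riemann sums
    and [l k = lg (k + 1)] the Bertrand sums. *)
Lemma sum_increments_powR_le (s : R) (l : nat -> R) n : 0 < s -> 0 < l 0%N ->
  (forall k, l k <= l k.+1) ->
  \sum_(0 <= k < n) (l k.+1 - l k) * l k.+1 `^ (- 1 - s) <= l 0%N `^ (- s) / s.
Proof.
move=> s0 l0 lnd.
have lp k : 0 < l k by elim: k => // k /lt_le_trans; apply.
have : s * \sum_(0 <= k < n) (l k.+1 - l k) * l k.+1 `^ (- 1 - s) <= l 0%N `^ (- s) - l n `^ (- s).
  elim: n => [|n IH]; first by rewrite big_nil mulr0 subrr.
  rewrite big_nat_recr//= mulrDr mulrA.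
  have := @subpow_le R s (l n) (l n.+1) s0 (lp n) (lnd n); lra.
rewrite ler_pdivlMr// mulrC => /le_trans; apply.
by rewrite gerBl powR_ge0.
Qed.

(** The shift by 1 keeps powers and quotients of the logarithm harmless at k = 0 and k = 1; at 0 the
    default [ln 0 = 0] gives [lg 0 = 1]. *)
Definition lg (k : nat) : R := 1 + ln k%:R.

Lemma lg_ge1 k : 1 <= lg k.
Proof.
by rewrite lerDl; case: k => [|k]; [rewrite ln0|apply: ln_ge0; rewrite ler1n].
Qed.

Lemma lg_gt0 k : 0 < lg k. Proof. exact: lt_le_trans ltr01 (lg_ge1 k). Qed.

Lemma lg_le k m : (k <= m)%N -> lg k <= lg m.
Proof.
case: k => [|k] km; first by rewrite {1}/lg ln0// addr0 lg_ge1.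
by rewrite lerD2l ler_ln ?posrE ?ltr0n ?ler_nat//; exact: leq_trans km.
Qed.

Lemma lgS_sub k : (0 < k)%N -> k.+1%:R^-1 <= lg k.+1 - lg k.
Proof.
move=> k0.
have kp : 0 < k%:R :> R by rewrite ltr0n.
have kp1 : 0 < k.+1%:R :> R by rewrite ltr0n.
have := @ln_le_subr1 R (k%:R / k.+1%:R) (divr_gt0 kp kp1).
rewrite ln_div ?posrE// /lg.
have -> : k%:R / k.+1%:R - 1 = - k.+1%:R^-1 :> R.
  by rewrite -{1}(addrK 1 k%:R) natr1 mulrBl divff ?gt_eqF// addrAC subrr add0r mul1r.
by rewrite lerNr opprB opprD addrACA subrr add0r.
Qed.

Lemma sum_lg_le (s : R) n : 0 < s ->
  \sum_(0 <= k < n) k.+2%:R^-1 * lg k.+2 `^ (- 1 - s) <= s^-1.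
Proof.
move=> s0.
have := @sum_increments_powR_le s (fun k => lg k.+1) n s0 (lg_gt0 _) (fun k => lg_le _ _ (leqnSn _)).
rewrite {4}/lg ln1 addr0 powR1 mul1r; apply: le_trans.
by apply: ler_sum => k _; rewrite ler_wpM2r ?powR_ge0 ?lgS_sub.
Qed.

Lemma sum_riemann_le (s : R) n : 0 < s ->
  \sum_(0 <= k < n) k.+2%:R `^ (- 1 - s) <= s^-1.
Proof.
move=> s0.
have le k : k.+1%:R <= k.+2%:R :> R by rewrite ler_nat.
have := @sum_increments_powR_le s (fun k => k.+1%:R) n s0 (ltr0Sn _ _) le.
rewrite powR1 mul1r; apply: le_trans.
by apply: ler_sum => k _; rewrite -(natr1 k.+1) addrAC subrr add0r mul1r natr1.
Qed.

End Sums.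

(** * Almost supermartingales *)

(** Measurability for the sub-sigma-algebra generated by [G], expressed by retyping the domain so
    that the general calculus of measurable functions applies to it. *)
Definition gfun {R : realType} {d : measure_display} {T : measurableType d}
    (G : set (set T)) (X : T -> R) :=
  measurable_fun [set: g_sigma_algebraType G] (X : g_sigma_algebraType G -> R).

Section Generated.
Context {R : realType} {d : measure_display} {T : measurableType d}.
Variable P : probability T R.
Implicit Types (G : set (set T)) (X Y : T -> R).

Lemma gen_measurable G : G `<=` measurable -> <<s G >> `<=` measurable.
Proof. exact: (smallest_sub (@sigma_algebra_measurable _ T)). Qed.

Lemma gfun_measurable G X : G `<=` measurable -> gfun G X -> measurable_fun setT X.
Proof. by move=> /gen_measurable Gm mX mT B mB; apply: Gm; exact: mX. Qed.

Lemma gfun_preimage G X (B : set R) : gfun G X -> measurable B -> <<s G >> (X @^-1` B).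
Proof. by move=> mX mB; rewrite -[_ @^-1` _]setTI; apply: (mX measurableT B mB). Qed.

Lemma genI G (A B : set T) : <<s G >> A -> <<s G >> B -> <<s G >> (A `&` B).
Proof. exact: (@measurableI _ (g_sigma_algebraType G)). Qed.

Lemma boundedE X (A : set T) (c : R) :
  (forall om, A om -> `|X om| <= c) -> [bounded X om | om in A].
Proof. by move=> h; exists c; split; [exact: num_real|move=> M /ltW cM om Aom; exact: le_trans (h _ Aom) cM]. Qed.

Lemma integrableM_bounded (A : set T) X Y (c : R) : measurable A ->
  measurable_fun A X -> (forall om, A om -> `|X om| <= c) ->
  P.-integrable A (EFin \o Y) -> P.-integrable A (EFin \o (fun om => X om * Y om)).
Proof.
move=> mA mX /boundedE bX iY.
by have := integrableMr mA mX bX iY; apply: eq_integrable.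
Qed.

Lemma Rintegral_eq0 (A : set T) Y :
  (\int[P]_(om in A) (Y om)%:E = 0)%E -> \int[P]_(om in A) Y om = 0.
Proof. by rewrite /Rintegral => ->. Qed.

Lemma measurable_gfun_split G (A : set T) X : <<s G >> A -> gfun G X ->
  <<s G >> (A `&` [set om | 0 <= X om]) /\ <<s G >> (A `&` [set om | X om < 0]).
Proof.
move=> GA mX; split; apply: genI => //.
- rewrite (_ : [set om | _] = X @^-1` `[0, +oo[); first exact: gfun_preimage.
  by apply/seteqP; split=> om /=; rewrite in_itv/= andbT.
- rewrite (_ : [set om | _] = X @^-1` `]-oo, 0[); first exact: gfun_preimage.
  by apply/seteqP; split=> om /=; rewrite in_itv/=.
Qed.

(* Each step replaces X by X - (c/2) sgn X, which halves the bound and does not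
   change the integral, since the sign of X is G-measurable. *)
Lemma cond_zero_mul G X Y (c : R) (B : set T) : G `<=` measurable ->
  P.-integrable setT (EFin \o Y) ->
  (forall A, <<s G >> A -> (\int[P]_(om in A) (Y om)%:E = 0)%E) ->
  gfun G X -> <<s G >> B -> (forall om, B om -> `|X om| <= c) ->
  \int[P]_(om in B) (X om * Y om) = 0.
Proof.
move=> Gm iY Y0 mX GB Xc.
have mB : measurable B by exact: gen_measurable GB.
have iYB : P.-integrable B (EFin \o Y) by apply: integrableS iY.
set E := \int[P]_(om in B) `|Y om|.
have E0 : 0 <= E by apply: Rintegral_ge0.
have half n : forall X c, gfun G X -> (forall om, B om -> `|X om| <= c) ->
    `|\int[P]_(om in B) (X om * Y om)| <= c / 2 ^+ n * E.
  elim: n => [|n IH] X' c' mX' Xc'.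
    rewrite expr0 divr1.
    have iXY : P.-integrable B (EFin \o (fun om => X' om * Y om)).
      apply: (@integrableM_bounded _ _ _ c') => //.
      by apply: measurable_funTS; exact: gfun_measurable mX'.
    apply: (le_trans (le_normr_Rintegral mB iXY)).
    rewrite /E -RintegralZl//; last exact: integrable_norm.
    apply: le_Rintegral => //; first exact: integrable_norm.
    - have := @integrable_norm _ _ _ P B Y iYB.
      by move=> /(integrableZl mB c'); apply: eq_integrable.
    - by move=> om Bom; rewrite normrM ler_wpM2r// Xc'.
  pose X2 om := if 0 <= X' om then X' om - c' / 2 else X' om + c' / 2.
  have mX2 : gfun G X2.
    rewrite /gfun /X2; apply: measurable_fun_ifT => //=.
    - by apply: measurable_fun_ler => //; exact: measurable_cst.
    - by apply: measurable_funB => //; exact: measurable_cst.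
    - by apply: measurable_funD => //; exact: measurable_cst.
  have X2c om : B om -> `|X2 om| <= c' / 2.
    move=> Bom; have := Xc' _ Bom; rewrite /X2 !ler_norml => /andP[h1 h2].
    by case: (leP 0 (X' om)) => h; apply/andP; split; lra.
  have [GB1 GB2] := measurable_gfun_split G B X' GB mX'.
  set B1 := B `&` _ in GB1; set B2 := B `&` _ in GB2.
  have mB1 : measurable B1 by exact: gen_measurable GB1.
  have mB2 : measurable B2 by exact: gen_measurable GB2.
  have BE : B = B1 `|` B2.
    apply/seteqP; split=> om; last by move=> [] [].
    by move=> Bom; case: (leP 0 (X' om)) => h; [left|right]; split.
  have dB : [disjoint B1 & B2].
    apply/disj_set2P/seteqP; split=> om //= [[_ /= h1] [_ /= h2]].
    by have := le_lt_trans h1 h2; rewrite ltxx.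
  have iM Z cz : gfun G Z -> (forall om, B om -> `|Z om| <= cz) -> forall D, measurable D -> D `<=` B ->
      P.-integrable D (EFin \o (fun om => Z om * Y om)).
    move=> mZ Zc D mD DB; apply: (@integrableS _ _ _ _ B) => //.
    apply: (@integrableM_bounded _ _ _ cz) => //.
    by apply: measurable_funTS; exact: gfun_measurable mZ.
  have iYD D : measurable D -> P.-integrable D (EFin \o Y).
    by move=> mD; apply: integrableS iY.
  have iY2 D (r : R) : measurable D -> P.-integrable D (EFin \o (fun om => r * Y om)).
    by move=> mD; have := integrableZl mD r (iYD D mD); apply: eq_integrable.
  have -> : \int[P]_(om in B) (X' om * Y om) = \int[P]_(om in B) (X2 om * Y om).
    have iU Z cz : gfun G Z -> (forall om, B om -> `|Z om| <= cz) ->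
        P.-integrable (B1 `|` B2) (EFin \o (fun om => Z om * Y om)).
      by move=> mZ Zc; rewrite -BE; exact: (iM Z cz).
    rewrite BE !Rintegral_setU//; [|exact: (iU X2 (c' / 2))|exact: (iU X' c')].
    congr (_ + _).
    - rewrite (@eq_Rintegral _ _ _ P B1 (fun om => X2 om * Y om + (c' / 2) * Y om)).
        rewrite RintegralD//.
        + by rewrite RintegralZl ?(@Rintegral_eq0 B1 Y (Y0 _ GB1)) ?mulr0 ?addr0//; exact: iYD.
        + by apply: iM X2c _ mB1 _ => // om [].
        + exact: iY2.
      by move=> om /set_mem[_ /= h]; rewrite /X2 h; ring.
    - rewrite (@eq_Rintegral _ _ _ P B2 (fun om => X2 om * Y om + (- c' / 2) * Y om)).
        rewrite RintegralD//.
        + by rewrite RintegralZl ?(@Rintegral_eq0 B2 Y (Y0 _ GB2)) ?mulr0 ?addr0//; exact: iYD.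
        + by apply: iM X2c _ mB2 _ => // om [].
        + exact: iY2.
      by move=> om /set_mem[_ /= h]; rewrite /X2 leNgt h/=; ring.
  apply: (le_trans (IH X2 (c' / 2) mX2 X2c)).
  by rewrite exprS invfM mulrA.
apply/eqP; rewrite -normr_eq0 eq_le normr_ge0 andbT.
apply/ler_addgt0Pr => _/posnumP[e]; rewrite add0r.
have cE : 0 <= `|c * E| by [].
pose n := Num.truncn (`|c * E| / e%:num).
have h2n : n.+1%:R <= 2 ^+ n.+1 :> R by rewrite -natrX ler_nat ltnW// ltn_expl.
have := half n.+1 X c mX Xc; move=> /le_trans; apply.
rewrite mulrAC ler_pdivrMr ?exprn_gt0//.
apply: (@le_trans _ _ `|c * E|); first exact: ler_norm.
rewrite -ler_pdivrMl// mulrC.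
apply: le_trans h2n; apply/ltW; rewrite /n.
have := truncnS_gt (`|c * E| / e%:num); exact.
Qed.

End Generated.

(** * A maximal inequality for localised almost supermartingales *)

Section Doob.
Context {R : realType} {d : measure_display} {T : measurableType d}.
Variable P : probability T R.
Variables (G : nat -> set (set T)) (A : nat -> set T) (S Z : nat -> T -> R).
Variables (I : finType) (X Y : nat -> I -> T -> R) (e : nat -> R) (M C D : R).
Hypothesis Gm : forall k, G k `<=` measurable.
Hypothesis Gincr : forall k, <<s G k >> `<=` <<s G k.+1 >>.
Hypothesis GA : forall k, <<s G k >> (A k).
Hypothesis Adecr : forall k, A k.+1 `<=` A k.
Hypothesis S0 : forall k om, 0 <= S k om.
Hypothesis GS : forall k, gfun (G k) (S k).
Hypothesis iY : forall k i, P.-integrable setT (EFin \o Y k i).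
Hypothesis Y0 : forall k i B, <<s G k >> B -> (\int[P]_(om in B) (Y k i om)%:E = 0)%E.
Hypothesis GX : forall k i, gfun (G k) (X k i).
Hypothesis Xb : forall k i, exists c : R, forall om, A k om -> `|X k i om| <= c.
Hypothesis Z0 : forall k om, 0 <= Z k om.
Hypothesis mZ : forall k, measurable_fun setT (Z k).
Hypothesis M0 : 0 <= M.
Hypothesis ZM : forall k B, <<s G k >> B -> B `<=` A k ->
  (\int[P]_(om in B) (Z k om)%:E <= M%:E * P B)%E.
Hypothesis e0 : forall k, 0 <= e k.
Hypothesis eC : forall n, \sum_(0 <= k < n) e k <= C.
Hypothesis Sstep : forall k om, A k om ->
  S k.+1 om <= S k om + \sum_i X k i om * Y k i om + e k * (1 + Z k om).
Hypothesis SD : forall om, A 0 om -> S 0 om <= D.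
Hypothesis D0 : 0 <= D.

Let PB k B : <<s G k >> B -> measurable B. Proof. exact: gen_measurable. Qed.

Let iZ k B : <<s G k >> B -> B `<=` A k -> P.-integrable B (EFin \o Z k).
Proof.
move=> GB BA; have mB := PB _ _ GB; apply/integrableP; split.
  by apply/measurable_EFinP; exact: measurable_funTS.
under eq_integral do rewrite /= ger0_norm//.
apply: (le_lt_trans (ZM _ _ GB BA)).
apply: (@le_lt_trans _ _ (M%:E * 1)%E); last by rewrite mule1 ltry.
by rewrite lee_wpmul2l ?lee_fin// probability_le1.
Qed.

Let RintZ k B : <<s G k >> B -> B `<=` A k -> \int[P]_(om in B) Z k om <= M.
Proof.
move=> GB BA; have mB := PB _ _ GB.
rewrite -lee_fin /Rintegral fineK; last by apply: integrable_fin_num => //; exact: iZ.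
apply: (le_trans (ZM _ _ GB BA)).
by rewrite -[leRHS]mule1 lee_wpmul2l ?lee_fin// probability_le1.
Qed.

Let fp (B : set T) : R := fine (P B).

Let fp_ge0 B : 0 <= fp B. Proof. by rewrite /fp fine_ge0// measure_ge0. Qed.

Let fp_le1 B : measurable B -> fp B <= 1.
Proof.
move=> mB; rewrite /fp -lee_fin fineK ?probability_le1//.
by rewrite ge0_fin_numE// (le_lt_trans (probability_le1 _ mB))// ltry.
Qed.

Section level.
Variable lam : R.
Hypothesis lamD : D <= lam.

(** Discrete stopping without stopping times: [below k] says that the path has stayed in the events
    [A] and under the level up to time k, and [exceed k] that the first crossing occurs at time k +
    1. The start needs no test of [S 0], which is at most D <= lam. A crossing at k + 1 does not ask
    for [A k.+1], since [Sstep] only refers to [A k]. *)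
Fixpoint below k : set T := match k with
  | 0 => A 0
  | k.+1 => below k `&` (A k.+1 `&` [set om | S k.+1 om <= lam])
  end.

Definition exceed k : set T := below k `&` [set om | lam < S k.+1 om].

Let belowA k : below k `<=` A k.
Proof. by case: k => [|k] om //= [_ []]. Qed.

Let belowS k om : below k om -> S k om <= lam.
Proof. by case: k => [|k] /=; [move=> /SD /le_trans; apply|move=> [_ []]]. Qed.

Let Gbelow k : <<s G k >> (below k).
Proof.
elim: k => [|k IH]; first exact: (GA 0%N).
apply: genI; first exact: (Gincr k _ IH).
apply: genI; first exact: (GA k.+1).
rewrite (_ : [set om | _] = S k.+1 @^-1` `]-oo, lam]); first exact: gfun_preimage.
by apply/seteqP; split=> om /=; rewrite in_itv.
Qed.

Let Gexceed k : <<s G k.+1 >> (exceed k).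
Proof.
apply: genI; first exact: (Gincr k _ (Gbelow k)).
rewrite (_ : [set om | _] = S k.+1 @^-1` `]lam, +oo[); first exact: gfun_preimage.
by apply/seteqP; split=> om /=; rewrite in_itv/= andbT.
Qed.

Let mS k B : measurable_fun B (S k).
Proof. by apply: measurable_funTS; exact: gfun_measurable (Gm k) (GS k). Qed.

Let iScur k : P.-integrable (below k) (EFin \o S k).
Proof.
have mB := PB _ _ (Gbelow k).
apply: measurable_bounded_integrable => //.
  by rewrite (le_lt_trans (probability_le1 _ mB))// ltry.
by apply: (@boundedE _ _ _ _ _ lam) => om Bom; rewrite ger0_norm//; exact: belowS.
Qed.

Let iXY k i : P.-integrable (below k) (EFin \o (fun om => X k i om * Y k i om)).
Proof.
have mB := PB _ _ (Gbelow k).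
have [c Xc] := Xb k i.
apply: (@integrableM_bounded _ _ _ _ _ _ _ c) => //.
- by apply: measurable_funTS; exact: gfun_measurable (Gm k) (GX k i).
- by move=> om /belowA; exact: Xc.
- exact: integrableS (iY k i).
Qed.

Let bound k om := S k om + \sum_i X k i om * Y k i om + e k * (1 + Z k om).

Let iF k : P.-integrable (below k) (EFin \o (fun om => \sum_i X k i om * Y k i om)).
Proof.
have mB := PB _ _ (Gbelow k).
have := @integrable_sum _ _ _ P _ mB _ (index_enum I) predT _ (fun i _ => iXY k i).
by apply: eq_integrable => // om _ /=; rewrite sumEFin.
Qed.

Let iE k : P.-integrable (below k) (EFin \o (fun om => e k * (1 + Z k om))).
Proof.
have mB := PB _ _ (Gbelow k).
have i1 := @finite_measure_integrable_cst _ _ _ P (below k) 1 mB.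
have := integrableD mB i1 (iZ _ _ (Gbelow k) (@belowA k)).
by move=> /(integrableZl mB (e k)); apply: eq_integrable.
Qed.

Let ibound k : P.-integrable (below k) (EFin \o bound k).
Proof.
have mB := PB _ _ (Gbelow k).
have := integrableD mB (integrableD mB (iScur k) (iF k)) (iE k).
by apply: eq_integrable.
Qed.

(** Integrability passes from time k to k + 1 by domination: on [below k] the nonnegative [S k.+1]
    is under the right-hand side of [Sstep]. *)
Let iSnext k : P.-integrable (below k) (EFin \o S k.+1).
Proof.
have mB := PB _ _ (Gbelow k).
apply: le_integrable (ibound k) => //; first exact/measurable_EFinP.
move=> om Bom /=; rewrite lee_fin.
have h : S k.+1 om <= bound k om by apply/Sstep/belowA.
by rewrite ger0_norm// ger0_norm// (le_trans _ h).
Qed.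

Let step_bound k : \int[P]_(om in below k) S k.+1 om <=
  \int[P]_(om in below k) S k om + e k * (1 + M).
Proof.
have mB := PB _ _ (Gbelow k).
apply: (@le_trans _ _ (\int[P]_(om in below k) bound k om)).
  by apply: le_Rintegral => // om Bom; exact/Sstep/belowA.
rewrite /bound RintegralD//; last first.
  by have := integrableD mB (iScur k) (iF k); apply: eq_integrable.
rewrite RintegralD//.
have -> : \int[P]_(om in below k) (\sum_i X k i om * Y k i om) = 0.
  rewrite /Rintegral (eq_integral (fun om => \sum_i (X k i om * Y k i om)%:E)%E); last first.
    by move=> om _; rewrite sumEFin.
  rewrite integral_sum//; last by move=> i; exact: iXY.
  rewrite big1// => i _.
  have [c Xc] := Xb k i.
  have := @cond_zero_mul _ _ _ P (G k) (X k i) (Y k i) c (below k) (Gm k) (iY k i)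
    (@Y0 k i) (GX k i) (Gbelow k) (fun om h => Xc om (@belowA k om h)).
  rewrite /Rintegral => /eqP; rewrite fine_eq0 ?integrable_fin_num//; last exact: iXY.
  by move/eqP.
rewrite addr0 lerD2l RintegralZl//; last first.
  have i1 := @finite_measure_integrable_cst _ _ _ P (below k) 1 mB.
  by have := integrableD mB i1 (iZ _ _ (Gbelow k) (@belowA k)); apply: eq_integrable.
rewrite ler_wpM2l// RintegralD//; last 2 first.
- exact: finite_measure_integrable_cst.
- exact: iZ (Gbelow k) (@belowA k).
by rewrite Rintegral_cst// mul1r lerD// ?fp_le1// RintZ.
Qed.

Let J k := \int[P]_(om in below k) S k om.

(** Inside [below k], the events [below k.+1] and [exceed k] are disjoint and S exceeds [lam] on the
    second; the paths that leave [A] at k + 1 contribute a nonnegative amount, which is dropped. *)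
Let J_step k : J k.+1 + lam * fp (exceed k) <= J k + e k * (1 + M).
Proof.
have mB := PB _ _ (Gbelow k).
have mB1 := PB _ _ (Gbelow k.+1).
have mE := PB _ _ (Gexceed k).
apply: le_trans (step_bound k).
have dBE : [disjoint below k.+1 & exceed k].
  apply/disj_set2P/seteqP; split=> om //= [[_ [_ /= h1]] [_ /= h2]].
  by have := le_lt_trans h1 h2; rewrite ltxx.
have sub : below k.+1 `|` exceed k `<=` below k by move=> om /= [[]|[]].
have mU : measurable (below k.+1 `|` exceed k) by exact: measurableU.
have iU : P.-integrable (below k.+1 `|` exceed k) (EFin \o S k.+1).
  by apply: integrableS (iSnext k).
apply: (@le_trans _ _ (\int[P]_(om in below k.+1 `|` exceed k) S k.+1 om)).
  rewrite Rintegral_setU// lerD2l -Rintegral_cst//.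
  apply: le_Rintegral => //.
  - exact: finite_measure_integrable_cst.
  - by apply: integrableS iU => // om; right.
  - by move=> om [_ /= /ltW].
rewrite /Rintegral fine_le ?integrable_fin_num//.
apply: ge0_subset_integral => //.
- by apply/measurable_EFinP.
- by move=> om _; rewrite lee_fin.
Qed.

Let J_sum n : J n + lam * \sum_(0 <= k < n) fp (exceed k) <= J 0 + (1 + M) * \sum_(0 <= k < n) e k.
Proof.
elim: n => [|n IH]; first by rewrite !big_nil !mulr0.
by rewrite !big_nat_recr//= !mulrDr; have := J_step n; lra.
Qed.

Lemma exceed_measurable : measurable (\bigcup_k exceed k).
Proof. by apply: bigcupT_measurable => k; exact: PB (Gexceed k). Qed.

Lemma prob_exceed : (lam%:E * P (\bigcup_k exceed k) <= (D + (1 + M) * C)%:E)%E.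
Proof.
have lam0 : 0 <= lam by exact: le_trans lamD.
have mE k := PB _ _ (Gexceed k).
have fpE k : P (exceed k) = (fp (exceed k))%:E.
  by rewrite fineK// ge0_fin_numE// (le_lt_trans (probability_le1 _ (mE k)))// ltry.
have J00 : J 0 <= D.
  have mA0 := PB _ _ (Gbelow 0).
  apply: (@le_trans _ _ (\int[P]_(om in below 0) D)).
    by apply: le_Rintegral => //; exact: finite_measure_integrable_cst.
  by rewrite Rintegral_cst// ler_piMr// fp_le1.
have sumb n : lam * \sum_(0 <= k < n) fp (exceed k) <= D + (1 + M) * C.
  have := J_sum n; have : 0 <= J n by apply: Rintegral_ge0 => om _.
  have : (1 + M) * \sum_(0 <= k < n) e k <= (1 + M) * C by rewrite ler_wpM2l// addr_ge0.
  lra.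
apply: (@le_trans _ _ (lam%:E * \sum_(0 <= k <oo) P (exceed k))%E).
  rewrite lee_wpmul2l ?lee_fin//.
  by apply: measure_sigma_subadditive => //; exact: exceed_measurable.
rewrite -nneseriesZl; last by move=> k _; exact: measure_ge0.
apply: lime_le.
  by apply: is_cvg_nneseries => k _ _; rewrite mule_ge0 ?lee_fin.
apply: nearW => n; rewrite (eq_bigr (fun k => (lam * fp (exceed k))%:E)).
  by rewrite sumEFin lee_fin -mulr_sumr.
by move=> k _; rewrite fpE.
Qed.

Lemma exceed_cover om : (forall k, A k om) -> (exists k, lam < S k om) -> (\bigcup_k exceed k) om.
Proof.
move=> Aom exk; have := ex_minnP exk => -[[|k] hk mink].
  by have := lt_le_trans hk (SD _ (Aom 0%N)); rewrite ltNge lamD.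
exists k => //; split => //.
have : forall j, (j <= k)%N -> below j om.
  elim=> [|j IH] jk //=; split; first exact/IH/ltnW.
  split=> //=; rewrite leNgt; apply/negP => /mink; rewrite ltnNge => /negP; apply.
  exact: leq_trans jk _.
exact.
Qed.

End level.

(** A path that stays in every [A k] and is unbounded crosses every level, and the crossing
    probability is at most Q / lam. Nothing is claimed about paths that leave [A], which is how
    bounds valid only on part of the space are used. *)
Lemma ae_bounded : {ae P, forall om, (forall k, A k om) -> exists K, forall k, S k om <= K}.
Proof.
set Q := D + (1 + M) * C.
have C0 : 0 <= C by have := eC 0; rewrite big_nil.
have Q0 : 0 <= Q by rewrite addr_ge0// mulr_ge0// addr_ge0.
pose lam j := D + j.+1%:R.
have lamD j : D <= lam j by rewrite lerDl.
exists (\bigcap_j \bigcup_k exceed (lam j) k); split.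
- by apply: bigcapT_measurable => j; apply: exceed_measurable.
- apply/eqP; rewrite eq_le measure_ge0 andbT.
  set N := \bigcap_j _.
  have mN : measurable N by apply: bigcapT_measurable => j; apply: exceed_measurable.
  have Nfin : P N \is a fin_num.
    by rewrite ge0_fin_numE// (le_lt_trans (probability_le1 _ mN))// ltry.
  have hN j : j.+1%:R * fine (P N) <= Q.
    have lamj0 : 0 <= lam j by exact: le_trans (lamD j).
    rewrite -lee_fin EFinM fineK//; apply: le_trans (prob_exceed (lam j) (lamD j)).
    apply: lee_pmul => //; rewrite ?lee_fin ?lerDr//.
    apply: le_measure; rewrite ?inE//; first exact: exceed_measurable.
    by move=> om; apply.
  rewrite -(fineK Nfin) lee_fin leNgt; apply/negP => p0.
  have := hN (Num.truncn (Q / fine (P N))).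
  rewrite -ler_pdivlMr// leNgt => /negP; apply; exact: truncnS_gt.
- move=> om /= /not_implyP[Aom nb] j _.
  apply: exceed_cover => //; apply: contrapT => nex; apply: nb; exists (lam j) => k.
  by rewrite leNgt; apply/negP => hk; apply: nex; exists k.
Qed.

End Doob.

(** * Conditional law of the transmitted bits *)

Lemma lapFN {R : realType} (x : R) : lapF (- x) = 1 - lapF x.
Proof.
rewrite /lapF oppr_lt0 opprK; case: (ltgtP x 0) => [h|h|->]; first by [].
- by rewrite opprB addrCA subrr addr0.
- by rewrite oppr0 expR0; lra.
Qed.

Lemma measurable_lapF {R : realType} : measurable_fun [set: R] (@lapF R).
Proof.
rewrite /lapF; apply: measurable_fun_ifT => /=.
- by apply: measurable_fun_ltr => //; exact: measurable_cst.
- by apply: measurable_funM => //; exact: measurable_cst.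
- apply: measurable_funB; first exact: measurable_cst.
  apply: measurable_funM; last exact: measurable_cst.
  by apply: measurableT_comp => //; exact: measurable_funN.
Qed.

Section Freezing.
Context {R : realType} {d : measure_display} {T : measurableType d}.
Variable P : probability T R.
Variables (G : set (set T)) (D : T -> R).
Hypothesis Gm : G `<=` measurable.
Hypothesis mD : measurable_fun setT D.
Hypothesis indep : forall (A : set T) (E : set R), <<s G >> A -> measurable E ->
  P (A `&` D @^-1` E) = (P A * P (D @^-1` E))%E.

Let GT : measurableType _ := g_sigma_algebraType G.

Let idG : T -> GT := id.
Let midG : measurable_fun setT idG.
Proof. by move=> _ A GA; rewrite setTI; exact: (gen_measurable G Gm). Qed.
Let idG_mixin := isMeasurableFun.Build _ _ _ _ _ midG.
Let idGf : {mfun T >-> GT} := HB.pack idG idG_mixin.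
Let D_mixin := isMeasurableFun.Build _ _ _ _ _ mD.
Let Df : {mfun T >-> R} := HB.pack D D_mixin.
Let pr : T -> (GT * R)%type := fun om => (om, D om).
Let mpr : measurable_fun setT pr.
Proof. by apply: measurable_fun_pair. Qed.
Let pr_mixin := isMeasurableFun.Build _ _ _ _ _ mpr.
Let prf : {mfun T >-> (GT * R)%type} := HB.pack pr pr_mixin.

(** Freezing of the past: the identity, seen as a variable with values in T with the sigma-algebra
    of [G], is independent of [D], so the law of the pair is a product measure. Integrating sections
    then averages over [D] with the past held fixed. *)
Lemma indep_fubini (E : set (GT * R)) : measurable E ->
  P [set om | E (om, D om)] = (\int[P]_om P (D @^-1` xsection E om))%E.
Proof.
move=> mE.
transitivity (distribution P prf E) => //.
rewrite -(@product_measure_unique _ _ _ _ _ (distribution P idGf) (distribution P Df)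
  (distribution P prf))//.
rewrite /product_measure1/= ge0_integral_pushforward//.
- by have := measurable_fun_xsection (distribution P Df) mE; apply.
Qed.

Lemma indep_fubini_restr (B : set T) (E : T -> set R) : <<s G >> B ->
  measurable [set z : GT * R | E z.1 z.2] ->
  P (B `&` [set om | E om (D om)]) = (\int[P]_(om in B) P (D @^-1` E om))%E.
Proof.
move=> GB mE.
have mB : measurable B by exact: gen_measurable GB.
have mE' : measurable ((B `*` [set: R] : set (GT * R)) `&` [set z : GT * R | E z.1 z.2]).
  by apply: measurableI => //; apply: measurableX => //.
have := indep_fubini _ mE'.
rewrite (_ : [set om | _] = B `&` [set om | E om (D om)]); last first.
  by apply/seteqP; split=> om /= [] => [[]|].
move=> ->; rewrite [RHS]integral_mkcond; apply: eq_integral => om _.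
rewrite patchE; case: ifPn => [/set_mem Bom|/negP nB].
  congr (P _); apply/seteqP; split=> y /=; rewrite /xsection/= inE/=; first by move=> [].
  by move=> ?; split.
rewrite (_ : _ @^-1` _ = set0) ?measure0//.
apply/seteqP; split=> y //=; rewrite /xsection/= inE/= => -[[Bom _] _].
by apply: nB; exact: mem_set.
Qed.

Hypothesis lawD : forall x, P [set om | D om <= x] = (lapF x)%:E.

Lemma law_gt x : P [set om | x < D om] = (lapF (- x))%:E.
Proof.
rewrite (_ : [set om | _] = ~` [set om | D om <= x]); last first.
  by apply/seteqP; split=> om /=; rewrite ltNge => /negP.
rewrite probability_setC ?lawD ?lapFN//.
rewrite (_ : [set om | _] = D @^-1` `]-oo, x]); last first.
  by apply/seteqP; split=> om /=; rewrite in_itv.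
by rewrite -[_ @^-1` _]setTI; exact: mD.
Qed.

(** The law has no atoms because [lapF] is continuous; the messages sent downwards involve a strict
    inequality. *)
Lemma law_lt x : P [set om | D om < x] = (lapF x)%:E.
Proof.
have m1 : measurable [set om | D om < x].
  rewrite (_ : [set om | _] = D @^-1` `]-oo, x[); last first.
    by apply/seteqP; split=> om /=; rewrite in_itv.
  by rewrite -[_ @^-1` _]setTI; exact: mD.
have m2 y : measurable [set om | D om <= y].
  rewrite (_ : [set om | _] = D @^-1` `]-oo, y]); last first.
    by apply/seteqP; split=> om /=; rewrite in_itv.
  by rewrite -[_ @^-1` _]setTI; exact: mD.
apply/eqP; rewrite eq_le; apply/andP; split.
  rewrite -lawD; apply: le_measure; rewrite ?inE// => om /= /ltW //.
apply/lee_addgt0Pr => e e0.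
(* With this [y], lapF x - lapF y <= (exp x - exp y) / 2 <= exp x (x - y) / 2 = e / 2. *)
pose y := x - e / expR x.
have yx : y < x by rewrite gtrBl divr_gt0// expR_gt0.
apply: (@le_trans _ _ (P [set om | (D om <= y)%R] + e%:E)%E).
  rewrite lawD -EFinD lee_fin.
  have /andP[_ h1] := lapF_diff _ _ _ (ltW yx).
  have h2 := expR_diff_ub _ x y x (ltW yx) (lexx x).
  have h3 : expR x * (x - y) = e by rewrite /y opprB addrCA subrr addr0 mulrC divfK// gt_eqF// expR_gt0.
  have : 0 <= e by exact: ltW.
  lra.
rewrite leeD2r//; apply: le_measure; rewrite ?inE// => om /= h; exact: le_lt_trans yx.
Qed.

Variables (u : T -> R) (b C : R).
Hypothesis Gu : gfun G u.
Hypothesis b0 : 0 < b.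

Let mu : measurable_fun setT (fun z : GT * R => (u : GT -> R) z.1).
Proof. exact: (measurableT_comp Gu measurable_fst). Qed.

Let ms : measurable_fun setT (fun z : GT * R => b * z.2).
Proof. by apply: measurable_funM => //; exact: measurable_cst. Qed.

Let mE1 : measurable [set z : GT * R | C < u z.1 + b * z.2].
Proof.
have h : measurable_fun [set: GT * R] (fun z : GT * R => C < (u : GT -> R) z.1 + b * z.2).
  by apply: measurable_fun_ltr; [exact: measurable_cst|exact: measurable_funD].
by have := h measurableT [set true] Logic.I; rewrite setTI; exact.
Qed.

Let mE2 : measurable [set z : GT * R | u z.1 + b * z.2 < - C].
Proof.
have h : measurable_fun [set: GT * R] (fun z : GT * R => (u : GT -> R) z.1 + b * z.2 < - C).
  by apply: measurable_fun_ltr; [exact: measurable_funD|exact: measurable_cst].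
by have := h measurableT [set true] Logic.I; rewrite setTI; exact.
Qed.

Definition sent_up om : R := (C < u om + b * D om)%R%:R.
Definition sent_down om : R := (u om + b * D om < - C)%R%:R.

Let mu' : measurable_fun setT u. Proof. exact: gfun_measurable Gu. Qed.

Lemma measurable_sent_up : measurable_fun setT sent_up.
Proof.
apply: (measurableT_comp (f := fun b : bool => b%:R : R)) => //.
apply: measurable_fun_ltr; first exact: measurable_cst.
by apply: measurable_funD => //; apply: measurable_funM => //; exact: measurable_cst.
Qed.

Lemma measurable_sent_down : measurable_fun setT sent_down.
Proof.
apply: (measurableT_comp (f := fun b : bool => b%:R : R)) => //.
apply: measurable_fun_ltr; last exact: measurable_cst.
by apply: measurable_funD => //; apply: measurable_funM => //; exact: measurable_cst.
Qed.

Lemma measurable_lapF_up : measurable_fun setT (fun om => lapF ((u om - C) / b)).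
Proof.
apply: (measurableT_comp measurable_lapF).
by apply: measurable_funM => //; exact: measurable_funB.
Qed.

Lemma measurable_lapF_down : measurable_fun setT (fun om => lapF ((- u om - C) / b)).
Proof.
apply: (measurableT_comp measurable_lapF).
apply: measurable_funM => //; apply: measurable_funB => //; exact: measurable_funN.
Qed.

Let integrable01 (B : set T) (f : T -> R) : measurable B -> measurable_fun setT f ->
  (forall om, 0 <= f om <= 1) -> P.-integrable B (EFin \o f).
Proof.
move=> mB mf f01; apply: measurable_bounded_integrable => //.
- by rewrite (le_lt_trans (probability_le1 _ mB))// ltry.
- exact: measurable_funTS.
- by apply: (@boundedE _ _ _ _ _ 1) => om _; have /andP[? ?] := f01 om; rewrite ger0_norm.
Qed.

Let lapF01 (x : R) : 0 <= lapF x <= 1. Proof. by rewrite lapF_ge0 lapF_le1. Qed.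

Let bool01 (x : bool) : 0 <= (x%:R : R) <= 1. Proof. by case: x; rewrite ?lexx ?ler01. Qed.

Lemma integral_bool (B : set T) (p : T -> bool) : measurable B -> measurable [set om | p om] ->
  (\int[P]_(om in B) (p om)%:R%:E = P (B `&` [set om | p om]))%E.
Proof.
move=> mB mp; rewrite (eq_integral (fun om => (\1_[set om | p om] om)%:E)).
  by rewrite integral_indic// setIC.
by move=> om _; rewrite indicE; congr ((nat_of_bool _)%:R%:E); apply/idP/idP => [h|/set_mem//]; exact/mem_set.
Qed.

Lemma integrable_sent_up : P.-integrable setT (EFin \o (fun om => sent_up om - lapF ((u om - C) / b))).
Proof.
have := integrableB measurableT (integrable01 _ _ measurableT measurable_sent_up (fun om => bool01 _))
  (integrable01 _ _ measurableT measurable_lapF_up (fun om => lapF01 _)).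
by apply: eq_integrable.
Qed.

Lemma integrable_sent_down : P.-integrable setT (EFin \o (fun om => sent_down om - lapF ((- u om - C) / b))).
Proof.
have := integrableB measurableT (integrable01 _ _ measurableT measurable_sent_down (fun om => bool01 _))
  (integrable01 _ _ measurableT measurable_lapF_down (fun om => lapF01 _)).
by apply: eq_integrable.
Qed.

Lemma sent_up_cond (B : set T) : <<s G >> B ->
  (\int[P]_(om in B) (sent_up om - lapF ((u om - C) / b))%:E = 0)%E.
Proof.
move=> GB; have mB : measurable B by exact: gen_measurable GB.
have i1 := integrable01 B _ mB measurable_sent_up (fun om => bool01 _).
have i2 := integrable01 B _ mB measurable_lapF_up (fun om => lapF01 _).
have -> : (\int[P]_(om in B) (sent_up om - lapF ((u om - C) / b))%:E =
  \int[P]_(om in B) (sent_up om)%:E - \int[P]_(om in B) (lapF ((u om - C) / b))%:E)%E.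
  by rewrite -integralB.
rewrite /sent_up integral_bool//; last first.
  have := measurable_sent_up measurableT [set 1] (measurable_set1 _).
  rewrite setTI (_ : _ @^-1` _ = [set om | C < u om + b * D om])//.
  by apply/seteqP; split=> om /=; rewrite /sent_up; case: ltP => //= _ /esym/eqP; rewrite oner_eq0.
rewrite (@indep_fubini_restr B (fun om => [set y | C < u om + b * y]) GB mE1).
rewrite (eq_integral (fun om => (lapF ((u om - C) / b))%:E)).
  by rewrite subee// integrable_fin_num.
move=> om _; rewrite (_ : _ @^-1` _ = [set om' | (C - u om) / b < D om']).
  by rewrite law_gt -mulNr opprB.
by apply/seteqP; split=> om' /=; rewrite ltr_pdivrMr// ltrBlDl [D _ * _]mulrC.
Qed.

Lemma sent_down_cond (B : set T) : <<s G >> B ->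
  (\int[P]_(om in B) (sent_down om - lapF ((- u om - C) / b))%:E = 0)%E.
Proof.
move=> GB; have mB : measurable B by exact: gen_measurable GB.
have i1 := integrable01 B _ mB measurable_sent_down (fun om => bool01 _).
have i2 := integrable01 B _ mB measurable_lapF_down (fun om => lapF01 _).
have -> : (\int[P]_(om in B) (sent_down om - lapF ((- u om - C) / b))%:E =
  \int[P]_(om in B) (sent_down om)%:E - \int[P]_(om in B) (lapF ((- u om - C) / b))%:E)%E.
  by rewrite -integralB.
rewrite /sent_down integral_bool//; last first.
  have := measurable_sent_down measurableT [set 1] (measurable_set1 _).
  rewrite setTI (_ : _ @^-1` _ = [set om | u om + b * D om < - C])//.
  by apply/seteqP; split=> om /=; rewrite /sent_down; case: ltP => //= _ /esym/eqP; rewrite oner_eq0.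
rewrite (@indep_fubini_restr B (fun om => [set y | u om + b * y < - C]) GB mE2).
rewrite (eq_integral (fun om => (lapF ((- u om - C) / b))%:E)).
  by rewrite subee// integrable_fin_num.
move=> om _; rewrite (_ : _ @^-1` _ = [set om' | D om' < (- u om - C) / b]).
  by rewrite law_lt.
by apply/seteqP; split=> om' /=; rewrite ltr_pdivlMr// => h; lra.
Qed.

End Freezing.

(** * Integrals over an event independent of the integrand *)

Section IndependentEvent.
Context {R : realType} {d : measure_display} {T : measurableType d}.
Variable P : probability T R.
Variables (G : set (set T)) (D : set T).
Hypothesis Gm : G `<=` measurable.
Hypothesis mD : measurable D.
Hypothesis indep : forall A, <<s G >> A -> P (A `&` D) = (P A * P D)%E.

Let fpE (A : set T) : measurable A -> P A = (fine (P A))%:E.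
Proof.
by move=> mA; rewrite fineK// ge0_fin_numE// (le_lt_trans (probability_le1 _ mA))// ltry.
Qed.

Let integrable_bnd (X : T -> R) (c : R) : measurable_fun setT X -> (forall om, `|X om| <= c) ->
  P.-integrable setT (EFin \o X).
Proof.
move=> mX Xc; apply: measurable_bounded_integrable => //.
- by rewrite (le_lt_trans (probability_le1 _ measurableT))// ltry.
- by apply: (@boundedE _ _ _ _ _ c).
Qed.

(** The centred indicator of [D] integrates to zero over every event of [G], so [cond_zero_mul]
    applies with [X] as multiplier. *)
Lemma indep_integral_bounded (X : T -> R) (c : R) : gfun G X -> (forall om, 0 <= X om <= c) ->
  (\int[P]_(om in D) (X om)%:E = P D * \int[P]_om (X om)%:E)%E.
Proof.
move=> GX X0; have mX : measurable_fun setT X by exact: gfun_measurable GX.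
have Xc om : `|X om| <= c by have /andP[h1 h2] := X0 om; rewrite ger0_norm.
set p := fine (P D).
pose Y om : R := \1_D om - p.
have iD : P.-integrable setT (EFin \o (\1_D : T -> R)) by exact: integrable_indic.
have ip : P.-integrable setT (EFin \o cst p) by exact: finite_measure_integrable_cst.
have iY : P.-integrable setT (EFin \o Y).
  by have := integrableB measurableT iD ip; apply: eq_integrable.
have Y0 A : <<s G >> A -> (\int[P]_(om in A) (Y om)%:E = 0)%E.
  move=> GA; have mA : measurable A by exact: gen_measurable GA.
  have iDA : P.-integrable A (EFin \o (\1_D : T -> R)) by exact: integrableS iD.
  have ipA : P.-integrable A (EFin \o cst p) by exact: finite_measure_integrable_cst.
  rewrite (_ : \int[P]_(om in A) (Y om)%:E = \int[P]_(om in A) (\1_D om)%:E - \int[P]_(om in A) p%:E)%E; last first.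
    by rewrite -integralB.
  rewrite integral_indic// integral_cst//= setIC indep// -(fpE D)// muleC subee//.
  by rewrite fin_numM ?fin_num_measure.
have := @cond_zero_mul _ _ _ P G X Y c setT Gm iY Y0 GX (@measurableT _ (g_sigma_algebraType G)) (fun om _ => Xc om).
have iXD : P.-integrable setT (EFin \o (fun om => X om * \1_D om)).
  by apply: (@integrableM_bounded _ _ _ _ _ _ _ c) => //.
have iX := integrable_bnd X c mX Xc.
have iXp : P.-integrable setT (EFin \o (fun om => X om * p)).
  by have := integrableZr measurableT p iX; apply: eq_integrable.
rewrite (@eq_Rintegral _ _ _ P setT (fun om => X om * \1_D om - X om * p)); last first.
  by move=> om _; rewrite /Y mulrBr.
rewrite RintegralB// RintegralZr// => /eqP; rewrite subr_eq0 => /eqP h.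
have -> : (\int[P]_(om in D) (X om)%:E = \int[P]_om (X om * \1_D om)%:E)%E.
  rewrite integral_mkcond; apply: eq_integral => om _; rewrite patchE indicE.
  by case: ifPn => /= _; rewrite ?mulr1 ?mulr0.
rewrite -(fineK (integrable_fin_num measurableT iXD)) -[fine _]/(Rintegral _ _ _) h.
by rewrite EFinM /Rintegral fineK ?integrable_fin_num// -fpE// muleC.
Qed.

(** Truncation at n and monotone convergence, since moments of the observation noise are unbounded
    functions. *)
Lemma indep_integral (X : T -> R) : gfun G X -> (forall om, 0 <= X om) ->
  (\int[P]_(om in D) (X om)%:E = P D * \int[P]_om (X om)%:E)%E.
Proof.
move=> GX X0.
pose Xn n om : R := Num.min (X om) n%:R.
have GXn n : gfun G (Xn n) by apply: measurable_minr => //; exact: measurable_cst.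
have Xn0 n om : 0 <= Xn n om <= n%:R by rewrite /Xn le_min X0 ler0n ge_min lexx orbT.
have mXn n : measurable_fun setT (Xn n) by exact: gfun_measurable (GXn n).
have nd om : nondecreasing_seq (fun n => (Xn n om)%:E).
  move=> n k nk; rewrite lee_fin /Xn le_min ge_min lexx/= ge_min.
  by rewrite ler_nat nk orbT.
have lim om : (Xn n om)%:E @[n --> \oo] --> (X om)%:E.
  apply: cvg_near_cst; exists (Num.truncn (X om)).+1 => // n /= hn.
  rewrite /Xn min_l// (le_trans (ltW (truncnS_gt (X om))))// ler_nat//.
have e1 E : measurable E -> (\int[P]_(om in E) (Xn n om)%:E @[n --> \oo] --> \int[P]_(om in E) (X om)%:E)%E.
  move=> mE.
  have -> : (\int[P]_(om in E) (X om)%:E = \int[P]_(om in E) limn (fun n => (Xn n om)%:E))%E.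
    by apply: eq_integral => om _; apply/esym/cvg_lim.
  apply: cvg_monotone_convergence => //.
  - by move=> n; apply/measurable_EFinP; exact: measurable_funTS.
  - by move=> n om _; rewrite lee_fin; have /andP[] := Xn0 n om.
have h1 := e1 D mD; have h2 := e1 setT measurableT.
have h3 : (P D * \int[P]_om (Xn n om)%:E @[n --> \oo] --> P D * \int[P]_om (X om)%:E)%E.
  by apply: cvgeZl => //; exact: fin_num_measure.
have : (fun n => \int[P]_(om in D) (Xn n om)%:E)%E = (fun n => P D * \int[P]_om (Xn n om)%:E)%E.
  by apply/funext => n; exact: (@indep_integral_bounded _ n%:R).
move=> E; rewrite E in h1; exact: cvg_unique h1 h3.
Qed.

End IndependentEvent.

(** * The filtration of the algorithm *)

Lemma gfun_sub {R : realType} {d : measure_display} {T : measurableType d}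
  (G1 G2 : set (set T)) (X : T -> R) : <<s G1 >> `<=` <<s G2 >> -> gfun G1 X -> gfun G2 X.
Proof. by move=> s12 mX _ B mB; apply: s12; exact: mX. Qed.

Lemma gfun_le {R : realType} {d : measure_display} {T : measurableType d}
  (G : set (set T)) (X : T -> R) : (forall c, <<s G >> [set om | X om <= c]) -> gfun G X.
Proof.
move=> h; apply: (measurability _ (RGenOInfty.measurableE R)) => //.
move=> /= _ [_ [x ->] <-]; rewrite setTI.
rewrite (_ : _ @^-1` _ = ~` [set om | X om <= x]).
  by apply: (@measurableC _ (g_sigma_algebraType G)); exact: h.
by apply/seteqP; split=> om /=; rewrite in_itv/= andbT ltNge => /negP.
Qed.

Section DensityMeasure.
Context {R : realType} {d : measure_display} {T : measurableType d}.
Variables (P : probability T R) (h : T -> R).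
Hypothesis mh : measurable_fun setT h.
Hypothesis h0 : forall om, 0 <= h om.

(** Packaged as a measure so that two integrands can be compared on a generating pi-system by
    uniqueness of measures. *)
Definition density (A : set T) : \bar R := (\int[P]_(om in A) (h om)%:E)%E.

Let density0 : density set0 = 0%E. Proof. by rewrite /density integral_set0. Qed.

Let density_ge0 A : (0 <= density A)%E.
Proof. by apply: integral_ge0 => om _; rewrite lee_fin. Qed.

Let density_sigma_additive : semi_sigma_additive density.
Proof.
move=> F mF tF mU; rewrite /density ge0_integral_bigcup//; last 2 first.
- by apply/measurable_EFinP; exact: measurable_funTS.
- by move=> om _; rewrite lee_fin.
by apply: is_cvg_nneseries => k _ _; apply: integral_ge0 => om _; rewrite lee_fin.
Qed.

HB.instance Definition _ := isMeasure.Build _ _ _ density density0 density_ge0 density_sigma_additive.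

Definition density_measure : {measure set T -> \bar R} := density.

End DensityMeasure.

Section Filtration.
Context {R : realType} {d : measure_display} {T : measurableType d}.
Variables (P : probability T R) (N : nat) (m : 'I_N -> nat).
Variables (w : forall i : 'I_N, nat -> T -> 'cV[R]_(m i)) (dd : 'I_N -> nat -> T -> R).
Hypothesis w_meas : forall i k (j : 'I_(m i)), measurable_fun setT (fun om => w i k om j 0).
Hypothesis dd_meas : forall i k, measurable_fun setT (dd i k).
Hypothesis dd_indep : forall (S : seq ('I_N * nat)) (B : 'I_N * nat -> set R) (A : set T),
      uniq S -> all (fun p => (1 <= p.2)%N) S ->
      (forall p, measurable (B p)) -> sigmaW w A ->
      P (A `&` \big[setI/setT]_(p <- S) (dd p.1 p.2 @^-1` B p))
      = (P A * \prod_(p <- S) P (dd p.1 p.2 @^-1` B p))%E.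

(** Generating families of [filtFw], [sigmaW] and [filtF], which are their generated sigma-algebras
    by conversion; they are named because [gfun] takes a family of generators. *)
Definition genFw k : set (set T) :=
  [set A | exists (i : 'I_N) (t : nat) (j : 'I_(m i)) (B : set R),
                  [/\ (1 <= t <= k)%N, measurable B &
                      A = (fun om => w i t om j 0) @^-1` B]].

Definition genW : set (set T) :=
  [set A | exists (i : 'I_N) (t : nat) (j : 'I_(m i)) (B : set R),
                  [/\ (1 <= t)%N, measurable B &
                      A = (fun om => w i t om j 0) @^-1` B]].

Definition genF k : set (set T) :=
  [set A | (exists (i : 'I_N) (t : nat) (j : 'I_(m i)) (B : set R),
                  [/\ (1 <= t <= k)%N, measurable B &
                      A = (fun om => w i t om j 0) @^-1` B]) \/
               (exists (i : 'I_N) (t : nat) (B : set R),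
                  [/\ (1 <= t <= k)%N, measurable B & A = dd i t @^-1` B])].

Let mpre (X : T -> R) (B : set R) : measurable_fun setT X -> measurable B -> measurable (X @^-1` B).
Proof. by move=> mX mB; rewrite -[_ @^-1` _]setTI; exact: mX. Qed.

Lemma genF_measurable k : genF k `<=` measurable.
Proof. by move=> _ [[i [t [j [B [_ mB ->]]]]]|[i [t [B [_ mB ->]]]]]; exact: mpre. Qed.

Lemma genW_measurable : genW `<=` measurable.
Proof. by move=> _ [i [t [j [B [_ mB ->]]]]]; exact: mpre. Qed.

Lemma genF_incr k : <<s genF k >> `<=` <<s genF k.+1 >>.
Proof.
apply: sub_sigma_algebra2 => A [[i [t [j [B [/andP[h1 h2] mB ->]]]]]|[i [t [B [/andP[h1 h2] mB ->]]]]].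
- by left; exists i, t, j, B; rewrite h1 (leq_trans h2 (leqnSn k)).
- by right; exists i, t, B; rewrite h1 (leq_trans h2 (leqnSn k)).
Qed.

Lemma genFw_genW k : <<s genFw k >> `<=` <<s genW >>.
Proof.
apply: sub_sigma_algebra2 => A [i [t [j [B [/andP[h1 h2] mB ->]]]]].
by exists i, t, j, B.
Qed.

Lemma genFw_genF k : <<s genFw k >> `<=` <<s genF k >>.
Proof. by apply: sub_sigma_algebra2 => A h; left. Qed.

Lemma gfun_w k i t (j : 'I_(m i)) : (1 <= t <= k)%N -> gfun (genF k) (fun om => w i t om j 0).
Proof.
move=> tk _ B mB; rewrite setTI; apply: sub_sigma_algebra.
by left; exists i, t, j, B.
Qed.

Lemma gfunW_w i t (j : 'I_(m i)) : (1 <= t)%N -> gfun genW (fun om => w i t om j 0).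
Proof.
move=> tk _ B mB; rewrite setTI; apply: sub_sigma_algebra.
by exists i, t, j, B.
Qed.

Lemma gfun_dd k i t : (1 <= t <= k)%N -> gfun (genF k) (dd i t).
Proof.
move=> tk _ B mB; rewrite setTI; apply: sub_sigma_algebra.
by right; exists i, t, B.
Qed.

Let past k : seq ('I_N * nat) := [seq (i, t) | i <- enum 'I_N, t <- iota 1 k].

Let mem_past k i t : ((i, t) \in past k) = (1 <= t <= k)%N.
Proof.
rewrite /past; apply/allpairsP/idP => [[[i' t'] /= [_ + [_ ->]]]|tk].
  by rewrite mem_iota add1n ltnS.
by exists (i, t); split => //=; rewrite ?mem_enum// mem_iota add1n ltnS.
Qed.

Let past_uniq k : uniq (past k).
Proof. by apply: allpairs_uniq; rewrite ?enum_uniq ?iota_uniq// => -[? ?] [? ?] _ _ [-> ->]. Qed.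

Let past_all k : all (fun p => (1 <= p.2)%N) (past k).
Proof. by apply/allP => -[i t]; rewrite mem_past => /andP[]. Qed.

Let cyl k (B : 'I_N * nat -> set R) : set T := \big[setI/setT]_(p <- past k) (dd p.1 p.2 @^-1` B p).

(** A pi-system that generates the past F_k: an event of the noises up to k, intersected with one
    event for each dither up to k. These are the sets whose probabilities [dd_indep] factors. *)
Let pisys k : set (set T) := [set A | exists (A0 : set T) (B : 'I_N * nat -> set R),
  [/\ <<s genFw k >> A0, (forall p, measurable (B p)) & A = A0 `&` cyl k B]].

Let cyl_measurable k B : (forall p, measurable (B p)) -> measurable (cyl k B).
Proof.
move=> mB; rewrite /cyl; elim/big_ind : _ => //; first by move=> *; exact: measurableI.
by move=> p _; exact: mpre.
Qed.

Let genFw_meas k A : <<s genFw k >> A -> measurable A.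
Proof. by move=> h; exact: (gen_measurable genW genW_measurable A (genFw_genW k A h)). Qed.

Let pisys_measurable k : pisys k `<=` measurable.
Proof.
by move=> _ [A0 [B [GA0 mB ->]]]; apply: measurableI; [exact: genFw_meas GA0|exact: cyl_measurable].
Qed.

Let pisys_setI k : setI_closed (pisys k).
Proof.
move=> _ _ [A0 [B [GA0 mB ->]]] [A1 [B' [GA1 mB' ->]]].
exists (A0 `&` A1), (fun p => B p `&` B' p); split; first exact: genI.
- by move=> p; exact: measurableI.
- by rewrite setIACA; congr (_ `&` _); rewrite /cyl -big_split.
Qed.

Let cylT k : cyl k (fun=> setT) = setT.
Proof. by rewrite /cyl big1// => p _; rewrite preimage_setT. Qed.

Let pisysT k : pisys k setT.
Proof.
exists setT, (fun=> setT); split => //; last by rewrite cylT setTI.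
exact: (@measurableT _ (g_sigma_algebraType (genFw k))).
Qed.

Let coverT : \bigcup_(k : nat) [set: T] = setT.
Proof. by apply/seteqP; split=> om // _; exists 0%N. Qed.

Let genF_pisys k : <<s genF k >> `<=` <<s pisys k >>.
Proof.
apply: sub_sigma_algebra2 => A [h|[i [t [B [tk mB ->]]]]].
  exists A, (fun=> setT); split => //; first by apply: sub_sigma_algebra.
  by rewrite cylT setIT.
exists setT, (fun p => if p == (i, t) then B else setT); split.
- exact: (@measurableT _ (g_sigma_algebraType (genFw k))).
- by move=> p; case: ifP.
rewrite setTI /cyl (bigD1_seq (i, t))//=; last by rewrite mem_past.
rewrite eqxx big1 ?setIT// => p /negPf ->.
by rewrite preimage_setT.
Qed.

(** As functions of [A], both sides are finite measures; they agree on [pisys k], hence on the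
    sigma-algebra it generates. *)
Lemma dither_indep k j (A : set T) (E : set R) : <<s genF k >> A -> measurable E ->
  P (A `&` dd j k.+1 @^-1` E) = (P A * P (dd j k.+1 @^-1` E))%E.
Proof.
move=> GA mE; set D := dd j k.+1 @^-1` E.
have mD : measurable D by exact: mpre.
have PDfin : P D \is a fin_num by exact: fin_num_measure.
have PD0 : 0 <= fine (P D) by rewrite fine_ge0.
rewrite -[LHS]/(mrestr P mD A) muleC -(fineK PDfin).
rewrite -[RHS]/(mscale (NngNum PD0) P A).
apply: (@g_sigma_algebra_measure_unique _ R T (pisys k) (@pisys_measurable k) (fun=> setT)
  (fun=> pisysT k) coverT (mrestr P mD) (mscale (NngNum PD0) P) (@pisys_setI k) _ _ A
  (genF_pisys k A GA)).
- move=> _ [A0 [B [GA0 mB ->]]]; rewrite /= /mrestr /mscale /= fineK//.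
  (* The dither at time k + 1 is not among those of [past k], so it joins them in a single
     application of [dd_indep]. *)
  pose B' p := if p == (j, k.+1) then E else B p.
  have mB' p : measurable (B' p) by rewrite /B'; case: ifP.
  have WA0 : sigmaW w A0 by exact: genFw_genW GA0.
  have nin : (j, k.+1) \notin past k by rewrite mem_past ltnn andbF.
  have eqB : {in past k, forall p, B' p = B p}.
    by move=> p pin; rewrite /B'; case: eqP => // pE; move: nin; rewrite -pE pin.
  have := dd_indep ((j, k.+1) :: past k) B' A0.
  rewrite /= nin past_uniq past_all => /(_ isT isT mB' WA0).
  rewrite !big_cons {1 3}/B' eqxx -/D.
  rewrite (eq_big_seq (fun p => dd p.1 p.2 @^-1` B p)); last by move=> p /eqB ->.
  rewrite [X in (_ * (_ * X))%E](eq_big_seq (fun p => P (dd p.1 p.2 @^-1` B p))); last by move=> p /eqB ->.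
  rewrite -/(cyl k B) => h.
  by rewrite -setIA [cyl k B `&` _]setIC h (dd_indep (past k) B A0)// muleCA.
- by move=> _; rewrite /= /mrestr setTI ltey_eq PDfin.
Qed.

Lemma cyl_indep k (B : 'I_N * nat -> set R) (A : set T) : (forall p, measurable (B p)) ->
  <<s genW >> A -> P (A `&` cyl k B) = (P A * P (cyl k B))%E.
Proof.
move=> mB GA.
have h := dd_indep (past k) B A (past_uniq k) (past_all k) mB GA.
have hT := dd_indep (past k) B setT (past_uniq k) (past_all k) mB
  (@measurableT _ (g_sigma_algebraType genW)).
by rewrite /cyl h; congr (_ * _)%E; rewrite setTI in hT; rewrite hT probability_setT mul1e.
Qed.

(** The moment bound of (A2) is conditional on the past of the noises, while the recursion
    conditions on noises and dithers. As the dithers are independent of the whole noise sequence,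
    they add no information about a function of the noises: two such functions with equal integrals
    over F^w_k also have equal integrals over F_k. *)
Lemma integral_eq_filtF k (h1 h2 : T -> R) : gfun genW h1 -> gfun genW h2 ->
  (forall om, 0 <= h1 om) -> (forall om, 0 <= h2 om) ->
  (\int[P]_om (h1 om)%:E < +oo)%E ->
  (forall A, <<s genFw k >> A -> (\int[P]_(om in A) (h1 om)%:E = \int[P]_(om in A) (h2 om)%:E)%E) ->
  forall A, <<s genF k >> A -> (\int[P]_(om in A) (h1 om)%:E = \int[P]_(om in A) (h2 om)%:E)%E.
Proof.
move=> Gh1 Gh2 h10 h20 fin h12 A GA.
have mh1 := gfun_measurable _ _ genW_measurable Gh1.
have mh2 := gfun_measurable _ _ genW_measurable Gh2.
apply: (@g_sigma_algebra_measure_unique _ R T (pisys k) (@pisys_measurable k) (fun=> setT)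
  (fun=> pisysT k) coverT (density_measure P h1 mh1 h10) (density_measure P h2 mh2 h20)
  (@pisys_setI k) _ _ A (genF_pisys k A GA)).
- move=> _ [A0 [B [GA0 mB ->]]]; rewrite /= /density.
  have WA0 : <<s genW >> A0 by exact: genFw_genW GA0.
  have mC := cyl_measurable k B mB.
  have key h : gfun genW h -> (forall om, 0 <= h om) ->
      (\int[P]_(om in A0 `&` cyl k B) (h om)%:E = P (cyl k B) * \int[P]_(om in A0) (h om)%:E)%E.
    move=> Gh h0.
    have Gh' : gfun genW (fun om => h om * \1_A0 om).
      apply: measurable_funM => //; exact: (@measurable_indic _ (g_sigma_algebraType genW)).
    have := @indep_integral _ _ _ P genW (cyl k B) genW_measurable mC
      (fun A hA => cyl_indep k B A mB hA) _ Gh' (fun om => mulr_ge0 (h0 om) _).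
    rewrite setIC integral_mkcondr [X in _ -> _ = (_ * X)%E]integral_mkcond.
    have e (E : set T) : (\int[P]_(om in E) (h om * \1_A0 om)%:E =
        \int[P]_(om in E) ((fun x => (h x)%:E) \_ A0) om)%E.
      apply: eq_integral => om _; rewrite patchE indicE.
      by case: ifPn => _ /=; rewrite ?mulr1 ?mulr0.
    rewrite !e; apply => om.
    by rewrite indicE; case: (_ \in _).
  by rewrite !key// h12.
- by [].
Qed.

End Filtration.

Arguments genFw {R d T N m} w k.
Arguments genW {R d T N m} w.
Arguments genF {R d T N m} w dd k.
Arguments genF_measurable {R d T N m} w dd w_meas dd_meas k.
Arguments genW_measurable {R d T N m} w w_meas.
Arguments genF_incr {R d T N m} w dd k.
Arguments genFw_genW {R d T N m} w k.
Arguments genFw_genF {R d T N m} w dd k.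
Arguments gfun_w {R d T N m} w dd k i t j.
Arguments gfunW_w {R d T N m} w i t j.
Arguments gfun_dd {R d T N m} w dd k i t.
Arguments dither_indep {R d T} P {N m} w dd w_meas dd_meas dd_indep k j A E.
Arguments integral_eq_filtF {R d T} P {N m} w dd w_meas dd_meas dd_indep k h1 h2.

Section GfunCalculus.
Context {R : realType} {d : measure_display} {T : measurableType d}.
Variable G : set (set T).
Implicit Types X Y : T -> R.

Lemma gfun_cst (c : R) : gfun G (fun=> c).
Proof. exact: measurable_cst. Qed.

Lemma gfunD X Y : gfun G X -> gfun G Y -> gfun G (fun om => X om + Y om).
Proof. exact: measurable_funD. Qed.

Lemma gfunB X Y : gfun G X -> gfun G Y -> gfun G (fun om => X om - Y om).
Proof. exact: measurable_funB. Qed.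

Lemma gfunN X : gfun G X -> gfun G (fun om => - X om).
Proof. exact: measurable_funN. Qed.

Lemma gfunM X Y : gfun G X -> gfun G Y -> gfun G (fun om => X om * Y om).
Proof. exact: measurable_funM. Qed.

Lemma gfunX n X : gfun G X -> gfun G (fun om => X om ^+ n).
Proof. exact: measurable_funX. Qed.

Lemma gfun_comp (f : R -> R) X : measurable_fun setT f -> gfun G X -> gfun G (fun om => f (X om)).
Proof. by move=> mf GX; exact: (measurableT_comp mf GX). Qed.

Lemma gfun_sum (I : Type) (s : seq I) (p : pred I) (X : I -> T -> R) :
  (forall i, gfun G (X i)) -> gfun G (fun om => \sum_(i <- s | p i) X i om).
Proof.
move=> GX; elim: s => [|i s IH].
  by under eq_fun do rewrite big_nil; exact: gfun_cst.
under eq_fun do rewrite big_cons.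
by case: (p i) => //; exact: gfunD.
Qed.

Lemma gfun_lt X Y : gfun G X -> gfun G Y ->
  measurable_fun [set: g_sigma_algebraType G] (fun om : g_sigma_algebraType G => X om < Y om).
Proof. exact: measurable_fun_ltr. Qed.

Lemma gfun_setle X (c : R) : gfun G X -> <<s G >> [set om | X om <= c].
Proof.
move=> GX; rewrite (_ : [set om | _] = X @^-1` `]-oo, c]); first exact: gfun_preimage.
by apply/seteqP; split=> om /=; rewrite in_itv.
Qed.

End GfunCalculus.

Lemma measurable_sqrt {R : realType} : measurable_fun [set: R] (@Num.sqrt R).
Proof.
have -> : @Num.sqrt R = (fun x => if 0 <= x then x `^ (2^-1) else 0).
  apply/funext => x; case: leP => [x0|x0]; first by rewrite powR12_sqrt.
  by rewrite ler0_sqrtr// ltW.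
by apply: measurable_fun_ifT => //; apply: measurable_fun_ler => //; exact: measurable_cst.
Qed.

Lemma gfun_vnorm {R : realType} {d : measure_display} {T : measurableType d}
  (G : set (set T)) n (x : T -> 'cV[R]_n) : (forall j, gfun G (fun om => x om j 0)) ->
  gfun G (fun om => vnorm (x om)).
Proof.
by move=> Gx; apply: (gfun_comp _ _ _ measurable_sqrt); apply: gfun_sum => j; exact: gfunX.
Qed.

(** * Moments of the noise conditional on the full past *)

Section MomentBound.
Context {R : realType} {d : measure_display} {T : measurableType d}.
Variables (P : probability T R) (N : nat) (m : 'I_N -> nat).
Variables (w : forall i : 'I_N, nat -> T -> 'cV[R]_(m i)) (dd : 'I_N -> nat -> T -> R).
Hypothesis w_meas : forall i k (j : 'I_(m i)), measurable_fun setT (fun om => w i k om j 0).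
Hypothesis dd_meas : forall i k, measurable_fun setT (dd i k).
Hypothesis dd_indep : forall (S : seq ('I_N * nat)) (B : 'I_N * nat -> set R) (A : set T),
      uniq S -> all (fun p => (1 <= p.2)%N) S ->
      (forall p, measurable (B p)) -> sigmaW w A ->
      P (A `&` \big[setI/setT]_(p <- S) (dd p.1 p.2 @^-1` B p))
      = (P A * \prod_(p <- S) P (dd p.1 p.2 @^-1` B p))%E.

(** The conditional moment [g] may be infinite. Multiplying it and the moment itself by the
    indicator of {g <= M} gives real-valued functions of the noises with finite integrals, to which
    [integral_eq_filtF] applies. *)
Lemma moment_bound k i (rho M : R) (g : T -> \bar R) : 0 <= M ->
  (forall om, (0 <= g om)%E) ->
  (forall c : R, filtFw w k [set om | (g om <= c%:E)%E]) ->
  (forall A, filtFw w k A ->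
     (\int[P]_(om in A) (powR (vnorm (w i k.+1 om)) rho)%:E = \int[P]_(om in A) g om)%E) ->
  forall B, filtF w dd k B -> B `<=` [set om | (g om <= M%:E)%E] ->
  (\int[P]_(om in B) (powR (vnorm (w i k.+1 om)) rho)%:E <= M%:E * P B)%E.
Proof.
move=> M0 g0 gm gint B GB BM.
set Gam := [set om | (g om <= M%:E)%E] in BM.
have GG : <<s genFw w k >> Gam by exact: gm.
have WG : <<s genW w >> Gam by exact: genFw_genW GG.
pose f om : R := powR (vnorm (w i k.+1 om)) rho.
pose h1 om : R := f om * \1_Gam om.
pose h2 om : R := fine (g om) * \1_Gam om.
have Gf : gfun (genW w) f.
  apply: (gfun_comp _ (@powR R ^~ rho) (fun om => vnorm (w i k.+1 om))) => //.
  apply: gfun_vnorm => j.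
  exact: gfunW_w.
have G1 : gfun (genW w) h1.
  by apply: gfunM => //; exact: (@measurable_indic _ (g_sigma_algebraType (genW w))).
have g2E om c : (h2 om <= c) = if om \in Gam then (g om <= c%:E)%E else (0 <= c).
  rewrite /h2 indicE; case: ifPn => [/set_mem omG|_]; last by rewrite mulr0.
  rewrite mulr1 -lee_fin fineK//.
  by rewrite ge0_fin_numE// (le_lt_trans omG)// ltry.
have G2 : gfun (genW w) h2.
  apply: gfun_le => c.
  have [c0|c0] := leP 0 c.
    rewrite (_ : [set om | _] = (Gam `&` [set om | (g om <= c%:E)%E]) `|` ~` Gam).
      apply: (@measurableU _ (g_sigma_algebraType (genW w))).
        by apply: genI => //; exact: (genFw_genW w k _ (gm c)).
      exact: (@measurableC _ (g_sigma_algebraType (genW w))).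
    apply/seteqP; split=> om /=; rewrite g2E.
      by case: ifPn => [/set_mem ? ?|/negP n _]; [left|right => h; apply: n; exact/mem_set].
    by case: ifPn => [/set_mem omG [[]//|/(_ omG)]|_ _].
  rewrite (_ : [set om | _] = set0); first exact: (@measurable0 _ (g_sigma_algebraType (genW w))).
  apply/seteqP; split=> om //=; rewrite leNgt => /negP; apply.
  by apply: (lt_le_trans c0); rewrite mulr_ge0// ?fine_ge0// indicE.
have h10 om : 0 <= h1 om by rewrite mulr_ge0 ?powR_ge0// indicE.
have h20 om : 0 <= h2 om by rewrite mulr_ge0 ?fine_ge0// indicE.
have restr (h : T -> R) (E : set T) : (\int[P]_(om in E) (h om * \1_Gam om)%:E = \int[P]_(om in E `&` Gam) (h om)%:E)%E.
  rewrite [RHS]integral_mkcondr; apply: eq_integral => om _; rewrite patchE indicE.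
  by case: ifPn => _ /=; rewrite ?mulr1 ?mulr0.
have gfin (E : set T) : E `<=` Gam -> (\int[P]_(om in E) (fine (g om))%:E = \int[P]_(om in E) g om)%E.
  move=> EG; apply: eq_integral => om /set_mem /EG omG; rewrite fineK//.
  by rewrite ge0_fin_numE// (le_lt_trans omG)// ltry.
have h12 A : <<s genFw w k >> A -> (\int[P]_(om in A) (h1 om)%:E = \int[P]_(om in A) (h2 om)%:E)%E.
  move=> GA; rewrite /h1 /h2 !restr gfin; last by move=> om [].
  by apply: gint; exact: genI.
have mB : measurable B by exact: (gen_measurable _ (genF_measurable w dd w_meas dd_meas k) _ GB).
have h2M om : h2 om <= M.
  by rewrite g2E; case: ifPn => [/set_mem|].
have mh2 : measurable_fun setT h2 by exact: (gfun_measurable _ _ (genW_measurable w w_meas) G2).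
have bnd E : measurable E -> (\int[P]_(om in E) (h2 om)%:E <= M%:E * P E)%E.
  move=> mE; rewrite -integral_cst//; apply: ge0_le_integral => //.
  - by move=> om _; rewrite lee_fin.
  - by apply/measurable_EFinP; exact: measurable_funTS.
  - by move=> om _; rewrite lee_fin.
have fin : (\int[P]_om (h1 om)%:E < +oo)%E.
  rewrite h12; last exact: (@measurableT _ (g_sigma_algebraType (genFw w k))).
  by rewrite (le_lt_trans (bnd _ measurableT))// probability_setT mule1 ltry.
have eqB := integral_eq_filtF P w dd w_meas dd_meas dd_indep k h1 h2 G1 G2 h10 h20 fin h12 B GB.
have -> : (\int[P]_(om in B) (powR (vnorm (w i k.+1 om)) rho)%:E = \int[P]_(om in B) (h1 om)%:E)%E.
  by rewrite /h1 restr setIidl.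
by rewrite eqB; exact: bnd.
Qed.

End MomentBound.

(** * Quadratic forms and the Lyapunov step *)

Section Forms.
Variables (R : realType) (E : lmodType R).
Implicit Types (Q : E -> E -> R) (x y z f e : E).

Record psdform Q : Prop := PsdForm {
  form_sym : forall x y, Q x y = Q y x;
  form_linear : forall a x y z, Q (a *: x + y) z = a * Q x z + Q y z;
  form_ge0 : forall x, 0 <= Q x x }.

Definition linfun1 (l : E -> R) := forall a x y, l (a *: x + y) = a * l x + l y.

Lemma psdform_sq (l : E -> R) : linfun1 l -> psdform (fun x y => l x * l y).
Proof.
move=> ll; split=> [x y|a x y z|x]; first exact: mulrC.
- by rewrite ll mulrDl mulrA.
- by rewrite -expr2 sqr_ge0.
Qed.

Lemma psdformD Q1 Q2 : psdform Q1 -> psdform Q2 -> psdform (fun x y => Q1 x y + Q2 x y).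
Proof.
move=> [s1 l1 p1] [s2 l2 p2]; split=> [x y|a x y z|x].
- by rewrite s1 s2.
- by rewrite l1 l2; ring.
- by rewrite addr_ge0.
Qed.

Lemma psdformZ (c : R) Q : 0 <= c -> psdform Q -> psdform (fun x y => c * Q x y).
Proof.
move=> c0 [s l p]; split=> [x y|a x y z|x].
- by rewrite s.
- by rewrite l; ring.
- by rewrite mulr_ge0.
Qed.

Lemma psdform_sum (I : Type) (s : seq I) (P : pred I) (Q : I -> E -> E -> R) :
  (forall i, psdform (Q i)) -> psdform (fun x y => \sum_(i <- s | P i) Q i x y).
Proof.
move=> pQ; split=> [x y|a x y z|x].
- by apply: eq_bigr => i _; rewrite (form_sym _ (pQ i)).
- by rewrite mulr_sumr -big_split; apply: eq_bigr => i _; rewrite (form_linear _ (pQ i)).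
- by apply: sumr_ge0 => i _; exact: (form_ge0 _ (pQ i)).
Qed.

Section FormTheory.
Variable Q : E -> E -> R.
Hypothesis pQ : psdform Q.

Lemma formDl x y z : Q (x + y) z = Q x z + Q y z.
Proof. by rewrite -[x]scale1r (form_linear _ pQ) scale1r mul1r. Qed.

Lemma form0l z : Q 0 z = 0.
Proof. by have := formDl 0 0 z; rewrite addr0 => /eqP; rewrite -subr_eq subrr => /eqP. Qed.

Lemma formZl a x z : Q (a *: x) z = a * Q x z.
Proof. by rewrite -[a *: x]addr0 (form_linear _ pQ) form0l addr0. Qed.

Lemma formDr x y z : Q x (y + z) = Q x y + Q x z.
Proof. by rewrite !(form_sym _ pQ x) formDl. Qed.

Lemma formZr a x y : Q x (a *: y) = a * Q x y.
Proof. by rewrite !(form_sym _ pQ x) formZl. Qed.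

Lemma form0r x : Q x 0 = 0.
Proof. by rewrite (form_sym _ pQ) form0l. Qed.

Lemma form_sumr (I : Type) (s : seq I) (P : pred I) x (y : I -> E) :
  Q x (\sum_(i <- s | P i) y i) = \sum_(i <- s | P i) Q x (y i).
Proof. by apply: (big_morph (Q x)); [exact: formDr|exact: form0r]. Qed.

Lemma form_sqrD x y : Q (x + y) (x + y) = Q x x + 2 * Q x y + Q y y.
Proof. by rewrite formDl !formDr (form_sym _ pQ y x); ring. Qed.

Lemma form_amgm (c : R) x y : 0 < c -> 2 * `|Q x y| <= c * Q x x + c^-1 * Q y y.
Proof.
move=> c0; have cN0 : c != 0 by rewrite gt_eqF.
have h (s : R) : s ^+ 2 = 1 -> 0 <= c * Q x x + 2 * s * Q x y + c^-1 * Q y y.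
  move=> s1; have /(mulr_ge0 (ltW c0)) := form_ge0 _ pQ (x + (s * c^-1) *: y).
  rewrite form_sqrD formZr formZl formZr.
  have -> : c * (Q x x + 2 * (s * c^-1 * Q x y) + s * c^-1 * (s * c^-1 * Q y y)) =
    c * Q x x + 2 * s * Q x y + s ^+ 2 * c^-1 * Q y y by field.
  by rewrite s1 mul1r.
have := h 1 (expr1n _ _); have := h (-1) (sqrr_sign _ 1).
case: (ger0P (Q x y)) => hq; lra.
Qed.

Lemma form_cs x y : Q x y ^+ 2 <= Q x x * Q y y.
Proof.
have [y0|yN0] := eqVneq (Q y y) 0.
  have [->|xyN0] := eqVneq (Q x y) 0; first by rewrite y0 expr0n mulr0.
  (* When [Q y y = 0] the form is affine along [y]; this multiple of [y] brings its value to -1, a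
     contradiction. *)
  have := form_ge0 _ pQ (x - ((Q x x + 1) / (2 * Q x y)) *: y).
  rewrite -scaleNr form_sqrD formZr formZl formZr y0 !mulr0 addr0.
  have -> : Q x x + 2 * (- ((Q x x + 1) / (2 * Q x y)) * Q x y) = -1 by field; rewrite xyN0.
  by rewrite ler0N1.
have yp : 0 < Q y y by rewrite lt_neqAle eq_sym yN0 form_ge0.
have := form_ge0 _ pQ (x - (Q x y / Q y y) *: y).
rewrite -scaleNr form_sqrD formZr formZl formZr => /(mulr_ge0 (ltW yp)).
have -> : Q y y * (Q x x + 2 * (- (Q x y / Q y y) * Q x y) + - (Q x y / Q y y) * (- (Q x y / Q y y) * Q y y)) =
  Q y y * Q x x - Q x y ^+ 2 by field.
lra.
Qed.

Lemma form_sqrD_le x y : Q (x + y) (x + y) <= 2 * Q x x + 2 * Q y y.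
Proof.
rewrite form_sqrD; have := form_amgm 1 x y ltr01; rewrite invr1 !mul1r.
have := ler_norm (Q x y); lra.
Qed.

End FormTheory.

(* The correction term [c1 * b * Rt] makes the decrease of the time-varying form
   strict at every step: [Rt - Rs = L Qt - Qs] trades the excitation [Qt] of the
   current step for the total excitation [Qs] of the coming window. *)
Lemma lyapunov_step (ip Qt Qs Rt Rs : E -> E -> R) (c0 c1 kap L Cr Cf Cb b b' : R) x f e :
  psdform ip -> psdform Rs ->
  (forall y z, Rt y z = Rs y z - Qs y z + L * Qt y z) ->
  (forall y, Rs y y <= Cr * ip y y) -> (forall y, Rt y y <= Cr * ip y y) ->
  (forall y, kap * ip y y <= Qs y y) ->
  0 <= Qt x x -> 0 <= Rt x x ->
  ip x f <= - (c0 * b * Qt x x) -> ip f f <= Cf * b ^+ 2 * ip x x ->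
  0 < b -> 0 <= b' <= b -> b - b' <= Cb * b ^+ 2 ->
  0 < c1 -> 0 <= L -> c1 * L <= c0 -> 0 <= Cr -> 0 <= Cf -> 0 <= Cb ->
  c1 * b * Cr <= 2^-1 ->
  let Pt y z := ip y z - c1 * b * Rt y z in
  let Ps y z := ip y z - c1 * b' * Rs y z in
  [/\ ip x x <= 2 * Pt x x, Pt x x <= ip x x,
      Ps (x + f + e) (x + f + e) <= Pt x x
        - (c1 * kap * b - (c1 * Cb * Cr + c1 * Cr * (1 + Cf) + 2 * Cf) * b ^+ 2) * ip x x
        + 2 * Ps x e + 2 * ip e e,
      0 <= Ps (x + f + e) (x + f + e) &
      Ps x e ^+ 2 <= ip x x * ip e e].
Proof.
move=> pip pRs RtE RsC RtC kapQ Qt0 Rt0 xf ff b0 /andP[b'0 b'b] bb' c10 L0 c1L Cr0 Cf0 Cb0 small Pt Ps.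
have ipx := form_ge0 _ pip x.
have b'Cr : c1 * b' * Cr <= 2^-1.
  by apply: le_trans small; rewrite ler_wpM2r// ler_wpM2l// ltW.
have c1b : 0 <= c1 * b by rewrite mulr_ge0 ?ltW.
have c1b' : 0 <= c1 * b' by rewrite mulr_ge0 ?(ltW c10).
have PsE y : c1 * b' * Rs y y <= 2^-1 * ip y y.
  apply: (@le_trans _ _ (c1 * b' * (Cr * ip y y))); first by rewrite ler_wpM2l.
  by rewrite mulrA ler_wpM2r// (form_ge0 _ pip).
have Ps0 y : 0 <= Ps y y.
  by have := PsE y; have := form_ge0 _ pip y; rewrite /Ps; lra.
have Psle y : Ps y y <= ip y y.
  by rewrite /Ps gerBl mulr_ge0// (form_ge0 _ pRs).
have pPs : psdform Ps.
  split=> [y z|a y z u|//].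
  - by rewrite /Ps (form_sym _ pip) (form_sym _ pRs).
  - by rewrite /Ps (form_linear _ pip) (form_linear _ pRs); ring.
have Pt2 : ip x x <= 2 * Pt x x.
  have : c1 * b * Rt x x <= 2^-1 * ip x x.
    apply: (@le_trans _ _ (c1 * b * (Cr * ip x x))); first by rewrite ler_wpM2l.
    by rewrite mulrA ler_wpM2r.
  rewrite /Pt; lra.
split => //.
- by rewrite /Pt gerBl mulr_ge0.
- have e1 : Ps (x + f + e) (x + f + e) = Ps x x + 2 * Ps x f + 2 * Ps x e + Ps (f + e) (f + e).
    by rewrite -addrA (form_sqrD _ pPs x (f + e)) (formDr _ pPs x); ring.
  have e2 : Ps (f + e) (f + e) <= 2 * ip f f + 2 * ip e e.
    by apply: (le_trans (Psle _)); exact: form_sqrD_le.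
  have e3 : Ps x x <= Pt x x - c1 * b * kap * ip x x + c1 * b * L * Qt x x + c1 * Cb * Cr * b ^+ 2 * ip x x.
    have h1 : c1 * b * (kap * ip x x) <= c1 * b * Qs x x by rewrite ler_wpM2l.
    have h2 : c1 * (b - b') * Rs x x <= c1 * (Cb * b ^+ 2) * (Cr * ip x x).
      apply: ler_pM => //.
      - by rewrite mulr_ge0 ?(ltW c10)// subr_ge0.
      - exact: (form_ge0 _ pRs).
      - by rewrite ler_wpM2l// ltW.
    rewrite /Ps /Pt RtE; nra.
  (* Weight [b] in the inequality of the means balances Rs x x, of order |x|^2, against Rs f f, of
     order b^2 |x|^2; the cross term then costs b, and b^2 after the factor b'. *)
  have e4 : - (2 * c1 * b' * Rs x f) <= c1 * Cr * (1 + Cf) * b ^+ 2 * ip x x.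
    have h1 := form_amgm _ pRs b x f b0.
    have h2 : b * Rs x x + b^-1 * Rs f f <= b * (Cr * ip x x) + b^-1 * (Cr * (Cf * b ^+ 2 * ip x x)).
      apply: lerD; first by rewrite ler_wpM2l// ltW.
      rewrite ler_wpM2l ?invr_ge0 ?(ltW b0)//; apply: (le_trans (RsC f)).
      by rewrite ler_wpM2l.
    have h3 : b * (Cr * ip x x) + b^-1 * (Cr * (Cf * b ^+ 2 * ip x x)) = b * (Cr * (1 + Cf) * ip x x).
      by field; rewrite gt_eqF.
    have h4 : - (2 * Rs x f) <= b * (Cr * (1 + Cf) * ip x x).
      rewrite -h3; apply: le_trans h2; apply: le_trans h1.
      by rewrite -mulrN ler_wpM2l// -normrN ler_norm.
    have : - (2 * c1 * b' * Rs x f) = (c1 * b') * (- (2 * Rs x f)) by ring.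
    move=> ->; apply: (@le_trans _ _ (c1 * b' * (b * (Cr * (1 + Cf) * ip x x)))).
      by rewrite ler_wpM2l.
    have : c1 * b' <= c1 * b by rewrite ler_wpM2l// ltW.
    have : 0 <= b * (Cr * (1 + Cf) * ip x x) by rewrite !mulr_ge0 ?addr_ge0 ?(ltW b0).
    move=> q0 q1; apply: (le_trans (ler_wpM2r q0 q1)).
    by rewrite le_eqVlt; apply/orP; left; apply/eqP; ring.
  (* The part L Qt that the window shift creates is absorbed by the drift; this is the only
     constraint that fixes the size of [c1]. *)
  have e5 : c1 * b * L * Qt x x <= c0 * b * Qt x x.
    have b0' := ltW b0; apply: ler_wpM2r => //; rewrite mulrAC; exact: ler_wpM2r.
  have e6 : 0 <= c0 * b * Qt x x.
    by apply: le_trans e5; apply: mulr_ge0 => //; apply: mulr_ge0.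
  rewrite e1.
  have : 2 * Ps x f = 2 * ip x f - 2 * c1 * b' * Rs x f by rewrite /Ps; ring.
  nra.
- apply: (le_trans (form_cs _ pPs x e)); apply: ler_pM => //.
Qed.

End Forms.

Arguments psdform {R E} Q.
Arguments linfun1 {R E} l.

(** * Drift and noise of the error dynamics *)

Lemma sum_cauchy_schwarz {R : realType} (I : finType) (P : pred I) (f g : I -> R) :
  (\sum_(i | P i) f i * g i) ^+ 2 <= (\sum_(i | P i) f i ^+ 2) * (\sum_(i | P i) g i ^+ 2).
Proof.
pose Q (x y : {ffun I -> R^o}) : R := \sum_(i | P i) x i * y i.
have pQ : psdform Q.
  by apply: psdform_sum => i; apply: psdform_sq => c x y; rewrite !ffunE.
have := form_cs R _ _ pQ (finfun f) (finfun g).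
rewrite /Q; under eq_bigr do rewrite !ffunE.
under [X in _ <= X * _]eq_bigr do rewrite ffunE -expr2.
by under [X in _ <= _ * X]eq_bigr do rewrite ffunE -expr2.
Qed.

Lemma sqr_sum_le {R : realType} (I : finType) (P : pred I) (f : I -> R) :
  (\sum_(i | P i) f i) ^+ 2 <= #|I|%:R * \sum_(i | P i) f i ^+ 2.
Proof.
have := sum_cauchy_schwarz I P f (fun=> 1).
under eq_bigr do rewrite mulr1.
move=> /le_trans; apply; rewrite mulrC ler_wpM2r ?sumr_ge0// => [i _|]; first exact: sqr_ge0.
under eq_bigr do rewrite expr1n.
by rewrite sumr_const ler_nat max_card.
Qed.

Section Model.
Variables (R : realType) (N n : nat) (m : 'I_N -> nat).
Variables (a nu b : 'M[R]_N) (H : forall i : 'I_N, nat -> 'M[R]_(m i, n)) (theta : 'cV[R]_n).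
Variable be : nat -> R.

Local Notation E := 'M[R]_(N, n).
Implicit Types X Y : E.

(* The state [X] is the matrix whose row [i] is the error of sensor [i]; thus [usig k i X] is
   the scalar x_{i,k} and [gval k i j] the function G_{ij,k} of the algorithm. *)
Definition alp (i j : 'I_N) (k : nat) : R := be k * k%:R `^ nu i j.

Definition ip X Y : R := \sum_i \sum_l X i l * Y i l.

Definition prj (k : nat) (i : 'I_N) X : R := \sum_l phi R n k l 0 * X i l.

Definition hx (k : nat) (i : 'I_N) (r : 'I_(m i)) X : R := \sum_l H i k r l * X i l.

Definition Qf (k : nat) X Y : R :=
  \sum_(i < N) \sum_(j < N | 0 < a i j) (prj k i X - prj k j X) * (prj k i Y - prj k j Y) +
  \sum_(i < N) \sum_(r < m i) hx k i r X * hx k i r Y.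

Lemma linfun1_entry i l : linfun1 (fun X => X i l).
Proof. by move=> c X Y; rewrite !mxE. Qed.

Lemma linfun1_sum (I : Type) (s : seq I) (P : pred I) (c : I -> R) (f : I -> E -> R) :
  (forall i, linfun1 (f i)) -> linfun1 (fun X => \sum_(i <- s | P i) c i * f i X).
Proof.
move=> lf z X Y; rewrite mulr_sumr -big_split; apply: eq_bigr => i _.
by rewrite lf /=; ring.
Qed.

Lemma linfun1_prj k i : linfun1 (prj k i).
Proof. by apply: linfun1_sum => l; exact: linfun1_entry. Qed.

Lemma linfun1_hx k i r : linfun1 (hx k i r).
Proof. by apply: linfun1_sum => l; exact: linfun1_entry. Qed.

Lemma psdform_ip : psdform ip.
Proof.
apply: psdform_sum => i; apply: psdform_sum => l; apply: psdform_sq; exact: linfun1_entry.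
Qed.

Lemma psdform_Qf k : psdform (Qf k).
Proof.
apply: psdformD; apply: psdform_sum => i; apply: psdform_sum => j; apply: psdform_sq.
- by move=> c X Y; rewrite !linfun1_prj; ring.
- exact: linfun1_hx.
Qed.

Definition usig (k : nat) (i : 'I_N) X : R := prj k i X + prj k i (\matrix_(i, l) theta l 0).

Definition gval (k : nat) (i j : 'I_N) (u : R) : R := scG R (nu i j * ln k%:R) (u / b i j).

(** The conditional mean of the increment: the bit received from j is replaced by its mean
    [gval k i j (usig k j X)]. What remains, the centred bits and the observation noise, is
    [noise]. *)
Definition drift (k : nat) X : E := \matrix_(i, l)
  ((\sum_(j < N | 0 < a i j) alp i j k * a i j * (gval k i j (usig k j X) - gval k i j (usig k i X)))
     * phi R n k l 0
   + be k * \sum_r H i k r l * (- hx k i r X)).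

Definition bit_up (k : nat) (d : 'I_N -> R) (j i : 'I_N) X : R :=
  (nu j i * b j i * ln k%:R < usig k j X + b j i * d j)%R%:R.

Definition bit_down (k : nat) (d : 'I_N -> R) (j i : 'I_N) X : R :=
  (usig k j X + b j i * d j < - (nu j i * b j i * ln k%:R))%R%:R.

Definition noise (k : nat) (w : forall i : 'I_N, 'cV[R]_(m i)) (d : 'I_N -> R) X : E := \matrix_(i, l)
  ((\sum_(j < N | 0 < a i j) alp i j k * a i j *
      (bit_up k d j i X - bit_down k d j i X - gval k i j (usig k j X))) * phi R n k l 0
   + be k * \sum_r H i k r l * w i r 0).

Hypothesis Ha_sym : forall i j, a i j = a j i.
Hypothesis Ha_nneg : forall i j, 0 <= a i j.
Hypothesis Hnu_sym : forall i j, nu i j = nu j i.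
Hypothesis Hnu : forall i j, 0 < a i j -> 0 <= nu i j < 2^-1.
Hypothesis Hb_sym : forall i j, b i j = b j i.
Hypothesis Hb : forall i j, 0 < a i j -> 0 < b i j.

Lemma gvalE k i j u : 0 < a i j ->
  lapF ((u - nu i j * b i j * ln k%:R) / b i j) - lapF ((- u - nu i j * b i j * ln k%:R) / b i j)
  = gval k i j u.
Proof.
move=> aij; have bN0 : b i j != 0 by rewrite gt_eqF// Hb.
by rewrite /gval /scG; congr (lapF _ - lapF _); field.
Qed.

(** The two indicators exclude each other because the threshold is nonnegative; this is where nu >=
    0 and k >= 1 enter. *)
Lemma shatE k d j i X : (0 < k)%N -> 0 < a i j ->
  (if nu j i * b j i * ln k%:R < `|usig k j X + b j i * d j|
   then if 0 < usig k j X + b j i * d j then 1 else -1 else 0)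
  = bit_up k d j i X - bit_down k d j i X.
Proof.
move=> k0 aij; rewrite /bit_up /bit_down; set z := _ + _ * d j; set C := _ * _ * ln _.
have C0 : 0 <= C.
  have /andP[? _] := Hnu _ _ aij.
  rewrite /C (Hnu_sym j i) (Hb_sym j i); apply: mulr_ge0; last by apply: ln_ge0; rewrite ler1n.
  by apply: mulr_ge0 => //; exact/ltW/Hb.
case: (ltP C z) => h1; case: (ltP z (- C)) => h2.
- lra.
- have z0 : 0 < z by lra.
  by rewrite gtr0_norm// h1 z0 subr0.
- have z0 : z < 0 by lra.
  have -> : C < `|z| by rewrite ltr0_norm//; lra.
  have -> : (0 < z) = false by apply/negbTE; rewrite -leNgt ltW.
  by rewrite sub0r.
- have -> : (C < `|z|) = false by apply/negbTE; rewrite -leNgt ler_norml; lra.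
  by rewrite subrr.
Qed.

Lemma sc_update_split (w : forall i : 'I_N, nat -> 'cV[R]_(m i)) (dd : 'I_N -> nat -> R) k
    (prev : 'I_N -> 'cV[R]_n) i l : (0 < k)%N ->
  let X : E := \matrix_(i, l) (prev i l 0 - theta l 0) in
  sc_update a nu b alp (fun=> be) H theta w dd k prev i l 0 - theta l 0 =
  (X + drift k X + noise k (fun i => w i k) (fun i => dd i k) X) i l.
Proof.
move=> k0 X.
have uE j : ((phi R n k)^T *m prev j) 0 0 = usig k j X.
  rewrite /usig /prj -big_split mxE; apply: eq_bigr => l' _; rewrite !mxE /=; ring.
rewrite /sc_update /=.
under eq_bigr => j aij do rewrite !uE gvalE// (shatE _ (fun j => dd j k))//.
rewrite !mxE /=.
set S := \sum_(j < N | _) _.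
have hE : \sum_j (H i k)^T l j * (H i k *m theta + w i k - H i k *m prev i) j 0 =
    \sum_r H i k r l * (- hx k i r X) + \sum_r H i k r l * w i k r 0.
  rewrite -big_split; apply: eq_bigr => r _; rewrite !mxE /= /hx -mulrDr; congr (_ * _).
  have -> : \sum_l H i k r l * X i l = \sum_j H i k r j * prev i j 0 - \sum_j H i k r j * theta j 0.
    by rewrite -sumrB; apply: eq_bigr => l' _; rewrite !mxE mulrBr.
  ring.
rewrite hE.
(* Insert the mean of the received bit with both signs. *)
have SE : S = \sum_(j < N | 0 < a i j) alp i j k * a i j * (gval k i j (usig k j X) - gval k i j (usig k i X))
   + \sum_(j < N | 0 < a i j) alp i j k * a i j *
      (bit_up k (fun j => dd j k) j i X - bit_down k (fun j => dd j k) j i X - gval k i j (usig k j X)).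
  by rewrite -big_split; apply: eq_bigr => j _; rewrite /=; ring.
rewrite SE; ring.
Qed.

Lemma sum_phi_sqr k : \sum_l phi R n k l 0 ^+ 2 <= 1.
Proof.
have [n0|n0] := posnP n.
  by move: (phi R n k); rewrite n0 => f; rewrite big_ord0 ler01.
have h : (k.-1 %% n < n)%N by rewrite ltn_mod.
rewrite (bigD1 (Ordinal h))//= big1 => [|l lN]; rewrite mxE.
  by rewrite eqxx addr0 expr1n.
case: eqP => [e|_]; last by rewrite expr0n.
by move: lN; rewrite -val_eqE /= e eqxx.
Qed.

Variable Hbar : R.
Hypothesis Hbar0 : 0 <= Hbar.
Hypothesis H_bnd : forall i k, (1 <= k)%N -> frob (H i k) <= Hbar.

Lemma H_sqr_le i k : (1 <= k)%N -> \sum_r \sum_l H i k r l ^+ 2 <= Hbar ^+ 2.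
Proof.
move=> k1; have s0 : 0 <= \sum_r \sum_l H i k r l ^+ 2.
  by apply: sumr_ge0 => r _; apply: sumr_ge0 => l _; exact: sqr_ge0.
have := H_bnd i k k1; rewrite /frob -(@ler_sqr R) ?nnegrE ?sqrtr_ge0//.
by rewrite sqr_sqrtr.
Qed.

Lemma sum_hx_sqr k i X : (1 <= k)%N -> \sum_r hx k i r X ^+ 2 <= Hbar ^+ 2 * \sum_l X i l ^+ 2.
Proof.
move=> k1; apply: le_trans (ler_wpM2r _ (H_sqr_le i k k1)).
  by rewrite mulr_suml; apply: ler_sum => r _; exact: sum_cauchy_schwarz.
by apply: sumr_ge0 => l _; exact: sqr_ge0.
Qed.

Lemma ip_sqrE X : ip X X = \sum_i \sum_l X i l ^+ 2.
Proof. by apply: eq_bigr => i _; apply: eq_bigr => l _; rewrite expr2. Qed.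

Lemma sum_hx_le k X : (1 <= k)%N -> \sum_i \sum_r hx k i r X ^+ 2 <= Hbar ^+ 2 * ip X X.
Proof.
by move=> k1; rewrite ip_sqrE mulr_sumr; apply: ler_sum => i _; exact: sum_hx_sqr.
Qed.

(** Drift and noise share this shape, one scalar per sensor along phi_k plus the transpose of H
    applied to a vector, so a single estimate serves all norm bounds. *)
Lemma ip_inject k (s : 'I_N -> R) (v : forall i, 'I_(m i) -> R) (c : R) (M : E) : (1 <= k)%N ->
  (forall i l, M i l = s i * phi R n k l 0 + c * \sum_r H i k r l * v i r) ->
  ip M M <= 2 * \sum_i s i ^+ 2 + 2 * c ^+ 2 * Hbar ^+ 2 * \sum_i \sum_r v i r ^+ 2.
Proof.
move=> k1 ME; rewrite ip_sqrE 2!mulr_sumr -big_split; apply: ler_sum => i _ /=.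
apply: (@le_trans _ _ (\sum_l (2 * s i ^+ 2 * phi R n k l 0 ^+ 2 + 2 * c ^+ 2 * (\sum_r H i k r l * v i r) ^+ 2))).
  apply: ler_sum => l _; rewrite ME; set p := s i * _; set q := \sum_r _.
  have := sqr_ge0 (p - c * q); rewrite /p; nra.
rewrite big_split /= -!mulr_sumr; apply: lerD.
  by rewrite -[leRHS]mulr1 ler_wpM2l ?sum_phi_sqr// mulr_ge0// sqr_ge0.
rewrite -[leRHS]mulrA; apply: ler_wpM2l; first by rewrite mulr_ge0 ?sqr_ge0.
apply: (@le_trans _ _ (\sum_l (\sum_r H i k r l ^+ 2) * (\sum_r v i r ^+ 2))).
  by apply: ler_sum => l _; exact: sum_cauchy_schwarz.
rewrite -mulr_suml ler_wpM2r//; first by apply: sumr_ge0 => r _; exact: sqr_ge0.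
by rewrite exchange_big /=; exact: H_sqr_le.
Qed.

(** Summation by parts over the edges: by symmetry of a, nu, b the exchange term is antisymmetric in
    (i, j), and averaging the two orientations gives the factor 1/2. The contribution of [theta] is
    the same at all sensors and cancels in differences. *)
Lemma drift_ip k X : (1 <= k)%N ->
  ip X (drift k X) = - (2^-1 * \sum_i \sum_(j < N | 0 < a i j) alp i j k * a i j *
     ((usig k i X - usig k j X) * (gval k i j (usig k i X) - gval k i j (usig k j X))))
   - be k * \sum_i \sum_r hx k i r X ^+ 2.
Proof.
move=> k1.
pose th := prj k ^~ (\matrix_(i, l) theta l 0).
have thE i j : th i = th j by apply: eq_bigr => l _; rewrite !mxE.
pose F i j := alp i j k * a i j * (gval k i j (usig k j X) - gval k i j (usig k i X)).
have FN i j : F j i = - F i j.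
  by rewrite /F /alp /gval Hnu_sym Ha_sym Hb_sym; ring.
have e1 : ip X (drift k X) = \sum_i \sum_(j < N | 0 < a i j) prj k i X * F i j
    - be k * \sum_i \sum_r hx k i r X ^+ 2.
  rewrite mulr_sumr -sumrB; apply: eq_bigr => i _.
  have -> : \sum_l X i l * drift k X i l = (\sum_(j < N | 0 < a i j) F i j) * prj k i X
      - be k * \sum_l \sum_r hx k i r X * (H i k r l * X i l).
    rewrite /prj 2!mulr_sumr -sumrB; apply: eq_bigr => l _; rewrite mxE -/(F i).
    have -> : \sum_r H i k r l * (- hx k i r X) = - \sum_r hx k i r X * H i k r l.
      by rewrite -sumrN; apply: eq_bigr => r _; ring.
    under [X in _ = _ - _ * X]eq_bigr do rewrite mulrA.
    by rewrite -mulr_suml; ring.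
  congr (_ - _ * _); first by rewrite mulr_suml; apply: eq_bigr => j _; rewrite mulrC.
  rewrite exchange_big /=; apply: eq_bigr => r _.
  by rewrite -mulr_sumr expr2.
have e2 : \sum_i \sum_(j < N | 0 < a i j) prj k i X * F i j =
    - \sum_i \sum_(j < N | 0 < a i j) prj k j X * F i j.
  rewrite (exchange_big_dep predT)//= -sumrN; apply: eq_bigr => j _.
  rewrite -sumrN; apply: eq_big => [i|i _]; first by rewrite Ha_sym.
  by rewrite FN mulrN.
have e3 : \sum_i \sum_(j < N | 0 < a i j) alp i j k * a i j *
     ((usig k i X - usig k j X) * (gval k i j (usig k i X) - gval k i j (usig k j X))) =
   \sum_i \sum_(j < N | 0 < a i j) prj k j X * F i j - \sum_i \sum_(j < N | 0 < a i j) prj k i X * F i j.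
  rewrite -sumrB; apply: eq_bigr => i _; rewrite -sumrB; apply: eq_bigr => j _.
  have -> : usig k i X - usig k j X = prj k i X - prj k j X.
    by rewrite /usig -/(th i) -/(th j) (thE j i); ring.
  by rewrite /F; ring.
by rewrite e1 e3 e2; lra.
Qed.

Hypothesis be_ge0 : forall k, 0 <= be k.

Lemma alp_ge0 i j k : 0 <= alp i j k.
Proof. by rewrite mulr_ge0// powR_ge0. Qed.

Lemma gval_monotone k i j u v : 0 < a i j -> 0 <= (u - v) * (gval k i j u - gval k i j v).
Proof.
move=> /Hb bp; have := scG_monotone R (nu i j * ln k%:R) (v / b i j) (u / b i j).
rewrite -/(gval k i j u) -/(gval k i j v) -mulrBl => h.
have -> : (u - v) = b i j * ((u - v) / b i j) by field; rewrite gt_eqF.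
by rewrite -mulrA mulr_ge0// ltW.
Qed.

Lemma drift_ip_le0 k X : (1 <= k)%N -> ip X (drift k X) <= 0.
Proof.
move=> k1; rewrite drift_ip//.
have h1 : 0 <= be k * \sum_i \sum_r hx k i r X ^+ 2.
  by rewrite mulr_ge0//; apply: sumr_ge0 => i _; apply: sumr_ge0 => r _; exact: sqr_ge0.
set S := \sum_i \sum_(j < N | _) _; have : 0 <= S; last lra.
apply: sumr_ge0 => i _; apply: sumr_ge0 => j aij.
by rewrite mulr_ge0 ?gval_monotone// mulr_ge0 ?alp_ge0.
Qed.

Variable Ca : R.
Hypothesis Ca1 : 1 <= Ca.
Hypothesis HCa : forall i j, 0 < a i j -> [/\ a i j <= Ca, (b i j)^-1 <= Ca & b i j / a i j <= Ca].

Definition psend (k : nat) (i j : 'I_N) (u : R) : R := sendp R (nu i j * ln k%:R) (u / b i j).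

Lemma psend_ge0 k i j u : 0 <= psend k i j u.
Proof. exact: sendp_ge0. Qed.

Let Ca0 : 0 <= Ca. Proof. exact: le_trans ler01 Ca1. Qed.

Lemma vnorm_sqr p (x : 'cV[R]_p) : vnorm x ^+ 2 = \sum_r x r 0 ^+ 2.
Proof. by rewrite sqr_sqrtr// sumr_ge0// => r _; exact: sqr_ge0. Qed.

Lemma edge_sum_sqr_le (F : 'I_N -> 'I_N -> R) :
  \sum_i (\sum_(j < N | 0 < a i j) F i j) ^+ 2 <= N%:R * \sum_i \sum_(j < N | 0 < a i j) F i j ^+ 2.
Proof.
rewrite mulr_sumr; apply: ler_sum => i _.
by have := sqr_sum_le 'I_N (fun j => 0 < a i j) (F i); rewrite card_ord.
Qed.

Lemma a_sqr_le i j : 0 < a i j -> a i j ^+ 2 <= Ca ^+ 2.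
Proof. by move=> aij; have [h _ _] := HCa i j aij; rewrite ler_sqr ?nnegrE. Qed.

(** The square of a centred bit is bounded linearly in the sending event and its probability instead
    of by a constant, so that the small conditional mean remains visible. *)
Lemma noise_ip k w d X : (1 <= k)%N ->
  ip (noise k w d X) (noise k w d X) <=
  (4 * N%:R * Ca ^+ 2 + 2 * Hbar ^+ 2) *
    (\sum_i \sum_(j < N | 0 < a i j) alp i j k ^+ 2 * (bit_up k d j i X + bit_down k d j i X + psend k i j (usig k j X))
     + be k ^+ 2 * \sum_i vnorm (w i) ^+ 2).
Proof.
move=> k1.
pose s i := \sum_(j < N | 0 < a i j) alp i j k * a i j *
      (bit_up k d j i X - bit_down k d j i X - gval k i j (usig k j X)).
have h1 := ip_inject k s (fun i r => w i r 0) (be k) (noise k w d X) k1 (fun i l => mxE _ _ _ _).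
apply: (le_trans h1).
under [X in _ + _ * X]eq_bigr do rewrite -vnorm_sqr.
set W := \sum_i vnorm _ ^+ 2.
set S := \sum_i \sum_(j < N | _) _.
have W0 : 0 <= W by apply: sumr_ge0 => i _; exact: sqr_ge0.
have ss : \sum_i s i ^+ 2 <= N%:R * (2 * Ca ^+ 2 * S).
  apply: (le_trans (edge_sum_sqr_le _)); rewrite ler_wpM2l// /S mulr_sumr.
  apply: ler_sum => i _; rewrite mulr_sumr; apply: ler_sum => j aij.
  set g := gval _ _ _ _.
  have gp : g ^+ 2 <= psend k i j (usig k j X) by exact: scG_sqr_le.
  have : (bit_up k d j i X - bit_down k d j i X - g) ^+ 2 <=
      2 * (bit_up k d j i X + bit_down k d j i X + psend k i j (usig k j X)).
    rewrite /bit_up /bit_down; move: (_ < _) (_ < _) => [] []; have := sqr_ge0 (1 + g); have := sqr_ge0 (1 - g);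
      rewrite /=; nra.
  set z := (_ - _ - g); set p := (_ + _ + _) => zp.
  have a2 := a_sqr_le i j aij.
  have p0 : 0 <= p by have := sqr_ge0 z; lra.
  have -> : (alp i j k * a i j * z) ^+ 2 = alp i j k ^+ 2 * (a i j ^+ 2 * z ^+ 2) by ring.
  have -> : 2 * Ca ^+ 2 * (alp i j k ^+ 2 * p) = alp i j k ^+ 2 * (Ca ^+ 2 * (2 * p)) by ring.
  by rewrite ler_wpM2l ?sqr_ge0// ler_pM ?sqr_ge0.
have S0 : 0 <= S.
  apply: sumr_ge0 => i _; apply: sumr_ge0 => j aij; rewrite mulr_ge0 ?sqr_ge0//.
  by rewrite addr_ge0 ?psend_ge0// addr_ge0// ler0n.
have c1 : 0 <= 4 * N%:R * Ca ^+ 2 by rewrite !mulr_ge0 ?sqr_ge0.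
have c2 : 0 <= 2 * Hbar ^+ 2 by rewrite !mulr_ge0 ?sqr_ge0.
have c3 : 0 <= be k ^+ 2 * W by rewrite mulr_ge0 ?sqr_ge0.
have := mulr_ge0 c1 c3; have := mulr_ge0 c2 S0.
move: (be k ^+ 2) ss => bb ss.
set A := N%:R * _ in ss.
have AE : 2 * A = 4 * N%:R * Ca ^+ 2 * S by rewrite /A; ring.
move: (4 * N%:R * Ca ^+ 2) AE => C1 AE.
move: (Hbar ^+ 2) => HH; nra.
Qed.

(** Bounding [gval] by 1 asks for no bound on [X]; the price is a term that does not vanish with
    [X]. It serves the almost sure boundedness of V. *)
Lemma drift_norm_global k X : (1 <= k)%N ->
  ip (drift k X) (drift k X) <= (8 * N%:R * Ca ^+ 2 + 2 * Hbar ^+ 4) *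
    (\sum_i \sum_(j < N | 0 < a i j) alp i j k ^+ 2 + be k ^+ 2 * ip X X).
Proof.
move=> k1.
pose s i := \sum_(j < N | 0 < a i j) alp i j k * a i j * (gval k i j (usig k j X) - gval k i j (usig k i X)).
have h1 := ip_inject k s (fun i r => - hx k i r X) (be k) (drift k X) k1 (fun i l => mxE _ _ _ _).
apply: (le_trans h1).
under [X in _ + _ * X]eq_bigr do under eq_bigr do rewrite sqrrN.
have hh := sum_hx_le k X k1.
set S := \sum_i \sum_(j < N | _) alp i j k ^+ 2.
have ss : \sum_i s i ^+ 2 <= N%:R * (4 * Ca ^+ 2 * S).
  apply: (le_trans (edge_sum_sqr_le _)); rewrite ler_wpM2l// /S mulr_sumr.
  apply: ler_sum => i _; rewrite mulr_sumr; apply: ler_sum => j aij.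
  have : `|gval k i j (usig k j X) - gval k i j (usig k i X)| <= 2.
    apply: (le_trans (ler_normB _ _)); have := scG_norm_le1 R (nu i j * ln k%:R) (usig k j X / b i j).
    have := scG_norm_le1 R (nu i j * ln k%:R) (usig k i X / b i j); rewrite /gval; lra.
  set z := (_ - _) => z2.
  have {}z2 : z ^+ 2 <= 4.
    have -> : (4 : R) = 2 ^+ 2 by ring.
    by rewrite -real_normK ?num_real// ler_sqr ?nnegrE.
  have a2 := a_sqr_le i j aij.
  have -> : (alp i j k * a i j * z) ^+ 2 = alp i j k ^+ 2 * (a i j ^+ 2 * z ^+ 2) by ring.
  have -> : 4 * Ca ^+ 2 * alp i j k ^+ 2 = alp i j k ^+ 2 * (Ca ^+ 2 * 4) by ring.
  by rewrite ler_wpM2l ?sqr_ge0// ler_pM ?sqr_ge0.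
have S0 : 0 <= S by apply: sumr_ge0 => i _; apply: sumr_ge0 => j _; exact: sqr_ge0.
have V0 := form_ge0 R _ _ psdform_ip X.
have h4 : 2 * be k ^+ 2 * Hbar ^+ 2 * \sum_i \sum_r hx k i r X ^+ 2 <= 2 * be k ^+ 2 * Hbar ^+ 2 * (Hbar ^+ 2 * ip X X).
  by rewrite ler_wpM2l// !mulr_ge0 ?sqr_ge0.
have c1 : 0 <= 8 * N%:R * Ca ^+ 2 by rewrite !mulr_ge0 ?sqr_ge0.
have c2 : 0 <= 2 * Hbar ^+ 4 by rewrite mulr_ge0 ?exprn_ge0.
have c3 : 0 <= be k ^+ 2 * ip X X by rewrite mulr_ge0 ?sqr_ge0.
have := mulr_ge0 c1 c3; have := mulr_ge0 c2 S0.
set A := N%:R * _ in ss.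
have AE : 2 * A = 8 * N%:R * Ca ^+ 2 * S by rewrite /A; ring.
have HE : 2 * be k ^+ 2 * Hbar ^+ 2 * (Hbar ^+ 2 * ip X X) = 2 * Hbar ^+ 4 * (be k ^+ 2 * ip X X) by ring.
rewrite HE in h4.
move: (8 * N%:R * Ca ^+ 2) (2 * Hbar ^+ 4) (be k ^+ 2 * ip X X) AE h4 => C1 C2 C3 AE h4.
lra.
Qed.

Lemma prj_sqr_le k i X : prj k i X ^+ 2 <= \sum_l X i l ^+ 2.
Proof.
have s0 : 0 <= \sum_l X i l ^+ 2 by apply: sumr_ge0 => l _; exact: sqr_ge0.
apply: (le_trans (sum_cauchy_schwarz _ _ _ _)).
by rewrite -[leRHS]mul1r ler_wpM2r// sum_phi_sqr.
Qed.

Lemma sum_prj_diff_le k X :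
  \sum_i \sum_(j < N | 0 < a i j) (prj k i X - prj k j X) ^+ 2 <= 4 * N%:R * ip X X.
Proof.
apply: (@le_trans _ _ (\sum_(i < N) \sum_(j < N) (2 * prj k i X ^+ 2 + 2 * prj k j X ^+ 2))).
  apply: ler_sum => i _; rewrite big_mkcond; apply: ler_sum => j _.
  case: ifP => _; last by rewrite addr_ge0// mulr_ge0// sqr_ge0.
  have := sqr_ge0 (prj k i X + prj k j X); lra.
have e (F : 'I_N -> R) : \sum_(i < N) \sum_(j < N) F i = N%:R * \sum_i F i.
  by rewrite mulr_sumr; apply: eq_bigr => i _; rewrite sumr_const card_ord mulr_natl.
have -> : \sum_(i < N) \sum_(j < N) (2 * prj k i X ^+ 2 + 2 * prj k j X ^+ 2) =
    4 * N%:R * \sum_i prj k i X ^+ 2.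
  under eq_bigr do rewrite big_split.
  rewrite big_split /= [X in _ + X]exchange_big /= !e -!mulr_sumr; ring.
rewrite ler_wpM2l ?mulr_ge0// ip_sqrE; apply: ler_sum => i _; exact: prj_sqr_le.
Qed.

Lemma usig_sub k i j X : usig k i X - usig k j X = prj k i X - prj k j X.
Proof.
rewrite /usig (_ : prj k i (\matrix_(i, l) theta l 0) = prj k j (\matrix_(i, l) theta l 0)); first ring.
by apply: eq_bigr => l _; rewrite !mxE.
Qed.

Lemma Qf_le k X : (1 <= k)%N -> Qf k X X <= (4 * N%:R + Hbar ^+ 2) * ip X X.
Proof.
move=> k1; rewrite /Qf mulrDl; apply: lerD.
  by under eq_bigr do under eq_bigr do rewrite -expr2; exact: sum_prj_diff_le.
by under eq_bigr do under eq_bigr do rewrite -expr2; exact: sum_hx_le.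
Qed.

(** * Drift estimates when the signals are bounded *)

Section Local.
Variables (k : nat) (X : E) (U : R).
Hypothesis k1 : (1 <= k)%N.
Hypothesis U0 : 0 <= U.
Hypothesis loc : forall i, `|usig k i X| <= U.

Let K : R := U * Ca.

Lemma loc_div i j : 0 < a i j -> `|usig k i X / b i j| <= K /\ `|usig k j X / b i j| <= K.
Proof.
move=> aij; have bp := Hb i j aij; have [_ b1 _] := HCa i j aij.
by rewrite !normrM normfV (gtr0_norm bp); split; apply: ler_pM => //; rewrite invr_ge0 ltW.
Qed.

Lemma powR_expRN i j : k%:R `^ nu i j * expR (- (nu i j * ln k%:R)) = 1 :> R.
Proof. by rewrite /powR pnatr_eq0 gtn_eqF// expRxMexpNx_1. Qed.

Let tau_ge0 i j : 0 < a i j -> 0 <= nu i j * ln k%:R.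
Proof.
by move=> aij; have /andP[? _] := Hnu _ _ aij; rewrite mulr_ge0// ln_ge0// ler1n.
Qed.

(** The gain contains k^nu and the slope of [gval] is of order k^(-nu); the product is of order be k
    on every edge, whatever its nu. The constant in front is at most 1, so the observation part of
    Qf fits under the same factor. *)
Lemma drift_ip_loc :
  ip X (drift k X) <= - (2^-1 * Ca^-1 * expR (- (3 * K)) * be k * Qf k X X).
Proof.
have K0 : 0 <= K by rewrite mulr_ge0.
rewrite drift_ip// /Qf.
under [X in _ - _ * X <= _]eq_bigr do under eq_bigr do rewrite expr2.
set HH := \sum_i \sum_(r < m i) _; set S := \sum_i \sum_(j < N | _) _; set S' := \sum_i \sum_(j < N | _) _.
have HH0 : 0 <= HH by apply: sumr_ge0 => i _; apply: sumr_ge0 => r _; rewrite -expr2 sqr_ge0.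
have CaV : 0 <= Ca^-1 <= 1 by rewrite invr_ge0 Ca0 invf_le1// (lt_le_trans ltr01 Ca1).
have e1 : 0 <= expR (- (3 * K)) <= 1 by rewrite expR_ge0 expR_le1 oppr_le0 mulr_ge0.
have key : Ca^-1 * expR (- (3 * K)) * be k * S' <= S.
  rewrite mulr_sumr; apply: ler_sum => i _; rewrite mulr_sumr; apply: ler_sum => j aij.
  have bp := Hb i j aij; have [_ b1 b2] := HCa i j aij; have [li lj] := loc_div i j aij.
  have := scG_strong_monotone R K (nu i j * ln k%:R) (usig k j X / b i j) (usig k i X / b i j)
    (tau_ge0 i j aij) lj li.
  rewrite -/(gval k i j (usig k i X)) -/(gval k i j (usig k j X)) -mulrBl.
  rewrite -!usig_sub; set dv := usig k i X - usig k j X; set dg := gval _ _ _ _ - _.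
  set ee := expR (- (3 * K)) in e1 *; move=> h.
  have bN0 : b i j != 0 by rewrite gt_eqF.
  have h' : ee * expR (- (nu i j * ln k%:R)) * dv ^+ 2 / b i j <= dv * dg.
    have := ler_wpM2l (ltW bp) h.
    have -> : b i j * (ee * expR (- (nu i j * ln k%:R)) * (dv / b i j) ^+ 2) =
      ee * expR (- (nu i j * ln k%:R)) * dv ^+ 2 / b i j by field.
    by have -> : b i j * (dv / b i j * dg) = dv * dg by field.
  have c0 : 0 <= alp i j k * a i j by rewrite mulr_ge0 ?alp_ge0.
  apply: le_trans (ler_wpM2l c0 h').
  have -> : alp i j k * a i j * (ee * expR (- (nu i j * ln k%:R)) * dv ^+ 2 / b i j) =
      (k%:R `^ nu i j * expR (- (nu i j * ln k%:R))) * (ee * be k * dv ^+ 2 * (a i j / b i j)).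
    by rewrite /alp; field.
  rewrite powR_expRN mul1r.
  have -> : Ca^-1 * ee * be k * (dv * dv) = ee * be k * dv ^+ 2 * Ca^-1 by ring.
  apply: ler_wpM2l; first by apply: mulr_ge0; rewrite ?sqr_ge0// mulr_ge0//; case/andP: e1.
  rewrite -[a i j / b i j]invrK invf_div lef_pV2 ?posrE//; last by rewrite divr_gt0.
  exact: lt_le_trans ltr01 Ca1.
move: e1 CaV => /andP[e10 e11] /andP[CaV0 CaV1].
have c1 : Ca^-1 * expR (- (3 * K)) <= 1 by rewrite mulr_ile1.
have c2 : 2^-1 * (Ca^-1 * expR (- (3 * K))) * (be k * HH) <= be k * HH.
  rewrite ler_piMl ?mulr_ge0//; lra.
have -> : 2^-1 * Ca^-1 * expR (- (3 * K)) * be k * (S' + HH) =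
  2^-1 * (Ca^-1 * expR (- (3 * K)) * be k * S') + 2^-1 * (Ca^-1 * expR (- (3 * K))) * (be k * HH) by ring.
lra.
Qed.

Lemma drift_norm_loc :
  ip (drift k X) (drift k X) <=
    (8 * N%:R ^+ 2 * (Ca ^+ 2 * expR K) ^+ 2 + 2 * Hbar ^+ 4) * be k ^+ 2 * ip X X.
Proof.
pose s i := \sum_(j < N | 0 < a i j) alp i j k * a i j * (gval k i j (usig k j X) - gval k i j (usig k i X)).
have h1 := ip_inject k s (fun i r => - hx k i r X) (be k) (drift k X) k1 (fun i l => mxE _ _ _ _).
apply: (le_trans h1).
under [X in _ + _ * X]eq_bigr do under eq_bigr do rewrite sqrrN.
have hh := sum_hx_le k X k1.
have ss : \sum_i s i ^+ 2 <= N%:R * ((be k * (Ca ^+ 2 * expR K)) ^+ 2 * (4 * N%:R * ip X X)).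
  apply: (le_trans (edge_sum_sqr_le _)); rewrite ler_wpM2l//.
  have := ler_wpM2l (sqr_ge0 (be k * (Ca ^+ 2 * expR K))) (sum_prj_diff_le k X).
  apply: le_trans; rewrite mulr_sumr.
  apply: ler_sum => i _; rewrite mulr_sumr; apply: ler_sum => j aij.
  have bp := Hb i j aij; have [a1 b1 _] := HCa i j aij; have [li lj] := loc_div i j aij.
  have := scG_lipschitz R K (nu i j * ln k%:R) (usig k j X / b i j) (usig k i X / b i j) lj li.
  rewrite -/(gval k i j (usig k i X)) -/(gval k i j (usig k j X)) -mulrBl usig_sub distrC.
  set dv := prj k i X - prj k j X; set dg := _ - _ => h.
  rewrite -[leRHS]exprMn -[leLHS]real_normK ?num_real// -[leRHS]real_normK ?num_real//.
  have CE : 0 <= be k * (Ca ^+ 2 * expR K) by rewrite !mulr_ge0 ?sqr_ge0 ?expR_ge0.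
  have aE : 0 <= alp i j k * a i j by rewrite mulr_ge0 ?alp_ge0.
  rewrite ler_sqr ?nnegrE// (normrM (alp i j k * _)) (ger0_norm aE) (normrM (be k * _)) (ger0_norm CE).
  apply: (le_trans (ler_wpM2l _ h)); first by rewrite mulr_ge0 ?alp_ge0.
  rewrite normrM normfV (gtr0_norm bp).
  have -> : alp i j k * a i j * (expR K * expR (- (nu i j * ln k%:R)) * (`|dv| / b i j)) =
    (k%:R `^ nu i j * expR (- (nu i j * ln k%:R))) * (be k * (a i j * (b i j)^-1 * expR K) * `|dv|).
    by rewrite /alp; ring.
  rewrite powR_expRN mul1r ler_wpM2r// ler_wpM2l// ler_wpM2r ?expR_ge0// expr2.
  by apply: ler_pM => //; rewrite invr_ge0 ltW.
have V0 := form_ge0 R _ _ psdform_ip X.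
have h4 : 2 * be k ^+ 2 * Hbar ^+ 2 * \sum_i \sum_r hx k i r X ^+ 2 <= 2 * be k ^+ 2 * Hbar ^+ 2 * (Hbar ^+ 2 * ip X X).
  by rewrite ler_wpM2l// !mulr_ge0 ?sqr_ge0.
have -> : (8 * N%:R ^+ 2 * (Ca ^+ 2 * expR K) ^+ 2 + 2 * Hbar ^+ 4) * be k ^+ 2 * ip X X =
  2 * (N%:R * ((be k * (Ca ^+ 2 * expR K)) ^+ 2 * (4 * N%:R * ip X X))) +
  2 * be k ^+ 2 * Hbar ^+ 2 * (Hbar ^+ 2 * ip X X) by ring.
by apply: lerD => //; rewrite ler_wpM2l.
Qed.

Lemma alp_psend_loc i j : 0 < a i j ->
  k%:R `^ nu i j * psend k i j (usig k j X) <= expR K.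
Proof.
move=> aij; have [_ lj] := loc_div i j aij.
have := sendp_ub R K (nu i j * ln k%:R) _ lj.
move=> /(ler_wpM2l (powR_ge0 k%:R (nu i j))) /le_trans; apply.
by rewrite mulrCA powR_expRN mulr1.
Qed.

End Local.

End Model.

Arguments alp {R N} nu be i j k.
Arguments ip {R N n} X Y.
Arguments prj {R N n} k i X.
Arguments hx {R N n m} H k i r X.
Arguments Qf {R N n m} a H k X Y.
Arguments usig {R N n} theta k i X.
Arguments gval {R N} nu b k i j u.
Arguments psend {R N} nu b k i j u.
Arguments drift {R N n m} a nu b H theta be k X.
Arguments noise {R N n m} a nu b H theta be k w d X.
Arguments bit_up {R N n} nu b theta k d j i X.
Arguments bit_down {R N n} nu b theta k d j i X.

(** * Connectivity and persistent excitation *)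

Section Connectivity.
Variables (R : realType) (N : nat) (a : 'M[R]_N).
Hypothesis Ha_sym : forall i j, a i j = a j i.
Hypothesis Ha_nneg : forall i j, 0 <= a i j.
Hypothesis Ha_rank : \rank (laplacian a) = N.-1.

Let e : rel 'I_N := fun i j => 0 < a i j.

Let lap_col (x : 'rV[R]_N) j : (x *m laplacian a) 0 j =
  x 0 j * (\sum_l a j l) - \sum_i x 0 i * a i j.
Proof.
rewrite mulmxBr !mxE; congr (_ - _).
under eq_bigr do rewrite !mxE.
rewrite (bigD1 j)//= eqxx mulr1n [X in _ + X]big1 ?addr0 => [|i /negPf ->]; last by rewrite mulr0n mulr0.
congr (_ * _); rewrite big_mkcond; apply: eq_bigr => l _.
by case: ltP => // h; apply/esym/le_anti; rewrite Ha_nneg h.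
Qed.

(** The indicator of the component of [i0] and the constant vector both lie in the kernel of the
    Laplacian, which the rank condition makes one-dimensional; a vertex outside the component would
    make them independent. *)
Lemma rank_connect i0 i : connect e i0 i.
Proof.
have N0 : (0 < N)%N by case: i0 => k; case: (N).
apply/negPn/negP => ni.
pose x : 'rV[R]_N := \row_i (connect e i0 i)%:R.
pose o : 'rV[R]_N := const_mx 1.
have xk : x *m laplacian a = 0.
  apply/rowP => j; rewrite lap_col mxE [RHS]mxE.
  have h l : x 0 l * a l j = (connect e i0 j)%:R * a j l.
    rewrite mxE Ha_sym; have [->|ajl] := eqVneq (a j l) 0; first by rewrite !mulr0.
    have jl : e j l by rewrite /e lt_neqAle eq_sym ajl Ha_nneg.
    have lj : e l j by rewrite /e Ha_sym.
    congr ((nat_of_bool _)%:R * _); apply/idP/idP => h; apply: connect_trans h _; exact: connect1.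
  by rewrite (eq_bigr _ (fun l _ => h l)) -mulr_sumr subrr.
have ok : o *m laplacian a = 0.
  apply/rowP => j; rewrite lap_col !mxE mul1r.
  by apply/eqP; rewrite subr_eq0; apply/eqP/eq_bigr => l _; rewrite mxE mul1r.
have xs : (x <= kermx (laplacian a))%MS by apply/sub_kermxP.
have os : (o <= kermx (laplacian a))%MS by apply/sub_kermxP.
have rk : \rank (kermx (laplacian a)) = 1%N by rewrite mxrank_ker Ha_rank; case: (N) N0 => // k _; rewrite subSnn.
have xN0 : x != 0.
  by apply/eqP => /rowP /(_ i0); rewrite !mxE connect0 => /eqP; rewrite oner_eq0.
have rx : \rank x = 1%N by rewrite rank_rV xN0.
have : (kermx (laplacian a) <= x)%MS.
  by have := mxrank_leqif_sup xs => -[_ <-]; rewrite rx rk.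
move=> /(submx_trans os) /sub_rVP[c] /rowP /(_ i); rewrite !mxE (negPf ni) mulr0 => /eqP.
by rewrite oner_eq0.
Qed.

Definition dirichlet (v : 'I_N -> R) : R := \sum_i \sum_(j < N | 0 < a i j) (v i - v j) ^+ 2.

Lemma dirichlet_ge0 v : 0 <= dirichlet v.
Proof. by apply: sumr_ge0 => i _; apply: sumr_ge0 => j _; exact: sqr_ge0. Qed.

Lemma dirichlet_edge v i j : e i j -> (v i - v j) ^+ 2 <= dirichlet v.
Proof.
move=> ij; rewrite /dirichlet (bigD1 i)//= (bigD1 j)//= -addrA lerDl addr_ge0//.
  by apply: sumr_ge0 => l _; exact: sqr_ge0.
by apply: sumr_ge0 => l _; apply: sumr_ge0 => l' _; exact: sqr_ge0.
Qed.

(** Follow a path and double at each edge; length l costs at most 4^l. Comparing all vertices with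
    one fixed vertex makes the constant uniform. *)
Lemma poincare : exists2 C : R, 0 <= C & forall (v : 'I_N -> R) i j, (v i - v j) ^+ 2 <= C * dirichlet v.
Proof.
have [N0|N0] := posnP N.
  by exists 0 => // v i; have := ltn_ord i; rewrite {2}N0.
have pth p : forall i0, path e i0 p ->
    forall v : 'I_N -> R, (v (last i0 p) - v i0) ^+ 2 <= 4 ^+ size p * dirichlet v.
  elim: p => [|j p IH] i0 /=; first by move=> _ v; rewrite subrr expr0n mulr_ge0 ?dirichlet_ge0.
  move=> /andP[ij jp] v; have h1 := IH _ jp v; have h2 := dirichlet_edge v i0 j ij.
  have d0 := dirichlet_ge0 v.
  have s1 : 1 <= 4 ^+ size p :> R by rewrite exprn_ege1// ler1n.
  rewrite (exprS (4 : R)); move: (4 ^+ size p) s1 h1 => c s1 h1.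
  have h3 : (v (last j p) - v i0) ^+ 2 <= 2 * (v (last j p) - v j) ^+ 2 + 2 * (v i0 - v j) ^+ 2.
    by have := sqr_ge0 (v (last j p) - v j + (v i0 - v j)); lra.
  have h4 : dirichlet v <= c * dirichlet v by rewrite ler_peMl.
  lra.
pose i0 := Ordinal N0.
have ex i : exists c : R, 0 <= c /\ forall v : 'I_N -> R, (v i - v i0) ^+ 2 <= c * dirichlet v.
  have /connectP[p ip ->] := rank_connect i0 i.
  by exists (4 ^+ size p); split; [exact: exprn_ge0|exact: pth].
have [c cP] := fin_all_exists ex.
have cS i : c i <= \sum_i c i.
  by rewrite (bigD1 i)//= lerDl sumr_ge0// => j _; case: (cP j).
have S0 : 0 <= \sum_i c i by apply: sumr_ge0 => i _; case: (cP i).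
exists (4 * \sum_i c i); first by rewrite mulr_ge0.
move=> v i j; have d0 := dirichlet_ge0 v.
have h1 := (cP i).2 v; have h2 := (cP j).2 v.
have h1' := ler_wpM2r d0 (cS i); have h2' := ler_wpM2r d0 (cS j).
have h3 : (v i - v j) ^+ 2 <= 2 * (v i - v i0) ^+ 2 + 2 * (v j - v i0) ^+ 2.
  by have := sqr_ge0 (v i - v i0 + (v j - v i0)); lra.
move: (\sum_i c i) h1' h2' => S h1' h2'; lra.
Qed.

End Connectivity.

(** Discrete derivative of the triangular weights; it supplies the relation between [Rt] and [Rs]
    that [lyapunov_step] takes as a hypothesis. *)
Lemma window_shift {R : realType} (q : nat -> R) L t :
  \sum_(0 <= s < L) (L - s)%:R * q (t + s)%N =
  \sum_(0 <= s < L) (L - s)%:R * q (t.+1 + s)%N - \sum_(0 <= s < L) q (t.+1 + s)%N + L%:R * q t.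
Proof.
(* The weight vanishes at s = L, so the window may be lengthened by one before its first term is
   split off. *)
have h1 : \sum_(0 <= s < L.+1) (L - s)%:R * q (t + s)%N = \sum_(0 <= s < L) (L - s)%:R * q (t + s)%N.
  by rewrite big_nat_recr//= subnn mul0r addr0.
rewrite -h1 big_nat_recl// subn0 addn0 addrC; congr (_ + _).
rewrite -sumrB; apply: eq_big_nat => s /andP[_ sL].
rewrite addnS addSn -[X in _ = _ - X]mul1r -mulrBl; congr (_ * _).
by rewrite subnS -subn1 natrB ?subn_gt0.
Qed.

Lemma periodic_window_sum {R : realType} (f : nat -> R) n t :
  (forall k, f (k + n)%N = f k) -> \sum_(0 <= s < n) f (t + s)%N = \sum_(0 <= s < n) f s.
Proof.
move=> fn; elim: t => [|t <-] //.
have e1 : \sum_(0 <= s < n.+1) f (t + s)%N = \sum_(0 <= s < n) f (t + s)%N + f (t + n)%N by rewrite big_nat_recr.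
have e2 : \sum_(0 <= s < n.+1) f (t + s)%N = f t + \sum_(0 <= s < n) f (t.+1 + s)%N.
  by rewrite big_nat_recl// addn0; congr (_ + _); apply: eq_bigr => s _; rewrite addnS.
by apply: (addrI (f t)); rewrite -e2 e1 fn addrC.
Qed.

Section Excitation.
Variables (R : realType) (N n : nat) (m : 'I_N -> nat).
Variables (a : 'M[R]_N) (H : forall i : 'I_N, nat -> 'M[R]_(m i, n)).
Hypothesis N0 : (0 < N)%N.
Hypothesis Ha_sym : forall i j, a i j = a j i.
Hypothesis Ha_nneg : forall i j, 0 <= a i j.
Hypothesis Ha_rank : \rank (laplacian a) = N.-1.
Variable Hbar : R.
Hypothesis Hbar0 : 0 <= Hbar.
Hypothesis H_bnd : forall i k, (1 <= k)%N -> frob (H i k) <= Hbar.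
Variables (p : nat) (delta : R).
Hypothesis p0 : (0 < p)%N.
Hypothesis delta0 : 0 < delta.
Hypothesis H_pe : forall k, (1 <= k)%N ->
  loewner_ge ((p%:R)^-1 *: \sum_(k <= t < k + p) \sum_(i < N) ((H i t)^T *m H i t)) delta.
Local Notation E := 'M[R]_(N, n).

Lemma prjE k i (X : E) (n0 : (0 < n)%N) : prj k.+1 i X = X i (Ordinal (ltn_pmod k n0)).
Proof.
rewrite /prj (bigD1 (Ordinal (ltn_pmod k n0)))//= big1 ?addr0; first by rewrite mxE /= eqxx mul1r.
move=> l; rewrite -val_eqE /= => /negPf h; by rewrite mxE /= h mul0r.
Qed.

(** Any n consecutive steps visit each coordinate exactly once. *)
Lemma sum_prj_window t i j (X : E) :
  \sum_(0 <= s < n) (prj (t.+1 + s) i X - prj (t.+1 + s) j X) ^+ 2 = \sum_l (X i l - X j l) ^+ 2.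
Proof.
have [n0|n0] := posnP n.
  move: X; rewrite n0 => X; rewrite big_ord0 big_geq//.
pose f k := (prj k.+1 i X - prj k.+1 j X) ^+ 2.
have fn k : f (k + n)%N = f k.
  by rewrite /f !prjE; congr ((X _ _ - X _ _) ^+ 2); apply: val_inj; rewrite /= modnDr.
have := periodic_window_sum f n t fn; rewrite /f.
under eq_bigr do rewrite -addSn.
move=> ->; rewrite big_mkord; apply: eq_bigr => l _; rewrite !prjE.
by congr ((X _ _ - X _ _) ^+ 2); apply: val_inj; rewrite /= modn_small.
Qed.

Lemma pe_sum t (x : 'cV[R]_n) : delta * p%:R * \sum_l x l 0 ^+ 2 <=
  \sum_(0 <= s < p) \sum_i \sum_r (\sum_l H i (t.+1 + s)%N r l * x l 0) ^+ 2.
Proof.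
have := H_pe t.+1 isT x.
have -> : (x^T *m x) 0 0 = \sum_l x l 0 ^+ 2.
  by rewrite mxE; apply: eq_bigr => l _; rewrite mxE expr2.
have -> : (x^T *m ((p%:R)^-1 *: \sum_(t.+1 <= k < t.+1 + p) \sum_(i < N) ((H i k)^T *m H i k)) *m x) 0 0
    = p%:R^-1 * \sum_(t.+1 <= k < t.+1 + p) \sum_i \sum_r (\sum_l H i k r l * x l 0) ^+ 2.
  rewrite -scalemxAr -scalemxAl mxE; congr (_ * _).
  rewrite mulmx_sumr mulmx_suml summxE; apply: eq_bigr => k _.
  rewrite mulmx_sumr mulmx_suml summxE; apply: eq_bigr => i _.
  have -> : x^T *m ((H i k)^T *m H i k) *m x = (H i k *m x)^T *m (H i k *m x).
    by rewrite trmx_mul !mulmxA.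
  rewrite mxE; apply: eq_bigr => r _.
  by rewrite !mxE expr2.
have pp : 0 < p%:R :> R by rewrite ltr0n.
rewrite [X in _ <= X -> _]mulrC ler_pdivlMr// => h.
rewrite [leRHS](_ : _ = \sum_(t.+1 <= k < t.+1 + p) \sum_i \sum_r (\sum_l H i k r l * x l 0) ^+ 2).
  by apply: le_trans h; rewrite le_eqVlt; apply/orP; left; apply/eqP; ring.
rewrite -[in RHS](add0n t.+1) big_addn !add0n addKn; by apply: eq_bigr => s _; rewrite addnC.
Qed.

(** Over n steps every coordinate is exchanged, and the Poincare inequality bounds the deviation of
    all rows from row i0. Over p steps persistent excitation bounds row i0 itself, once every
    sensor's error is replaced by it at the cost of that deviation. A window of n + p contains
    both. *)
Lemma excitation : exists2 kap : R, 0 < kap & forall t (X : E),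
  kap * ip X X <= \sum_(0 <= s < n + p) Qf a H (t.+1 + s) X X.
Proof.
have [Cc Cc0 pc] := poincare R N a Ha_sym Ha_nneg Ha_rank.
pose dp := delta * p%:R.
have dp0 : 0 < dp by rewrite mulr_gt0// ltr0n.
(* Coefficients of the final estimate ip X X <= C1 D2 + C2 D1, with D1 the disagreement and D2 the
   observation part; the 1 in [kap] keeps the inverse positive. *)
pose C1 := 2 * N%:R * dp^-1 * 2.
pose C2 := 2 * N%:R * dp^-1 * (2 * p%:R * (Hbar ^+ 2 * (N%:R * Cc))) + 2 * N%:R * Cc.
have C10 : 0 <= C1 by rewrite !mulr_ge0// invr_ge0 ltW.
have C20 : 0 <= C2 by rewrite addr_ge0// !mulr_ge0 ?sqr_ge0// invr_ge0 ltW.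
exists (C1 + C2 + 1)^-1; first by rewrite invr_gt0 ltr_wpDl// addr_ge0.
move=> t X; rewrite mulrC ler_pdivrMr; last by rewrite ltr_wpDl// addr_ge0.
pose D1 := \sum_(0 <= s < n) \sum_i \sum_(j < N | 0 < a i j) (prj (t.+1 + s) i X - prj (t.+1 + s) j X) ^+ 2.
pose D2 := \sum_(0 <= s < p) \sum_i \sum_r hx H (t.+1 + s)%N i r X ^+ 2.
pose d1 k := \sum_i \sum_(j < N | 0 < a i j) (prj k i X - prj k j X) ^+ 2.
pose d2 k := \sum_i \sum_r hx H k i r X ^+ 2.
have d10 k : 0 <= d1 k by apply: sumr_ge0 => i _; apply: sumr_ge0 => j _; exact: sqr_ge0.
have d20 k : 0 <= d2 k by apply: sumr_ge0 => i _; apply: sumr_ge0 => j _; exact: sqr_ge0.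
have QE k : Qf a H k X X = d1 k + d2 k.
  by congr (_ + _); apply: eq_bigr => i _; apply: eq_bigr => j _; rewrite expr2.
have D12 : D1 + D2 <= \sum_(0 <= s < n + p) Qf a H (t.+1 + s) X X.
  under eq_bigr do rewrite QE.
  rewrite big_split; apply: lerD.
    rewrite (big_cat_nat (n := n))//= ?leq_addr// lerDl.
    by apply: sumr_ge0 => s _; exact: d10.
  rewrite /= (big_cat_nat (n := p))//= ?leq_addl// lerDl.
  by apply: sumr_ge0 => s _; exact: d20.
have D10 : 0 <= D1 by apply: sumr_ge0 => s _; exact: d10.
have D20 : 0 <= D2 by apply: sumr_ge0 => s _; exact: d20.
have D1E : D1 = \sum_l dirichlet R N a (fun i => X i l).
  rewrite /D1 exchange_big /= /dirichlet [RHS]exchange_big /=; apply: eq_bigr => i _.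
  rewrite exchange_big /= [RHS]exchange_big /=; apply: eq_bigr => j _.
  exact: sum_prj_window.
pose i0 := Ordinal N0.
(* The consensus matrix that repeats row i0. *)
pose Xb : E := \matrix_(i, l) X i0 l.
pose xb : 'cV[R]_n := \col_l X i0 l.
pose B := \sum_l xb l 0 ^+ 2.
have dev i : \sum_l (X i l - X i0 l) ^+ 2 <= Cc * D1.
  by rewrite D1E mulr_sumr; apply: ler_sum => l _; exact: (pc (fun i => X i l)).
have devip : ip (X - Xb) (X - Xb) <= N%:R * (Cc * D1).
  rewrite ip_sqrE; apply: (@le_trans _ _ (\sum_(i < N) Cc * D1)); last by rewrite sumr_const card_ord mulr_natl.
  apply: ler_sum => i _; apply: le_trans (dev i); rewrite le_eqVlt; apply/orP; left; apply/eqP.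
  by apply: eq_bigr => l _; rewrite !mxE.
have Xbip : ip Xb Xb = N%:R * B.
  rewrite ip_sqrE (eq_bigr (fun=> B)); first by rewrite sumr_const card_ord mulr_natl.
  by move=> i _; apply: eq_bigr => l _; rewrite !mxE.
have pe : dp * B <= 2 * D2 + 2 * p%:R * (Hbar ^+ 2 * (N%:R * (Cc * D1))).
  apply: (le_trans (pe_sum t xb)).
  have -> : 2 * p%:R * (Hbar ^+ 2 * (N%:R * (Cc * D1))) =
      \sum_(0 <= s < p) 2 * (Hbar ^+ 2 * (N%:R * (Cc * D1))).
    by rewrite sumr_const_nat subn0 -[RHS]mulr_natl; ring.
  rewrite /D2 mulr_sumr -big_split; apply: ler_sum => s _ /=.
  set k := (t.+1 + s)%N.
  have h : \sum_i \sum_r hx H k i r (X - Xb) ^+ 2 <= Hbar ^+ 2 * (N%:R * (Cc * D1)).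
    apply: (le_trans (sum_hx_le R N n m H Hbar Hbar0 H_bnd k _ isT)).
    by rewrite ler_wpM2l ?sqr_ge0.
  apply: (@le_trans _ _ (2 * d2 k + 2 * \sum_i \sum_r hx H k i r (X - Xb) ^+ 2)); last first.
    by rewrite lerD2l ler_wpM2l.
  rewrite /d2 !mulr_sumr -big_split; apply: ler_sum => i _ /=.
  rewrite !mulr_sumr -big_split; apply: ler_sum => r _ /=.
  have -> : \sum_l H i k r l * xb l 0 = hx H k i r X - hx H k i r (X - Xb).
    by rewrite /hx -sumrB; apply: eq_bigr => l _; rewrite !mxE; ring.
  have := sqr_ge0 (hx H k i r X + hx H k i r (X - Xb)).
  by move: (hx _ _ _ _ _) (hx _ _ _ _ _) => y z; nra.
have Bb : B <= dp^-1 * (2 * D2 + 2 * p%:R * (Hbar ^+ 2 * (N%:R * (Cc * D1)))).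
  by rewrite mulrC ler_pdivlMr// mulrC.
have ipX : ip X X <= 2 * (N%:R * B) + 2 * (N%:R * (Cc * D1)).
  rewrite -Xbip; have := form_sqrD_le R _ _ (psdform_ip R N n) Xb (X - Xb).
  rewrite addrCA subrr addr0; lra.
have NB : N%:R * B <= N%:R * (dp^-1 * (2 * D2 + 2 * p%:R * (Hbar ^+ 2 * (N%:R * (Cc * D1))))).
  by rewrite ler_wpM2l.
have h : ip X X <= C1 * D2 + C2 * D1.
  have -> : C1 * D2 + C2 * D1 = 2 * (N%:R * (dp^-1 * (2 * D2 + 2 * p%:R * (Hbar ^+ 2 * (N%:R * (Cc * D1)))))) + 2 * (N%:R * (Cc * D1)).
    by rewrite /C1 /C2; ring.
  lra.
apply: (le_trans h); have D120 := addr_ge0 D10 D20.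
apply: (@le_trans _ _ ((D1 + D2) * (C1 + C2 + 1))); last first.
  by rewrite ler_wpM2r// addr_ge0// addr_ge0.
have := mulr_ge0 C10 D10; have := mulr_ge0 C20 D20; nra.
Qed.

End Excitation.

(** * Powers of the Lyapunov function *)

Lemma powR_le1 {R : realType} (x r : R) : 0 <= x <= 1 -> 0 <= r -> x `^ r <= 1.
Proof. by move=> /andP[x0 x1] r0; have := ler_powRl R r x 1 r0 x0 x1; rewrite powR1. Qed.

Lemma powR_2q_le {R : realType} (q x : R) : 1 < q -> 0 <= x <= 1 -> (x ^+ 2) `^ q <= x `^ (1 + q).
Proof.
move=> q1 x01; have /andP[x0 x1] := x01.
have -> : (x ^+ 2) `^ q = x `^ (1 + q) * x `^ (q - 1).
  rewrite -powR_mulrn// -powRrM -powRD; first by congr powR; ring.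
  by apply/implyP => /eqP ?; exfalso; lra.
by rewrite ler_piMr ?powR_ge0// powR_le1//; lra.
Qed.

Lemma powR_le_mul4 {R : realType} (q x : R) : 1 < q <= 2 -> 0 <= x <= 4 -> x `^ q <= 4 * x.
Proof.
move=> /andP[q1 q2] /andP[x0 x4]; rewrite powR_pred// ler_wpM2r//.
apply: (@le_trans _ _ ((4 : R) `^ (q - 1))); first by apply: ler_powRl => //; lra.
rewrite -[leRHS]powRr1//; apply: ler_powR; lra.
Qed.

Section PowerStep.
Variables (R : realType) (I : finType) (q cc D F Cw : R).
Hypothesis q12 : 1 < q <= 2.
Hypothesis cc0 : 0 < cc.
Hypothesis D0 : 0 <= D.
Hypothesis F0 : 0 <= F.
Hypothesis Cw0 : 0 <= Cw.

(** The letters: [tau] = k^nubar, [W] the squared observation noise, [al] the edge gains, [s] the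
    sending events, [pi] their conditional probabilities. Each s + pi is written (s - pi) + 2 pi;
    the centred part joins the martingale terms and the [pi] part is of the order of the admissible
    error. Young's inequality uses half of the contraction, whence cc / 2. *)
Lemma power_step : exists2 C : R * R * R, [/\ 0 <= C.1.1, 0 <= C.1.2 & 0 <= C.2] &
  forall (b tau v v' mm r W Z : R) (al s pi : I -> R),
  0 < b <= 1 -> 1 <= tau -> cc * b <= 2^-1 -> 0 <= v -> 0 <= v' ->
  v' <= v - cc * b * v + mm + r -> mm ^+ 2 <= 4 * (v * r) -> 0 <= r ->
  r <= D * (\sum_p al p ^+ 2 * (s p + pi p) + b ^+ 2 * W) ->
  (forall p, [/\ 0 <= al p <= 1, 0 <= s p <= 2 & 0 <= pi p <= 2]) ->
  (forall p, al p ^+ 2 * pi p <= b ^+ 2 * tau * F) ->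
  (forall p, al p `^ (1 + q) * pi p <= b `^ (1 + q) * tau `^ q * F) ->
  0 <= W -> 0 <= Z -> (1 + W) `^ q <= Cw * (1 + Z) ->
  v' `^ q <= (1 - cc / 2 * b) * v `^ q + q * (v - cc * b * v) `^ (q - 1) * mm
    + \sum_p (C.1.1 * (v - cc * b * v) `^ (q - 1) * al p ^+ 2 + C.1.2 * al p `^ (1 + q)) * (s p - pi p)
    + C.2 * (b `^ (1 + q) * tau `^ q) * (1 + Z).
Proof.
have /andP[q1 q2] := q12.
pose n : R := #|I|%:R.
have n0 : 0 <= n by rewrite /n.
pose K : R := (2 + 3) ^+ 2 + 2 * 3 ^+ 2 + 2 * 3 + 4.
have K0 : 0 < K by rewrite /K; lra.
pose Cy := D * (2 * n * F + 1).
have Cy0 : 0 <= Cy by rewrite mulr_ge0// addr_ge0// !mulr_ge0.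
(* Chosen so that K eta0 = cc / 2, the share of the contraction given to Young's inequality. *)
pose eta0 := cc / (2 * K).
have eta00 : 0 < eta0 by rewrite divr_gt0// mulr_gt0.
pose C1 := K * D.
pose C2 := K * (D `^ q * 4 * (n ^+ 2 * 4)).
pose Cb := K * (eta0 `^ (1 - q) * Cy `^ q * Cw + D `^ q * 4 * Cw) + C2 * (2 * n * F).
have C10 : 0 <= C1 by rewrite mulr_ge0// ltW.
have C20 : 0 <= C2 by rewrite !mulr_ge0 ?powR_ge0 ?sqr_ge0 ?(ltW K0).
have Cb0 : 0 <= Cb.
  by rewrite addr_ge0 ?mulr_ge0 ?addr_ge0 ?mulr_ge0 ?powR_ge0 ?(ltW K0).
exists (C1, C2, Cb) => //= b tau v v' mm r W Z al s pi /andP[b0 b1] tau1 ccb v0 v'0 hv' hm r0 hr hp hB1 hB2 W0 Z0 hW.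
have q0 : 0 <= q by lra.
pose u := v - cc * b * v.
have u2 : 2^-1 * v <= u.
  have : cc * b * v <= 2^-1 * v by rewrite ler_wpM2r.
  rewrite /u; lra.
have u0 : 0 <= u by apply: le_trans u2; rewrite mulr_ge0.
have uv : u <= v by rewrite /u gerBl !mulr_ge0// ltW.
(* As v <= 2 u, 4 v r is at most 8 u r, rounded up to the square 9. *)
have hm' : mm ^+ 2 <= 3 ^+ 2 * (u * r).
  apply: (le_trans hm).
  have : 2^-1 * v * r <= u * r by rewrite ler_wpM2r.
  have : 0 <= u * r by rewrite mulr_ge0.
  lra.
have h1 : v' `^ q <= u `^ q + q * u `^ (q - 1) * mm + K * (u `^ (q - 1) * r + r `^ q).
  apply: (@le_trans _ _ ((u + mm + r) `^ q)).
    by apply: ler_powRl => //; apply: (le_trans hv'); rewrite /u.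
  apply: powR_perturb => //.
  by apply: (le_trans v'0); apply: (le_trans hv'); rewrite /u.
have uq : u `^ q <= (1 - cc * b) * v `^ q.
  have e : u = (1 - cc * b) * v by rewrite /u; ring.
  have f0 : 0 <= 1 - cc * b by lra.
  rewrite e powRM// ler_wpM2r ?powR_ge0//.
  rewrite powR_pred// ler_piMl//.
  apply: powR_le1; last lra.
  by rewrite f0 gerBl mulr_ge0// ltW.
have bq0 : 0 <= b `^ (1 + q) * tau `^ q by rewrite mulr_ge0 ?powR_ge0.
set BT := b `^ (1 + q) * tau `^ q in bq0 *.
pose M1 := \sum_p al p ^+ 2 * (s p - pi p).
pose M2 := \sum_p al p `^ (1 + q) * (s p - pi p).
pose A := \sum_p al p ^+ 2 * (s p + pi p).
have AE : A = M1 + 2 * \sum_p al p ^+ 2 * pi p.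
  by rewrite mulr_sumr -big_split; apply: eq_bigr => p _; rewrite /=; ring.
have B1 : \sum_p al p ^+ 2 * pi p <= n * (b ^+ 2 * tau * F).
  apply: (@le_trans _ _ (\sum_(p : I) b ^+ 2 * tau * F)); first exact: ler_sum.
  by rewrite sumr_const -mulr_natl.
have A0 : 0 <= A.
  apply: sumr_ge0 => p _; have [/andP[? _] /andP[? _] /andP[? _]] := hp p.
  by rewrite mulr_ge0 ?sqr_ge0// addr_ge0.
pose y := Cy * (b ^+ 2 * tau * (1 + W)).
have tau0 : 0 <= tau by exact: le_trans ler01 tau1.
have y0 : 0 <= y.
  by apply: mulr_ge0 => //; apply: mulr_ge0; [apply: mulr_ge0 => //; exact: sqr_ge0|exact: addr_ge0].
have b20 : 0 <= b ^+ 2 by exact: sqr_ge0.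
have W10 : 0 <= 1 + W by exact: addr_ge0.
have b2t : 0 <= b ^+ 2 * tau by exact: mulr_ge0.
have btW : 0 <= b ^+ 2 * tau * (1 + W) by exact: mulr_ge0.
have ry : r <= D * M1 + y.
  apply: (le_trans hr); rewrite -/A AE.
  have -> : D * M1 + y = D * (M1 + (2 * n * F + 1) * (b ^+ 2 * tau * (1 + W))) by rewrite /y /Cy; ring.
  rewrite ler_wpM2l// -addrA lerD2l.
  have bt : b ^+ 2 <= b ^+ 2 * tau by rewrite ler_peMr.
  have bt0 : 0 <= b ^+ 2 * tau by exact: le_trans bt.
  have nF : 0 <= n * F by rewrite mulr_ge0.
  have h3 : b ^+ 2 * W <= b ^+ 2 * tau * W by rewrite ler_wpM2r.
  have h4 : 0 <= n * F * (b ^+ 2 * tau) * W by rewrite mulr_ge0// mulr_ge0.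
  have h5 : n * (b ^+ 2 * tau * F) = n * F * (b ^+ 2 * tau) by ring.
  rewrite h5 in B1.
  have -> : (2 * n * F + 1) * (b ^+ 2 * tau * (1 + W)) = 2 * (n * F * (b ^+ 2 * tau)) + 2 * (n * F * (b ^+ 2 * tau) * W) + b ^+ 2 * tau + b ^+ 2 * tau * W by ring.
  lra.
have pu := powR_ge0 u (q - 1).
have young : u `^ (q - 1) * y <= eta0 * b * v `^ q + eta0 `^ (1 - q) * Cy `^ q * Cw * BT * (1 + Z).
  have eb : 0 < eta0 * b by rewrite mulr_gt0.
  apply: (le_trans (young_powR R q u y (eta0 * b) q1 u0 y0 eb)).
  apply: lerD; first by apply: ler_wpM2l; [exact: ltW|exact: ler_powRl].
  rewrite /y powRM ?(ltW eta00) ?(ltW b0)// powRM//.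
  rewrite (@powRM R (b ^+ 2 * tau))// (@powRM R (b ^+ 2))//.
  have e : b `^ (1 - q) * (b ^+ 2) `^ q = b `^ (1 + q).
    rewrite -powR_mulrn ?(ltW b0)// -powRrM -powRD; first by congr powR; ring.
    by rewrite (gt_eqF b0) implybT.
  have -> : eta0 `^ (1 - q) * b `^ (1 - q) * (Cy `^ q * ((b ^+ 2) `^ q * tau `^ q * (1 + W) `^ q)) =
     eta0 `^ (1 - q) * Cy `^ q * (b `^ (1 - q) * (b ^+ 2) `^ q) * tau `^ q * (1 + W) `^ q by ring.
  rewrite e.
  have -> : eta0 `^ (1 - q) * Cy `^ q * Cw * BT * (1 + Z) =
    eta0 `^ (1 - q) * Cy `^ q * b `^ (1 + q) * tau `^ q * (Cw * (1 + Z)) by rewrite /BT; ring.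
  by rewrite ler_wpM2l// !mulr_ge0 ?powR_ge0.
have Wq0 : 0 <= b ^+ 2 * W by rewrite mulr_ge0.
have rq : r `^ q <= D `^ q * 4 * (n ^+ 2 * 4) * (M2 + 2 * n * F * BT) + D `^ q * 4 * Cw * BT * (1 + Z).
  apply: (@le_trans _ _ ((D * (A + b ^+ 2 * W)) `^ q)); first exact: ler_powRl.
  rewrite powRM ?addr_ge0//.
  have hAW : (A + b ^+ 2 * W) `^ q <= 4 * (A `^ q + (b ^+ 2 * W) `^ q).
    by apply: powR_add_le => //; apply/andP; split; lra.
  have hWq : (b ^+ 2 * W) `^ q <= Cw * BT * (1 + Z).
    rewrite powRM//.
    have -> : Cw * BT * (1 + Z) = BT * (Cw * (1 + Z)) by ring.
    apply: ler_pM; rewrite ?powR_ge0//.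
      apply: (@le_trans _ _ (b `^ (1 + q))); first by apply: powR_2q_le => //; rewrite (ltW b0).
      rewrite /BT ler_peMr ?powR_ge0//.
      by have := ler_powRl R q 1 tau q0 ler01 tau1; rewrite powR1.
    by apply: le_trans hW; apply: ler_powRl => //; lra.
  have hA : A `^ q <= n ^+ 2 * 4 * (M2 + 2 * n * F * BT).
    apply: (@le_trans _ _ (n ^+ 2 * \sum_p (al p ^+ 2 * (s p + pi p)) `^ q)).
      apply: powR_sum_le; first by apply/andP; split; lra.
      move=> p; have [/andP[? _] /andP[? _] /andP[? _]] := hp p.
      by rewrite mulr_ge0 ?sqr_ge0// addr_ge0.
    rewrite -mulrA ler_wpM2l ?sqr_ge0//.
    apply: (@le_trans _ _ (\sum_p 4 * (al p `^ (1 + q) * (s p - pi p) + 2 * (b `^ (1 + q) * tau `^ q * F)))).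
      apply: ler_sum => p _; have [/andP[a0 a1] /andP[s0 s2] /andP[p0 p2]] := hp p.
      rewrite powRM ?sqr_ge0 ?addr_ge0//.
      (* Since al <= 1, the exponent 2q may be lowered to 1 + q, the order that Young's inequality
         produces as well; and a bounded sum s + pi dominates its own power up to a factor, so the
         bound stays linear in [s] and can be centred. *)
      have e1 : (al p ^+ 2) `^ q <= al p `^ (1 + q) by apply: powR_2q_le => //; rewrite a0.
      have e2 : (s p + pi p) `^ q <= 4 * (s p + pi p).
        by apply: powR_le_mul4 => //; apply/andP; split; lra.
      apply: (@le_trans _ _ (al p `^ (1 + q) * (4 * (s p + pi p)))).
        by apply: ler_pM; rewrite ?powR_ge0.
      have := hB2 p; lra.
    rewrite -mulr_sumr ler_wpM2l// big_split /= -/M2 lerD2l sumr_const -mulr_natl -/n /BT.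
    by rewrite le_eqVlt; apply/orP; left; apply/eqP; ring.
  apply: (@le_trans _ _ (D `^ q * (4 * (n ^+ 2 * 4 * (M2 + 2 * n * F * BT) + Cw * BT * (1 + Z))))).
    rewrite ler_wpM2l ?powR_ge0//; apply: (le_trans hAW).
    by rewrite ler_wpM2l// lerD.
  by rewrite le_eqVlt; apply/orP; left; apply/eqP; ring.
have sumE : \sum_p (C1 * u `^ (q - 1) * al p ^+ 2 + C2 * al p `^ (1 + q)) * (s p - pi p) =
    C1 * u `^ (q - 1) * M1 + C2 * M2.
  by rewrite !mulr_sumr -big_split; apply: eq_bigr => p _; rewrite /=; ring.
rewrite -/u sumE; apply: (le_trans h1).
have hur : u `^ (q - 1) * r <= u `^ (q - 1) * (D * M1) + u `^ (q - 1) * y.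
  by rewrite -mulrDr ler_wpM2l.
have Keta : K * (eta0 * b * v `^ q) = cc / 2 * b * v `^ q by rewrite /eta0; field; rewrite gt_eqF.
have BZ : C2 * (2 * n * F * BT) <= C2 * (2 * n * F) * BT * (1 + Z).
  have -> : C2 * (2 * n * F * BT) = C2 * (2 * n * F) * BT by ring.
  apply: ler_peMr; last by rewrite lerDl.
  have nF : 0 <= 2 * n * F by rewrite !mulr_ge0.
  by apply: mulr_ge0 => //; exact: mulr_ge0.
have k1 := ler_wpM2l (ltW K0) hur; have k2 := ler_wpM2l (ltW K0) young; have k3 := ler_wpM2l (ltW K0) rq.
have C2E : K * (D `^ q * 4 * (n ^+ 2 * 4) * (M2 + 2 * n * F * BT)) = C2 * M2 + C2 * (2 * n * F * BT) by rewrite /C2; ring.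
have CbE : Cb * BT * (1 + Z) = K * (eta0 `^ (1 - q) * Cy `^ q * Cw * BT * (1 + Z)) + K * (D `^ q * 4 * Cw * BT * (1 + Z)) + C2 * (2 * n * F) * BT * (1 + Z).
  by rewrite /Cb; ring.
rewrite mulrDr C2E in k3; rewrite mulrDr Keta in k2; rewrite mulrDr in k1; rewrite CbE.
have C1E : K * (u `^ (q - 1) * (D * M1)) = C1 * u `^ (q - 1) * M1 by rewrite /C1; ring.
rewrite C1E in k1.
have KE : K * (u `^ (q - 1) * r + r `^ q) = K * (u `^ (q - 1) * r) + K * r `^ q by ring.
rewrite KE.
have uE : (1 - cc * b) * v `^ q + cc / 2 * b * v `^ q = (1 - cc / 2 * b) * v `^ q by field.
rewrite -uE; move: k1 k2 k3 uq BZ.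
move: (K * (u `^ (q - 1) * r)) (K * (u `^ (q - 1) * y)) (K * r `^ q) (C1 * u `^ (q - 1) * M1)
  (K * (eta0 `^ (1 - q) * Cy `^ q * Cw * BT * (1 + Z))) (K * (D `^ q * 4 * Cw * BT * (1 + Z)))
  (C2 * M2) (C2 * (2 * n * F * BT)) (C2 * (2 * n * F) * BT * (1 + Z)) (q * u `^ (q - 1) * mm)
  (cc / 2 * b * v `^ q) ((1 - cc * b) * v `^ q) (u `^ q).
move=> z1 z2 z3 z4 z5 z6 z7 z8 z9 z10 z11 z12 z13; lra.
Qed.

End PowerStep.

(** * Step sizes and weights *)

Section Steps.
Variables (R : realType) (ep : R).
Hypothesis ep01 : 0 < ep <= 1.

(* The factor [lg k `^ ep] makes [k * step k] tend to infinity, so that the contraction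
   eventually beats any rate, however small the random contraction constant is. *)
Definition step (k : nat) : R := lg R k `^ ep / k%:R.

Let ep0 : 0 < ep. Proof. by case/andP: ep01. Qed.
Let ep1 : ep <= 1. Proof. by case/andP: ep01. Qed.

Lemma step_ge0 k : 0 <= step k.
Proof. by rewrite divr_ge0 ?powR_ge0. Qed.

Lemma lgp_ge1 k : 1 <= lg R k `^ ep.
Proof. by have := ler_powRl R ep 1 (lg R k) (ltW ep0) ler01 (lg_ge1 R k); rewrite powR1. Qed.

Lemma step_ge k : k%:R^-1 <= step k.
Proof. by rewrite /step ler_peMl ?lgp_ge1. Qed.

Lemma step_gt0 k : (0 < k)%N -> 0 < step k.
Proof. by move=> k0; apply: lt_le_trans (step_ge k); rewrite invr_gt0 ltr0n. Qed.

Lemma lgS_le k : (0 < k)%N -> lg R k.+1 <= lg R k * (1 + k%:R^-1).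
Proof.
move=> k0; have kp : 0 < k%:R :> R by rewrite ltr0n.
have kp1 : 0 < k.+1%:R :> R by rewrite ltr0n.
have h : ln k.+1%:R - ln k%:R <= k%:R^-1 :> R.
  rewrite -ln_div ?posrE//; have := ln_le_subr1 R (k.+1%:R / k%:R) (divr_gt0 kp1 kp).
  move=> /le_trans; apply; rewrite -natr1 mulrDl divff ?gt_eqF// mul1r addrAC subrr add0r//.
have := lg_ge1 R k; have kV : 0 < k%:R^-1 :> R by rewrite invr_gt0.
move: h kV; rewrite /lg; move: (k%:R^-1 : R) (ln k%:R : R) (ln k.+1%:R : R) => x y z; nra.
Qed.

(** The logarithm grows by a factor of at most 1 + 1/k, and ep <= 1 keeps its power below the factor
    (k + 1) / k of the denominator. *)
Lemma step_noninc k : (0 < k)%N -> step k.+1 <= step k.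
Proof.
move=> k0; have kp : 0 < k%:R :> R by rewrite ltr0n.
have kp1 : 0 < k.+1%:R :> R by rewrite ltr0n.
rewrite /step ler_pdivrMr// mulrAC ler_pdivlMr//.
apply: (@le_trans _ _ ((lg R k * (1 + k%:R^-1)) `^ ep * k%:R)).
  rewrite ler_wpM2r//; apply: ler_powRl; [exact: ltW|exact/ltW/lg_gt0|exact: lgS_le].
rewrite powRM ?(ltW (lg_gt0 R k)) ?addr_ge0//.
rewrite -mulrA ler_wpM2l ?powR_ge0//.
have kE : k.+1%:R = (1 + k%:R^-1) * k%:R :> R by rewrite mulrDl mul1r mulVf ?gt_eqF// natr1.
rewrite kE ler_wpM2r//.
rewrite -[leRHS]powRr1; last by rewrite addr_ge0// invr_ge0.
by apply: ler_powR => //; rewrite lerDl invr_ge0.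
Qed.

Lemma step_sub_le k : (0 < k)%N -> step k - step k.+1 <= 1 * step k ^+ 2.
Proof.
move=> k0; have kp : 0 < k%:R :> R by rewrite ltr0n.
have kp1 : 0 < k.+1%:R :> R by rewrite ltr0n.
have h1 : lg R k `^ ep / k.+1%:R <= step k.+1.
  rewrite /step ler_wpM2r ?invr_ge0//; apply: ler_powRl; [exact: ltW|exact/ltW/lg_gt0|exact: lg_le].
have h2 : k%:R^-1 - k.+1%:R^-1 <= k%:R^-1 * k%:R^-1 :> R.
  have -> : k%:R^-1 - k.+1%:R^-1 = k%:R^-1 * k.+1%:R^-1 :> R.
    by rewrite -natr1; field; rewrite !gt_eqF//= natr1.
  by rewrite ler_wpM2l ?invr_ge0// lef_pV2 ?posrE// ler_nat.
have h3 : step k - step k.+1 <= lg R k `^ ep * (k%:R^-1 - k.+1%:R^-1) by rewrite mulrBr lerB.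
rewrite mul1r; apply: (le_trans h3).
apply: (@le_trans _ _ (lg R k `^ ep * (k%:R^-1 * k%:R^-1))); first by rewrite ler_wpM2l ?powR_ge0.
rewrite mulrA expr2 ler_wpM2l ?step_ge0//; exact: step_ge.
Qed.

Lemma lg_le_powR (s : R) k : 0 < s <= 1 -> (0 < k)%N -> lg R k <= s^-1 * k%:R `^ s.
Proof.
move=> /andP[s0 s1] k0; have kp : 0 < k%:R :> R by rewrite ltr0n.
have := ln_le_subr1 R (k%:R `^ s) (powR_gt0 _ kp); rewrite ln_powR => h.
by rewrite /lg -(ler_pM2l s0) mulrA divff ?gt_eqF// mul1r mulrDr mulr1; lra.
Qed.

Lemma step_le_powR (s : R) k : 0 < s <= 1 -> (0 < k)%N -> step k <= s^-1 * k%:R `^ (s - 1).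
Proof.
move=> s01 k0; have kp : 0 < k%:R :> R by rewrite ltr0n.
have -> : s^-1 * k%:R `^ (s - 1) = s^-1 * k%:R `^ s / k%:R.
  rewrite -mulrA; congr (_ * _); rewrite powRB ?powRr1 ?ltW//.
  by rewrite (gt_eqF kp) implybT.
rewrite /step ler_wpM2r ?invr_ge0//; apply: le_trans (lg_le_powR s k s01 k0).
rewrite -[leRHS]powRr1 ?(ltW (lg_gt0 R k))//; apply: ler_powR => //; exact: lg_ge1.
Qed.

Lemma sum_sqr_step (nu : R) : 0 <= nu < 2^-1 -> exists C : R, forall n,
  \sum_(0 <= k < n) (step k.+1 * k.+1%:R `^ nu) ^+ 2 <= C.
Proof.
(* With this s the squared term has exponent 2 (s - 1 + nu) = -1 - (1/2 - nu), which is summable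
   exactly because nu < 1/2. *)
move=> /andP[nu0 nu1]; pose s := (1 - 2 * nu) / 4.
have s01 : 0 < s <= 1 by apply/andP; split; rewrite /s; lra.
have d0 : 0 < 2^-1 - nu by lra.
pose f (k : nat) : R := (step k.+1 * k.+1%:R `^ nu) ^+ 2.
have fb k : f k <= s^-1 ^+ 2 * k.+1%:R `^ (- 1 - (2^-1 - nu)).
  have kp : 0 < k.+1%:R :> R by rewrite ltr0n.
  rewrite /f; apply: (@le_trans _ _ ((s^-1 * k.+1%:R `^ (s - 1) * k.+1%:R `^ nu) ^+ 2)).
    rewrite ler_sqr ?nnegrE ?mulr_ge0 ?powR_ge0 ?step_ge0//; last first.
      by rewrite invr_ge0; case/andP: s01 => /ltW.
    by rewrite ler_wpM2r ?powR_ge0// step_le_powR.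
  rewrite -mulrA exprMn ler_wpM2l ?sqr_ge0// -powRD; last by rewrite (gt_eqF kp) implybT.
  rewrite -powR_mulrn ?powR_ge0// -powRrM.
  apply: ler_powR; first by rewrite ler1n.
  by rewrite /s; lra.
have s20 : 0 <= s^-1 ^+ 2 :> R by exact: sqr_ge0.
exists (f 0%N + s^-1 ^+ 2 * (2^-1 - nu)^-1) => -[|n].
  rewrite big_nil addr_ge0 ?sqr_ge0// mulr_ge0// invr_ge0; lra.
rewrite big_nat_recl//; apply: lerD => //.
apply: (@le_trans _ _ (\sum_(0 <= k < n) s^-1 ^+ 2 * k.+2%:R `^ (- 1 - (2^-1 - nu)))).
  by apply: ler_sum => k _; exact: fb.
by rewrite -mulr_sumr ler_wpM2l// sum_riemann_le.
Qed.

Lemma lgp_large (c : R) : exists k0, forall k, (k0 <= k)%N -> c <= lg R k `^ ep.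
Proof.
pose x := `|c| `^ (ep^-1).
exists (Num.truncn (expR x)).+1 => k hk.
have k0 : (0 < k)%N by exact: leq_trans hk.
have kx : expR x <= k%:R.
  by apply: (le_trans (ltW (truncnS_gt _))); rewrite ler_nat.
have lx : x <= lg R k.
  have : x <= ln k%:R by rewrite -[leLHS]expRK ler_ln ?posrE ?expR_gt0 ?ltr0n.
  rewrite /lg; lra.
apply: (le_trans (ler_norm c)).
have -> : `|c| = x `^ ep by rewrite /x -powRrM mulVf ?gt_eqF// powRr1.
by apply: ler_powRl; [exact: ltW|exact: powR_ge0|].
Qed.

Lemma step_small (nu c : R) : 0 <= nu < 2^-1 -> 0 < c ->
  exists k0, forall k, (k0 <= k)%N -> step k * k%:R `^ nu <= c.
Proof.
move=> /andP[nu0 nu1] c0; pose s := (1 - 2 * nu) / 4.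
have s01 : 0 < s <= 1 by apply/andP; split; rewrite /s; lra.
pose g := 1 - s - nu.
have g0 : 0 < g by rewrite /g /s; lra.
pose y := (s^-1 / c) `^ g^-1.
exists (Num.truncn y).+1 => k hk.
have k0 : (0 < k)%N by exact: leq_trans hk.
have kp : 0 < k%:R :> R by rewrite ltr0n.
have ky : y <= k%:R by apply: (le_trans (ltW (truncnS_gt _))); rewrite ler_nat.
have sp : 0 < s^-1 by rewrite invr_gt0; case/andP: s01.
apply: (@le_trans _ _ (s^-1 * k%:R `^ (s - 1) * k%:R `^ nu)).
  by rewrite ler_wpM2r ?powR_ge0// step_le_powR.
rewrite -mulrA -powRD; last by rewrite (gt_eqF kp) implybT.
have -> : s - 1 + nu = - g by rewrite /g; ring.
rewrite powRN ler_pdivrMr ?powR_gt0// -ler_pdivrMl// mulrC.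
have -> : s^-1 / c = y `^ g.
  by rewrite /y -powRrM mulVf ?gt_eqF// powRr1// divr_ge0 ?ltW.
by apply: ler_powRl; [exact: ltW|exact: powR_ge0|].
Qed.

End Steps.

(** * Growth of the weights against the step sizes *)

Section Weights.
Variables (R : realType) (q nub : R).
Hypothesis q12 : 1 < q <= 3 / 2.
Hypothesis nub01 : 0 <= nub < 2^-1.

Let ep : R := (q - 1) / 4.

Lemma ep_bounds : 0 < ep <= 1.
Proof. by case/andP: q12 => h1 h2; apply/andP; split; rewrite /ep; lra. Qed.

Let st := step R ep.

Definition weight (k : nat) : R := k%:R `^ (1 - nub) / lg R k.

Lemma weight_ge0 k : 0 <= weight k.
Proof. by rewrite divr_ge0 ?powR_ge0// ltW// lg_gt0. Qed.

(** The weights to the power q grow by at most (1 + 1/k)^2, whereas (k + 1) st (k + 1) is a power of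
    the logarithm and exceeds 3 / c eventually; and (1 - 3 / (k + 1)) (1 + 1/k)^2 = (k - 2) (k + 1)
    / k^2 < 1. *)
Lemma weight_decay (c : R) : 0 < c -> exists k0, forall k, (k0 <= k)%N ->
  (1 - c * st k.+1) * weight k.+1 `^ q <= weight k `^ q.
Proof.
move=> c0; have /andP[q1 q2] := q12; have /andP[n0 n1] := nub01.
have [k0 hk0] := lgp_large R ep ep_bounds (3 / c).
exists k0.+1 => k hk.
have kg : (0 < k)%N by exact: leq_trans hk.
have kp : 0 < k%:R :> R by rewrite ltr0n.
have kp1 : 0 < k.+1%:R :> R by rewrite ltr0n.
have lk := lg_gt0 R k; have lk1 := lg_gt0 R k.+1.
have sE : st k.+1 = lg R k.+1 `^ ep / k.+1%:R by [].
have cs : 3 / k.+1%:R <= c * st k.+1.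
  rewrite sE mulrA ler_wpM2r ?invr_ge0// -ler_pdivrMl// mulrC.
  by apply: hk0; apply: leq_trans (leqnSn k); exact: ltnW.
pose x : R := k.+1%:R / k%:R.
have x1 : 1 <= x by rewrite /x ler_pdivlMr// mul1r ler_nat.
have wle : weight k.+1 <= weight k * x.
  rewrite /weight.
  have -> : k.+1%:R = k%:R * x by rewrite /x mulrCA divff ?gt_eqF// mulr1.
  rewrite powRM ?(ltW kp) ?(le_trans ler01 x1)//.
  have xx : x `^ (1 - nub) <= x.
    by rewrite -[leRHS]powRr1 ?(le_trans ler01 x1)//; apply: ler_powR => //; lra.
  have lV : (lg R k.+1)^-1 <= (lg R k)^-1 by rewrite lef_pV2 ?posrE// lg_le.
  apply: (@le_trans _ _ (k%:R `^ (1 - nub) * x * (lg R k)^-1)).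
    apply: ler_pM; rewrite ?mulr_ge0 ?powR_ge0 ?invr_ge0 ?(ltW lk1)//.
    by rewrite ler_wpM2l ?powR_ge0.
  by rewrite mulrAC.
have w0 := weight_ge0 k; have w10 := weight_ge0 k.+1.
have wq : weight k.+1 `^ q <= weight k `^ q * (x * x).
  apply: (@le_trans _ _ ((weight k * x) `^ q)); first by apply: ler_powRl => //; lra.
  rewrite powRM ?(le_trans ler01 x1)// ler_wpM2l ?powR_ge0//.
  have -> : x * x = x `^ 2%:R by rewrite powR_mulrn ?(le_trans ler01 x1)// expr2.
  by apply: ler_powR => //; lra.
have pk := powR_ge0 (weight k) q; have pk1 := powR_ge0 (weight k.+1) q.
have [neg|pos] := leP (1 - c * st k.+1) 0.
  by apply: le_trans pk; exact: mulr_le0_ge0.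
apply: (le_trans (ler_wpM2l (ltW pos) wq)).
rewrite mulrCA ler_piMr//.
have kr1 : 1 <= k%:R :> R by rewrite ler1n.
have pos3 : 1 - c * st k.+1 <= 1 - 3 / k.+1%:R by rewrite lerD2l lerN2.
have xx0 : 0 <= x * x by rewrite mulr_ge0// (le_trans ler01 x1).
apply: (le_trans (ler_wpM2r xx0 pos3)).
have -> : (1 - 3 / k.+1%:R) * (x * x) = (k%:R - 2) * (k%:R + 1) / (k%:R * k%:R).
  by rewrite /x -natr1; field; rewrite !gt_eqF//= natr1.
rewrite ler_pdivrMr ?mulr_gt0// mul1r; nra.
Qed.

(** The powers of k add up to -(1 + q) + nub q + (1 - nub) q = -1 and those of the logarithm to ep
    (1 + q) - q. *)
Lemma weight_err k : (0 < k)%N ->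
  st k `^ (1 + q) * (k%:R `^ nub) `^ q * weight k `^ q = k%:R^-1 * lg R k `^ (- 1 - (q - 1 - ep * (1 + q))).
Proof.
move=> k0; have kp : 0 < k%:R :> R by rewrite ltr0n.
have lk := lg_gt0 R k; have /andP[q1 q2] := q12.
rewrite /st /step /weight.
rewrite powRM ?powR_ge0 ?invr_ge0 ?(ltW kp)// powRM ?powR_ge0 ?invr_ge0 ?(ltW lk)//.
rewrite -!powR_inv1 ?(ltW kp) ?(ltW lk)// -!powRrM.
set l := lg R k in lk *; set kk := k%:R in kp *.
have -> : l `^ (ep * (1 + q)) * kk `^ (-1 * (1 + q)) * kk `^ (nub * q) * (kk `^ ((1 - nub) * q) * l `^ (-1 * q)) =
   (kk `^ (-1 * (1 + q)) * kk `^ (nub * q) * kk `^ ((1 - nub) * q)) * (l `^ (ep * (1 + q)) * l `^ (-1 * q)) by ring.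
by rewrite -!powRD ?(gt_eqF kp) ?(gt_eqF lk) ?implybT//; congr (powR _ _ * powR _ _); ring.
Qed.

(** Uniform in the shift [k0], because the process will be started at a time that depends on the
    level at which it is localised. *)
Lemma sum_weight_err : exists C : R, forall k0 n,
  \sum_(0 <= k < n) st (k + k0).+1 `^ (1 + q) * ((k + k0).+1%:R `^ nub) `^ q * weight (k + k0).+1 `^ q <= C.
Proof.
have /andP[q1 q2] := q12.
(* This equals (q - 1) (3 - q) / 4. *)
pose s := q - 1 - ep * (1 + q).
have s0 : 0 < s by rewrite /s /ep; nra.
pose f k : R := k.+1%:R^-1 * lg R k.+1 `^ (- 1 - s).
have f0 k : 0 <= f k by rewrite mulr_ge0 ?powR_ge0.
exists (1 + s^-1) => k0 n.
apply: (@le_trans _ _ (\sum_(0 <= k < n + k0) f k)).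
  rewrite [leRHS](big_cat_nat (n := k0)) ?leq_addl//=.
  have -> : \sum_(k0 <= k < n + k0) f k = \sum_(0 <= k < n) f (k + k0)%N.
    by rewrite -{1}[k0]add0n big_addn addnK.
  rewrite -[leLHS]add0r lerD ?sumr_ge0//.
  by apply: ler_sum => k _; rewrite weight_err.
case: (n + k0)%N => [|m]; first by rewrite big_nil addr_ge0// invr_ge0 ltW.
rewrite big_nat_recl//; apply: lerD; last exact: sum_lg_le.
by rewrite /f invr1 mul1r {1}/lg ln1 addr0 powR1.
Qed.

End Weights.

(** * The error process *)

Section MartingaleDifferences.
Context {R : realType} {d : measure_display} {T : measurableType d}.
Variables (P : probability T R) (G : set (set T)).
Hypothesis Gm : G `<=` measurable.

Definition mds (Y : T -> R) := P.-integrable setT (EFin \o Y) /\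
  forall A, <<s G >> A -> (\int[P]_(om in A) (Y om)%:E = 0)%E.

Lemma eq_mds (Y1 Y2 : T -> R) : Y1 =1 Y2 -> mds Y1 -> mds Y2.
Proof. by move=> /funext ->. Qed.

Lemma mds0 : mds (fun=> 0).
Proof.
split=> [|A GA]; last by rewrite integral0.
exact: (@finite_measure_integrable_cst _ _ _ P setT 0).
Qed.

Lemma mdsD Y1 Y2 : mds Y1 -> mds Y2 -> mds (fun om => Y1 om + Y2 om).
Proof.
move=> [i1 z1] [i2 z2]; split.
  by have := integrableD measurableT i1 i2; apply: eq_integrable.
move=> A GA; have mA : measurable A by exact: gen_measurable GA.
have i1A : P.-integrable A (EFin \o Y1) by exact: integrableS i1.
have i2A : P.-integrable A (EFin \o Y2) by exact: integrableS i2.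
under eq_integral do rewrite EFinD.
by rewrite integralD// z1// z2// adde0.
Qed.

Lemma mdsZ (c : R) Y : mds Y -> mds (fun om => c * Y om).
Proof.
move=> [i1 z1]; split.
  by have := integrableZl measurableT c i1; apply: eq_integrable.
move=> A GA; have mA : measurable A by exact: gen_measurable GA.
have iA : P.-integrable A (EFin \o Y) by exact: integrableS i1.
under eq_integral do rewrite EFinM.
by rewrite integralZl// z1// mule0.
Qed.

Lemma mdsB Y1 Y2 : mds Y1 -> mds Y2 -> mds (fun om => Y1 om - Y2 om).
Proof.
move=> h1 /(mdsZ (-1)) h2; apply: eq_mds (mdsD _ _ h1 h2) => om; ring.
Qed.

Lemma mds_sum (I : Type) (s : seq I) (p : pred I) (Y : I -> T -> R) :
  (forall i, p i -> mds (Y i)) -> mds (fun om => \sum_(i <- s | p i) Y i om).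
Proof.
move=> h; elim: s => [|i s IH].
  by apply: eq_mds mds0 => om; rewrite big_nil.
have [pi|npi] := boolP (p i).
  by apply: eq_mds (mdsD _ _ (h i pi) IH) => om; rewrite big_cons pi.
by apply: eq_mds IH => om; rewrite big_cons (negPf npi).
Qed.

End MartingaleDifferences.

Lemma gen_forall {T : pointedType} {G : set (set T)} N (F : 'I_N -> set T) :
  (forall i, <<s G >> (F i)) -> <<s G >> [set om | forall i, F i om].
Proof.
move=> GF.
rewrite (_ : [set om | _] = \bigcap_k (if insub k is Some i then F i else setT)).
  apply: (@bigcapT_measurable _ (g_sigma_algebraType G)) => k.
  case: insubP => [i _ _|_]; first exact: GF.
  exact: (@measurableT _ (g_sigma_algebraType G)).
apply/seteqP; split=> om /= h.
  by move=> k _; case: insubP.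
by move=> i; have := h i Logic.I; rewrite valK.
Qed.

Section Process.
Context {R : realType} {d : measure_display} {T : measurableType d}.
Variables (P : probability T R) (N n : nat) (m : 'I_N -> nat).
Variables (a nu b : 'M[R]_N) (H : forall i : 'I_N, nat -> 'M[R]_(m i, n)) (theta : 'cV[R]_n).
Variables (w : forall i : 'I_N, nat -> T -> 'cV[R]_(m i)) (dd : 'I_N -> nat -> T -> R).
Variables (th0 : 'I_N -> 'cV[R]_n) (be : nat -> R).
Hypothesis Ha_sym : forall i j, a i j = a j i.
Hypothesis w_meas : forall i k (j : 'I_(m i)), measurable_fun setT (fun om => w i k om j 0).
Hypothesis w_int : forall i k (j : 'I_(m i)), (1 <= k)%N ->
      P.-integrable setT (fun om => (w i k om j 0)%:E).
Hypothesis w_mds : forall i k (j : 'I_(m i)) (A : set T), (1 <= k)%N ->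
      filtF w dd k.-1 A -> (\int[P]_(om in A) (w i k om j 0)%:E = 0)%E.
Hypothesis dd_meas : forall i k, measurable_fun setT (dd i k).
Hypothesis dd_law : forall i k (x : R), (1 <= k)%N -> P [set om | dd i k om <= x] = (lapF x)%:E.
Hypothesis dd_indep : forall (S : seq ('I_N * nat)) (B : 'I_N * nat -> set R) (A : set T),
      uniq S -> all (fun p => (1 <= p.2)%N) S ->
      (forall p, measurable (B p)) -> sigmaW w A ->
      P (A `&` \big[setI/setT]_(p <- S) (dd p.1 p.2 @^-1` B p))
      = (P A * \prod_(p <- S) P (dd p.1 p.2 @^-1` B p))%E.
Hypothesis Hnu_sym : forall i j, nu i j = nu j i.
Hypothesis Hnu : forall i j, 0 < a i j -> 0 <= nu i j < 2^-1.
Hypothesis Hb_sym : forall i j, b i j = b j i.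
Hypothesis Hb : forall i j, 0 < a i j -> 0 < b i j.

Definition err (om : T) (k : nat) : 'M[R]_(N, n) := \matrix_(i, l)
  (sc_est a nu b (alp nu be) (fun=> be) H theta (fun i t => w i t om) (fun i t => dd i t om) th0 k i l 0
   - theta l 0).

Definition err_drift om k := drift a nu b H theta be k.+1 (err om k).

Definition err_noise om k :=
  noise a nu b H theta be k.+1 (fun i => w i k.+1 om) (fun i => dd i k.+1 om) (err om k).

Lemma err_step om k : err om k.+1 = err om k + err_drift om k + err_noise om k.
Proof.
apply/matrixP => i l; rewrite [LHS]mxE.
rewrite (sc_update_split R N n m a nu b H theta be Hnu_sym Hnu Hb_sym Hb
  (fun i t => w i t om) (fun i t => dd i t om) k.+1
  (sc_est a nu b (alp nu be) (fun=> be) H theta (fun i t => w i t om) (fun i t => dd i t om) th0 k) i l isT).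
by [].
Qed.

Local Notation F := (genF w dd).

Lemma gfun_prj G t i (X : T -> 'M[R]_(N, n)) :
  (forall i l, gfun G (fun om => X om i l)) -> gfun G (fun om => prj t i (X om)).
Proof. by move=> GX; apply: gfun_sum => l; apply: gfunM => //; exact: gfun_cst. Qed.

Lemma gfun_usig G t i (X : T -> 'M[R]_(N, n)) :
  (forall i l, gfun G (fun om => X om i l)) -> gfun G (fun om => usig theta t i (X om)).
Proof. by move=> GX; apply: gfunD; [exact: gfun_prj|exact: gfun_cst]. Qed.

Lemma gfun_hx G t i r (X : T -> 'M[R]_(N, n)) :
  (forall i l, gfun G (fun om => X om i l)) -> gfun G (fun om => hx H t i r (X om)).
Proof. by move=> GX; apply: gfun_sum => l; apply: gfunM => //; exact: gfun_cst. Qed.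

Lemma gfun_lapF G (X : T -> R) : gfun G X -> gfun G (fun om => lapF (X om)).
Proof. exact: (gfun_comp _ _ _ measurable_lapF). Qed.

Lemma gfun_gval G t i j (X : T -> R) : gfun G X -> gfun G (fun om => gval nu b t i j (X om)).
Proof.
move=> GX; have GY : gfun G (fun om => X om / b i j) by apply: gfunM => //; exact: gfun_cst.
by apply: gfunB; apply: gfun_lapF; apply: gfunB; rewrite ?gfun_cst//; [exact: gfun_cst|exact: gfunN|exact: gfun_cst].
Qed.

Lemma gfun_bool G (f : T -> bool) :
  measurable_fun [set: g_sigma_algebraType G] (f : g_sigma_algebraType G -> bool) ->
  gfun G (fun om => (f om)%:R : R).
Proof. by move=> mf; apply: (measurableT_comp (f := fun x : bool => x%:R : R)). Qed.

Lemma gfun_err k i l : gfun (F k) (fun om => err om k i l).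
Proof.
elim: k i l => [|k IH] i l.
  rewrite (_ : (fun om => _) = fun=> th0 i l 0 - theta l 0); first exact: gfun_cst.
  by apply/funext => om; rewrite mxE.
have GX i' l' : gfun (F k.+1) (fun om => err om k i' l').
  exact: (gfun_sub _ _ _ (genF_incr w dd k)) (IH i' l').
have Gu j : gfun (F k.+1) (fun om => usig theta k.+1 j (err om k)) by exact: gfun_usig.
have Gd j : gfun (F k.+1) (dd j k.+1) by apply: gfun_dd; rewrite leqnn.
have Gz j c : gfun (F k.+1) (fun om => usig theta k.+1 j (err om k) + c * dd j k.+1 om).
  by apply: gfunD => //; apply: gfunM => //; exact: gfun_cst.
rewrite (_ : (fun om => _) = fun om => err om k i l + err_drift om k i l + err_noise om k i l); last first.
  by apply/funext => om; rewrite err_step mxE [X in X + _]mxE.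
apply: gfunD; first apply: gfunD => //.
- rewrite (_ : (fun om => _) = fun om =>
    (\sum_(j < N | 0 < a i j) alp nu be i j k.+1 * a i j *
       (gval nu b k.+1 i j (usig theta k.+1 j (err om k)) - gval nu b k.+1 i j (usig theta k.+1 i (err om k))))
     * phi R n k.+1 l 0
    + be k.+1 * \sum_r H i k.+1 r l * (- hx H k.+1 i r (err om k))); last by apply/funext => om; rewrite mxE.
  apply: gfunD; apply: gfunM; try exact: gfun_cst; apply: gfun_sum => j; apply: gfunM; try exact: gfun_cst.
  + by apply: gfunB; exact: gfun_gval.
  + by apply: gfunN; exact: gfun_hx.
- rewrite (_ : (fun om => _) = fun om =>
    (\sum_(j < N | 0 < a i j) alp nu be i j k.+1 * a i j *
       (bit_up nu b theta k.+1 (fun i => dd i k.+1 om) j i (err om k) -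
        bit_down nu b theta k.+1 (fun i => dd i k.+1 om) j i (err om k) -
        gval nu b k.+1 i j (usig theta k.+1 j (err om k))))
     * phi R n k.+1 l 0
    + be k.+1 * \sum_r H i k.+1 r l * w i k.+1 om r 0); last by apply/funext => om; rewrite mxE.
  apply: gfunD; apply: gfunM; try exact: gfun_cst; apply: gfun_sum => j; apply: gfunM; try exact: gfun_cst.
  + apply: gfunB; last exact: gfun_gval.
    by apply: gfunB; apply: gfun_bool; apply: gfun_lt => //; exact: gfun_cst.
  + by apply: gfun_w; rewrite leqnn.
Qed.

Let Fm k : F k `<=` measurable. Proof. exact: genF_measurable. Qed.

Let usig_gfun k j : gfun (F k) (fun om => usig theta k.+1 j (err om k)).
Proof. by apply: gfun_usig => i l; exact: gfun_err. Qed.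

(** The sender j draws with nu_ji and b_ji while the receiver i compensates with nu_ij and b_ij; the
    symmetry of the coefficients makes the means match. *)
Lemma mds_up k i j : 0 < a i j -> mds P (F k) (fun om =>
  bit_up nu b theta k.+1 (fun i => dd i k.+1 om) j i (err om k)
  - lapF (usig theta k.+1 j (err om k) / b i j - nu i j * ln k.+1%:R)).
Proof.
move=> aij; have bp : 0 < b j i by rewrite Hb_sym Hb.
have E om : lapF ((usig theta k.+1 j (err om k) - nu j i * b j i * ln k.+1%:R) / b j i) =
    lapF (usig theta k.+1 j (err om k) / b i j - nu i j * ln k.+1%:R).
  by rewrite Hnu_sym Hb_sym; congr lapF; field; rewrite Hb_sym gt_eqF.
have ind := dither_indep P w dd w_meas dd_meas dd_indep k j.
split.
- have := integrable_sent_up P (F k) (dd j k.+1) (Fm k) (dd_meas j k.+1) _ (b j i)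
    (nu j i * b j i * ln k.+1%:R) (usig_gfun k j).
  by apply: eq_integrable => // om _ /=; rewrite E.
- move=> A GA.
  have := sent_up_cond P (F k) (dd j k.+1) (Fm k) (dd_meas j k.+1) (ind) (fun x => dd_law j k.+1 x isT) _ (b j i)
    (nu j i * b j i * ln k.+1%:R) (usig_gfun k j) bp A GA.
  by move=> <-; apply: eq_integral => om _; rewrite E.
Qed.

Lemma mds_down k i j : 0 < a i j -> mds P (F k) (fun om =>
  bit_down nu b theta k.+1 (fun i => dd i k.+1 om) j i (err om k)
  - lapF (- (usig theta k.+1 j (err om k) / b i j) - nu i j * ln k.+1%:R)).
Proof.
move=> aij; have bp : 0 < b j i by rewrite Hb_sym Hb.
have E om : lapF ((- usig theta k.+1 j (err om k) - nu j i * b j i * ln k.+1%:R) / b j i) =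
    lapF (- (usig theta k.+1 j (err om k) / b i j) - nu i j * ln k.+1%:R).
  by rewrite Hnu_sym Hb_sym; congr lapF; field; rewrite Hb_sym gt_eqF.
have ind := dither_indep P w dd w_meas dd_meas dd_indep k j.
split.
- have := integrable_sent_down P (F k) (dd j k.+1) (Fm k) (dd_meas j k.+1) _ (b j i)
    (nu j i * b j i * ln k.+1%:R) (usig_gfun k j).
  by apply: eq_integrable => // om _ /=; rewrite E.
- move=> A GA.
  have := sent_down_cond P (F k) (dd j k.+1) (Fm k) (dd_meas j k.+1) (ind) (fun x => dd_law j k.+1 x isT) _ (b j i)
    (nu j i * b j i * ln k.+1%:R) (usig_gfun k j) bp A GA.
  by move=> <-; apply: eq_integral => om _; rewrite E.
Qed.

(** The centred sending event, needed for the squared noise; [err_noise] only involves the centred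
    bit itself. *)
Definition send_noise om k (i j : 'I_N) : R := if 0 < a i j then
  bit_up nu b theta k.+1 (fun i => dd i k.+1 om) j i (err om k)
  + bit_down nu b theta k.+1 (fun i => dd i k.+1 om) j i (err om k)
  - psend nu b k.+1 i j (usig theta k.+1 j (err om k)) else 0.

Lemma mds_send k i j : mds P (F k) (fun om => send_noise om k i j).
Proof.
have [aij|naij] := boolP (0 < a i j); last first.
  by apply: eq_mds (mds0 P (F k)) => om; rewrite /send_noise (negPf naij).
apply: eq_mds (mdsD _ _ (Fm k) _ _ (mds_up k i j aij) (mds_down k i j aij)) => om.
by rewrite /send_noise aij /psend /sendp; ring.
Qed.

Lemma mds_noise k i l : mds P (F k) (fun om => err_noise om k i l).
Proof.
have h1 : mds P (F k) (fun om => \sum_(j < N | 0 < a i j) alp nu be i j k.+1 * a i j *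
       (bit_up nu b theta k.+1 (fun i => dd i k.+1 om) j i (err om k) -
        bit_down nu b theta k.+1 (fun i => dd i k.+1 om) j i (err om k) -
        gval nu b k.+1 i j (usig theta k.+1 j (err om k)))).
  apply: mds_sum => // j aij; apply: mdsZ => //.
  apply: eq_mds (mdsB _ _ (Fm k) _ _ (mds_up k i j aij) (mds_down k i j aij)) => om.
  by rewrite /gval /scG; ring.
have h2 : mds P (F k) (fun om => \sum_r H i k.+1 r l * w i k.+1 om r 0).
  apply: mds_sum => // r _; apply: mdsZ => //; split; first exact: w_int.
  by move=> A GA; exact: (w_mds i k.+1 r A).
apply: eq_mds (mdsD _ _ (Fm k) _ _ (mdsZ _ _ (Fm k) (phi R n k.+1 l 0) _ h1) (mdsZ _ _ (Fm k) (be k.+1) _ h2)) => om.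
by rewrite [RHS]mxE; ring.
Qed.

Hypothesis Ha_nneg : forall i j, 0 <= a i j.
Variables (Hbar Ca : R).
Hypothesis Hbar0 : 0 <= Hbar.
Hypothesis H_bnd : forall i k, (1 <= k)%N -> frob (H i k) <= Hbar.
Hypothesis Ca1 : 1 <= Ca.
Hypothesis HCa : forall i j, 0 < a i j -> [/\ a i j <= Ca, (b i j)^-1 <= Ca & b i j / a i j <= Ca].
Hypothesis be_ge0 : forall k, 0 <= be k.
Variable nub : R.
Hypothesis nub0 : 0 <= nub.
Hypothesis nu_nub : forall i j, 0 < a i j -> nu i j <= nub.
Hypothesis be_sum : exists C : R, forall K, \sum_(0 <= k < K) (be k.+1 * k.+1%:R `^ nub) ^+ 2 <= C.
Variables (rho : R) (g : 'I_N -> nat -> T -> \bar R).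
Hypothesis rho2 : 2 <= rho.
Hypothesis g_cond : forall i k, (1 <= k)%N ->
           [/\ (forall om, (0 <= g i k om)%E),
               (forall c : R, filtFw w k.-1 [set om | (g i k om <= c%:E)%E]) &
               (forall A, filtFw w k.-1 A ->
                  (\int[P]_(om in A) (powR (vnorm (w i k om)) rho)%:E
                   = \int[P]_(om in A) g i k om)%E)].

Definition moment_ok (M : R) k : set T := [set om | forall i, (g i k.+1 om <= M%:E)%E].

Definition wmoment om k : R := \sum_i vnorm (w i k.+1 om) `^ rho.

Lemma moment_okF M k : <<s F k >> (moment_ok M k).
Proof.
apply: gen_forall => i; apply: (genFw_genF w dd k).
by have [_ h _] := g_cond i k.+1 isT; exact: h.
Qed.

Lemma wmoment_ge0 om k : 0 <= wmoment om k.
Proof. by apply: sumr_ge0 => i _; exact: powR_ge0. Qed.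

Lemma measurable_vnorm_powR i k : measurable_fun setT (fun om => vnorm (w i k.+1 om) `^ rho).
Proof.
have h : gfun (genW w) (fun om => vnorm (w i k.+1 om) `^ rho).
  apply: (gfun_comp _ (@powR R ^~ rho) (fun om => vnorm (w i k.+1 om))) => //.
  by apply: gfun_vnorm => j; exact: gfunW_w.
exact: gfun_measurable (genW_measurable w w_meas) h.
Qed.

Lemma measurable_wmoment k : measurable_fun setT (fun om => wmoment om k).
Proof. by apply: measurable_sum => i; exact: measurable_vnorm_powR. Qed.

Lemma wmoment_bound M k B : 0 <= M -> <<s F k >> B -> B `<=` moment_ok M k ->
  (\int[P]_(om in B) (wmoment om k)%:E <= (N%:R * M)%:E * P B)%E.
Proof.
move=> M0 GB BM; have mB : measurable B by exact: gen_measurable (Fm k) _ GB.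
have h i : (\int[P]_(om in B) (vnorm (w i k.+1 om) `^ rho)%:E <= M%:E * P B)%E.
  have [g0 gm gi] := g_cond i k.+1 isT.
  apply: (moment_bound P N m w dd w_meas dd_meas dd_indep k i rho M (g i k.+1)) => //.
  by move=> om /BM; exact.
under eq_integral do rewrite -sumEFin.
rewrite ge0_integral_sum//; last 2 first.
- by move=> i; apply/measurable_EFinP; apply: measurable_funTS; exact: measurable_vnorm_powR.
- by move=> i om _; rewrite lee_fin powR_ge0.
apply: (@le_trans _ _ (\sum_(i < N) M%:E * P B)%E); first by apply: lee_sum => i _; exact: h.
have PBfin : P B \is a fin_num by exact: fin_num_measure.
rewrite -(fineK PBfin) -EFinM sumEFin lee_fin sumr_const card_ord -mulr_natl; lra.
Qed.

Lemma sqr_le_1powR (x : R) : 0 <= x -> x ^+ 2 <= 1 + x `^ rho.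
Proof.
move=> x0; have [x1|x1] := leP x 1.
  by apply: (@le_trans _ _ 1); [rewrite exprn_ile1|rewrite lerDl powR_ge0].
apply: (@le_trans _ _ (x `^ rho)); last by rewrite lerDr.
by rewrite -powR_mulrn//; apply: ler_powR => //; exact: ltW.
Qed.

Lemma sum_vnorm_sqr_le om k : \sum_i vnorm (w i k.+1 om) ^+ 2 <= N%:R + wmoment om k.
Proof.
apply: (@le_trans _ _ (\sum_i (1 + vnorm (w i k.+1 om) `^ rho))).
  by apply: ler_sum => i _; apply: sqr_le_1powR; exact: sqrtr_ge0.
by rewrite big_split /= sumr_const card_ord.
Qed.

Definition energy om k : R := ip (err om k) (err om k).

Lemma energy_ge0 om k : 0 <= energy om k.
Proof. exact: (form_ge0 _ _ _ (psdform_ip R N n)). Qed.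

Lemma gfun_energy k : gfun (F k) (fun om => energy om k).
Proof.
by apply: gfun_sum => i; apply: gfun_sum => l; apply: gfunM; exact: gfun_err.
Qed.

Let bk k := be k.+1 * k.+1%:R `^ nub.

Let bk_ge0 k : 0 <= bk k. Proof. by rewrite mulr_ge0 ?powR_ge0. Qed.

Lemma alp_le_bk i j k : 0 < a i j -> alp nu be i j k.+1 <= bk k.
Proof.
by move=> aij; rewrite ler_wpM2l//; apply: ler_powR; [rewrite ler1n|exact: nu_nub].
Qed.

Lemma sum_alp_sqr_le k : \sum_i \sum_(j < N | 0 < a i j) alp nu be i j k.+1 ^+ 2 <= N%:R ^+ 2 * bk k ^+ 2.
Proof.
apply: (@le_trans _ _ (\sum_(i < N) \sum_(j < N) bk k ^+ 2)).
  apply: ler_sum => i _; rewrite big_mkcond; apply: ler_sum => j _.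
  case: ifPn => [aij|_]; last exact: sqr_ge0.
  by rewrite ler_sqr ?nnegrE// ?alp_le_bk// mulr_ge0// powR_ge0.
by rewrite !sumr_const !card_ord -mulrnA -(mulr_natl (bk k ^+ 2)) natrM expr2.
Qed.

Lemma be_le_bk k : be k.+1 <= bk k.
Proof.
have k1 : 1 <= k.+1%:R :> R by rewrite ler1n.
by rewrite /bk ler_peMr//; have := @ler_powR R k.+1%:R k1 0 nub nub0; rewrite powRr0.
Qed.

Lemma energy_step om k : energy om k.+1 = energy om k + 2 * ip (err om k) (err_drift om k)
  + 2 * ip (err om k) (err_noise om k) + ip (err_drift om k + err_noise om k) (err_drift om k + err_noise om k).
Proof.
rewrite /energy err_step -addrA (form_sqrD _ _ _ (psdform_ip R N n) (err om k)).
by rewrite (formDr _ _ _ (psdform_ip R N n)); ring.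
Qed.

(** No bound on the errors is available yet, so only the sign of the drift is used, and all
    second-order terms are dominated by bk^2 (1 + V); bk^2 is summable because nubar < 1/2. *)
Lemma energy_drift : exists2 C : R, 0 <= C & forall om k,
  energy om k.+1 <= energy om k + 2 * ip (err om k) (err_noise om k)
    + C * bk k ^+ 2 * (1 + wmoment om k) * (1 + energy om k).
Proof.
pose Cd := 8 * N%:R * Ca ^+ 2 + 2 * Hbar ^+ 4.
pose Cn := 4 * N%:R * Ca ^+ 2 + 2 * Hbar ^+ 2.
have Ca20 : 0 <= Ca ^+ 2 by exact: sqr_ge0.
have Cd0 : 0 <= Cd by apply: addr_ge0; apply: mulr_ge0 => //; rewrite ?exprn_ge0// mulr_ge0.
have Cn0 : 0 <= Cn by apply: addr_ge0; apply: mulr_ge0; rewrite ?sqr_ge0// mulr_ge0.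
pose N2 : R := N%:R ^+ 2.
have N20 : 0 <= N2 by exact: sqr_ge0.
exists (2 * Cd * (N2 + 1) + 2 * Cn * (4 * N2 + N%:R + 1)).
  have c1 : 0 <= N2 + 1 by exact: addr_ge0.
  have c2 : 0 <= 4 * N2 + N%:R + 1 by rewrite !addr_ge0// mulr_ge0.
  by apply: addr_ge0; apply: mulr_ge0 => //; apply: mulr_ge0.
move=> om k; rewrite energy_step; set V := energy om k; set Z := wmoment om k.
have V0 : 0 <= V := energy_ge0 om k; have Z0 : 0 <= Z := wmoment_ge0 om k.
have h1 : ip (err om k) (err_drift om k) <= 0.
  exact: (drift_ip_le0 R N n m a nu b H theta be Ha_sym Ha_nneg Hnu_sym Hb_sym Hb be_ge0 k.+1 _ isT).
have h2 := form_sqrD_le R _ _ (psdform_ip R N n) (err_drift om k) (err_noise om k).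
have h3 := drift_norm_global R N n m a nu b H theta be Ha_nneg Hbar Hbar0 H_bnd be_ge0 Ca Ca1 HCa k.+1 (err om k) isT.
have h4 := noise_ip R N n m a nu b H theta be Ha_nneg Hbar Hbar0 H_bnd Ca Ca1 HCa k.+1
  (fun i => w i k.+1 om) (fun i => dd i k.+1 om) (err om k) isT.
rewrite -/(err_drift om k) -/Cd in h3; rewrite -/(err_noise om k) -/Cn in h4.
have A2 := sum_alp_sqr_le k; set B2 := bk k ^+ 2 in A2 *.
have B20 : 0 <= B2 by exact: sqr_ge0.
have beB : be k.+1 ^+ 2 <= B2 by rewrite ler_sqr ?nnegrE// be_le_bk.
set A := \sum_i \sum_(j < N | _) alp nu be i j k.+1 ^+ 2 in A2 h3.
have h5 : \sum_i \sum_(j < N | 0 < a i j) alp nu be i j k.+1 ^+ 2 *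
   (bit_up nu b theta k.+1 (fun i => dd i k.+1 om) j i (err om k) +
    bit_down nu b theta k.+1 (fun i => dd i k.+1 om) j i (err om k) +
    psend nu b k.+1 i j (usig theta k.+1 j (err om k))) <= 4 * A.
  rewrite /A mulr_sumr; apply: ler_sum => i _; rewrite mulr_sumr; apply: ler_sum => j _.
  rewrite mulrC ler_wpM2r ?sqr_ge0//.
  have := sendp_le2 R (nu i j * ln k.+1%:R) (usig theta k.+1 j (err om k) / b i j).
  rewrite -/(psend nu b k.+1 i j (usig theta k.+1 j (err om k))) /bit_up /bit_down.
  by move: (_ < _) (_ < _) => [] [] /=; lra.
have W2 := sum_vnorm_sqr_le om k; rewrite -/Z in W2; set W := \sum_i vnorm _ ^+ 2 in W2 h4.
have W0 : 0 <= W by apply: sumr_ge0 => i _; exact: sqr_ge0.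
rewrite -/N2 in A2.
have h3' : ip (err_drift om k) (err_drift om k) <= Cd * ((N2 + 1) * B2 * (1 + V)).
  apply: (le_trans h3); rewrite -/(energy om k) -/V ler_wpM2l//.
  have := ler_wpM2r V0 beB; have := mulr_ge0 N20 B20; have := mulr_ge0 (mulr_ge0 N20 B20) V0.
  lra.
have h4' : ip (err_noise om k) (err_noise om k) <= Cn * ((4 * N2 + N%:R + 1) * B2 * (1 + Z)).
  apply: (le_trans h4); rewrite ler_wpM2l//.
  have k1 := ler_wpM2r W0 beB; have k2 := ler_wpM2l B20 W2.
  have k3 := mulr_ge0 (mulr_ge0 N20 B20) Z0; have k4 := mulr_ge0 (mulr_ge0 (ler0n R N) B20) Z0.
  apply: (@le_trans _ _ (4 * A + B2 * (N%:R + Z))).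
    apply: lerD => //; exact: le_trans k1 k2.
  lra.
have t1 : 0 <= B2 * Z by rewrite mulr_ge0.
have t2 : 0 <= B2 * V by rewrite mulr_ge0.
have t3 : 0 <= B2 * Z * V by rewrite mulr_ge0.
have e1 : Cd * ((N2 + 1) * B2 * (1 + V)) <= Cd * ((N2 + 1) * (B2 * (1 + Z) * (1 + V))).
  rewrite ler_wpM2l// -mulrA ler_wpM2l ?addr_ge0//; lra.
have e2 : Cn * ((4 * N2 + N%:R + 1) * B2 * (1 + Z)) <= Cn * ((4 * N2 + N%:R + 1) * (B2 * (1 + Z) * (1 + V))).
  by rewrite ler_wpM2l// -mulrA ler_wpM2l ?addr_ge0 ?mulr_ge0//; lra.
have -> : (2 * Cd * (N2 + 1) + 2 * Cn * (4 * N2 + N%:R + 1)) * B2 * (1 + Z) * (1 + V) =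
  2 * (Cd * ((N2 + 1) * (B2 * (1 + Z) * (1 + V)))) + 2 * (Cn * ((4 * N2 + N%:R + 1) * (B2 * (1 + Z) * (1 + V)))) by ring.
lra.
Qed.

Fixpoint stay (B : nat -> set T) k : set T :=
  if k is k'.+1 then stay B k' `&` B k else B 0%N.

Lemma stayF B k : (forall k, <<s F k >> (B k)) -> <<s F k >> (stay B k).
Proof.
move=> GB; elim: k => [|k IH]; first exact: (GB 0%N).
by apply: genI; [exact: (genF_incr w dd k _ IH)|exact: GB].
Qed.

Lemma stay_sub B k : stay B k `<=` B k.
Proof. by case: k => [|k] om //= []. Qed.

Lemma stay_all B om : (forall k, B k om) -> forall k, stay B k om.
Proof. by move=> h; elim=> [|k IH] /=. Qed.

(* The logarithm makes the multiplicative noise term additive and bounds the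
   martingale coefficients without any localisation. *)
Lemma energy_bounded (M : R) : 0 <= M ->
  {ae P, forall om, (forall k, moment_ok M k om) -> exists K : R, forall k, energy om k <= K}.
Proof.
move=> M0; have [C C0 hC] := energy_drift; have [Cs hCs] := be_sum.
pose S k om : R := ln (1 + energy om k).
pose X k (p : 'I_N * 'I_n) om : R := 2 * err om k p.1 p.2 / (1 + energy om k).
pose Y k (p : 'I_N * 'I_n) om : R := err_noise om k p.1 p.2.
have E1 om k : 1 <= 1 + energy om k by rewrite lerDl energy_ge0.
have E0 om k : 0 < 1 + energy om k by exact: lt_le_trans (E1 om k).
have GE k : gfun (F k) (fun om => 1 + energy om k) by apply: gfunD; [exact: gfun_cst|exact: gfun_energy].
have main : {ae P, forall om, (forall k, stay (moment_ok M) k om) -> exists K, forall k, S k om <= K}.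
  apply: (@ae_bounded _ _ _ P F (stay (moment_ok M)) S (fun k om => wmoment om k) _ X Y
     (fun k => C * bk k ^+ 2) (N%:R * M) (C * Cs) `|ln (1 + ip (\matrix_(i, l) (th0 i l 0 - theta l 0)) (\matrix_(i, l) (th0 i l 0 - theta l 0)))|).
  - exact: Fm.
  - exact: genF_incr.
  - by move=> k; apply: stayF => k'; exact: moment_okF.
  - by move=> k om; exact: ln_ge0 (E1 om k).
  - by move=> k; apply: (gfun_comp _ (@ln R)) => //; exact: measurable_ln.
  - by move=> k p; have [] := mds_noise k p.1 p.2.
  - by move=> k p B GB; have [_] := mds_noise k p.1 p.2; exact.
  - move=> k p; apply: gfunM; first by apply: gfunM; [exact: gfun_cst|exact: gfun_err].
    rewrite (_ : (fun om => _) = fun om => (1 + energy om k) `^ (-1)).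
      by apply: (gfun_comp _ (@powR R ^~ (-1))).
    by apply/funext => om; rewrite powR_inv1// ltW.
  - move=> k p; exists 2 => om _; rewrite /X normrM normfV (gtr0_norm (E0 om k)) normrM.
    rewrite ler_pdivrMr// normr_nat ler_wpM2l//.
    have : err om k p.1 p.2 ^+ 2 <= energy om k.
      rewrite /energy ip_sqrE (bigD1 p.1)//= (bigD1 p.2)//= -addrA lerDl addr_ge0//.
        by apply: sumr_ge0 => l _; exact: sqr_ge0.
      by apply: sumr_ge0 => i _; apply: sumr_ge0 => l _; exact: sqr_ge0.
    have := sqr_ge0 (`|err om k p.1 p.2| - 1); rewrite -(real_normK (num_real (err om k p.1 p.2))); nra.
  - by move=> k om; exact: wmoment_ge0.
  - exact: measurable_wmoment.
  - by rewrite mulr_ge0.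
  - move=> k B GB Bs; apply: wmoment_bound => // om /Bs; exact: stay_sub.
  - by move=> k; rewrite mulr_ge0 ?sqr_ge0.
  - by move=> K; rewrite -mulr_sumr ler_wpM2l.
  - move=> k om _; have := hC om k; set V := energy om k; set V' := energy om k.+1 => h.
    have Vp : 0 < 1 + V := E0 om k; have V'p : 0 < 1 + V' := E0 om k.+1.
    have h1 : S k.+1 om <= S k om + ((1 + V') / (1 + V) - 1).
      have := ln_le_subr1 R ((1 + V') / (1 + V)) (divr_gt0 V'p Vp).
      rewrite ln_div ?posrE// /S -/V -/V'; lra.
    apply: (le_trans h1); rewrite -addrA lerD2l.
    have -> : \sum_p X k p om * Y k p om = 2 * ip (err om k) (err_noise om k) / (1 + V).
      transitivity (\sum_i \sum_l 2 * err om k i l / (1 + V) * err_noise om k i l).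
        by rewrite pair_bigA.
      rewrite /ip mulr_sumr mulr_suml; apply: eq_bigr => i _.
      by rewrite mulr_sumr mulr_suml; apply: eq_bigr => l _; ring.
    rewrite lerBlDr ler_pdivrMr// mulrDl mul1r.
    have -> : (2 * ip (err om k) (err_noise om k) / (1 + V) + C * bk k ^+ 2 * (1 + wmoment om k)) * (1 + V) =
       2 * ip (err om k) (err_noise om k) + C * bk k ^+ 2 * (1 + wmoment om k) * (1 + V).
      by field; rewrite gt_eqF.
    lra.
  - move=> om _; rewrite /S /energy; apply: (le_trans (ler_norm _)).
    by rewrite (_ : err om 0 = \matrix_(i, l) (th0 i l 0 - theta l 0)).
  - by [].
apply: filterS main => om h ok; have [K hK] := h (stay_all _ om ok).
exists (expR K) => k; have := hK k; rewrite /S -ler_expR lnK ?posrE//; lra.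
Qed.

(** * Contraction on bounded energy and the almost sure rate *)

Variables (L : nat) (kap q : R).
Hypothesis kap0 : 0 < kap.
Hypothesis excited : forall t (X : 'M[R]_(N, n)),
  kap * ip X X <= \sum_(0 <= s < L) Qf a H (t.+1 + s) X X.
Hypothesis q12 : 1 < q <= 3 / 2.
Hypothesis q_rho : 2 * q <= rho.
Hypothesis be_gt0 : forall k, (0 < k)%N -> 0 < be k.
Hypothesis be_noninc : forall k, (0 < k)%N -> be k.+1 <= be k.
Hypothesis be_sub : forall k, (0 < k)%N -> be k - be k.+1 <= 1 * be k ^+ 2.
Hypothesis be_small : forall c : R, 0 < c -> exists k0, forall k, (k0 <= k)%N -> be k * k%:R `^ nub <= c.
Hypothesis be_weight : forall c : R, 0 < c -> exists k0, forall k, (k0 <= k)%N ->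
  (1 - c * be k.+1) * weight R nub k.+1 `^ q <= weight R nub k `^ q.
Hypothesis be_err : exists C : R, forall k0 K,
  \sum_(0 <= k < K) be (k + k0).+1 `^ (1 + q) * ((k + k0).+1%:R `^ nub) `^ q * weight R nub (k + k0).+1 `^ q <= C.

Local Notation E := 'M[R]_(N, n).
Local Notation wt := (weight R nub).

Definition Rf (t : nat) (X Y : E) : R := \sum_(0 <= s < L) (L - s)%:R * Qf a H (t + s) X Y.

(** The index is shifted by one: the state [err om k] is about to undergo step k + 1, so the window
    starts there. *)
Definition lyap (c1 : R) (k : nat) (X Y : E) : R := ip X Y - c1 * be k.+1 * Rf k.+1 X Y.

Lemma psdform_Rf t : psdform (Rf t).
Proof. by apply: psdform_sum => s; apply: psdformZ => //; exact: psdform_Qf. Qed.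

Lemma Rf_le t X : (0 < t)%N -> Rf t X X <= L%:R * (L%:R * (4 * N%:R + Hbar ^+ 2)) * ip X X.
Proof.
move=> t0; have V0 := form_ge0 _ _ _ (psdform_ip R N n) X.
apply: (@le_trans _ _ (\sum_(0 <= s < L) L%:R * ((4 * N%:R + Hbar ^+ 2) * ip X X))).
  apply: ler_sum => s _; apply: ler_pM => //.
  - exact: (form_ge0 _ _ _ (psdform_Qf R N n m a H _)).
  - by rewrite ler_nat leq_subr.
  - by apply: (Qf_le R N n m a H Hbar Hbar0 H_bnd); rewrite ltn_addr.
by rewrite sumr_const_nat subn0 -[leLHS]mulr_natl !mulrA.
Qed.

Lemma usig_bound k (i : 'I_N) (X : E) (Kv : R) : ip X X <= Kv ->
  `|usig theta k i X| <= 2 + Kv + ip (\matrix_(i < N, l < n) theta l 0) (\matrix_(i < N, l < n) theta l 0).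
Proof.
move=> XK.
have h (Y : E) : `|prj k i Y| <= 1 + ip Y Y.
  have : prj k i Y ^+ 2 <= ip Y Y.
    apply: (le_trans (prj_sqr_le R N n k i Y)); rewrite ip_sqrE (bigD1 i)//= lerDl.
    by apply: sumr_ge0 => i' _; apply: sumr_ge0 => l _; exact: sqr_ge0.
  rewrite -(real_normK (num_real (prj k i Y))); have := sqr_ge0 (`|prj k i Y| - 1); nra.
apply: (le_trans (ler_normD _ _)).
have := h X; have := h (\matrix_(i < N, l < n) theta l 0); lra.
Qed.

(** A bound on the energy bounds every signal by U, which puts the local drift estimates at the
    disposal of [lyapunov_step]; [c1] and [cc] thereby depend on Kv, and [k0] is the time from which
    the steps are small relative to them. *)
Lemma lyap_local (Kv : R) : 0 <= Kv -> exists c1 cc : R, exists k0, [/\ 0 < c1, 0 < cc &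
  forall om k, (k0 <= k)%N -> energy om k <= Kv ->
  let X := err om k in let eta := err_noise om k in
  let v := lyap c1 k X X in let v' := lyap c1 k.+1 (err om k.+1) (err om k.+1) in
  [/\ energy om k <= 2 * v, v <= energy om k,
      v' <= v - cc * be k.+1 * v + 2 * lyap c1 k.+1 X eta + 2 * ip eta eta,
      0 <= v' & forall Y, lyap c1 k.+1 X Y ^+ 2 <= energy om k * ip Y Y] /\
  [/\ cc * be k.+1 <= 2^-1, be k.+1 <= 1 & be k.+1 * k.+1%:R `^ nub <= 1]].
Proof.
move=> Kv0.
pose U := 2 + Kv + ip (\matrix_(i < N, l < n) theta l 0) (\matrix_(i < N, l < n) theta l 0 : E).
have U0 : 0 <= U by rewrite addr_ge0 ?addr_ge0// (form_ge0 _ _ _ (psdform_ip R N n)).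
have Cap : 0 < Ca by exact: lt_le_trans ltr01 Ca1.
pose c0 := 2^-1 * Ca^-1 * expR (- (3 * (U * Ca))).
have c00 : 0 < c0 by rewrite !mulr_gt0 ?invr_gt0 ?expR_gt0.
pose Cf := 8 * N%:R ^+ 2 * (Ca ^+ 2 * expR (U * Ca)) ^+ 2 + 2 * Hbar ^+ 4.
have Cf0 : 0 <= Cf by apply: addr_ge0; apply: mulr_ge0; rewrite ?exprn_ge0 ?sqr_ge0// mulr_ge0// sqr_ge0.
pose c1 := c0 / (L%:R + 1).
have L1 : 0 < L%:R + 1 :> R by rewrite ltr_wpDl.
have c10 : 0 < c1 by rewrite divr_gt0.
have c1L : c1 * L%:R <= c0 by rewrite /c1 mulrAC ler_pdivrMr// ler_wpM2l ?(ltW c00)// lerDl.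
pose Cr := L%:R * (L%:R * (4 * N%:R + Hbar ^+ 2)).
have Cr0 : 0 <= Cr by rewrite !mulr_ge0// addr_ge0 ?mulr_ge0// sqr_ge0.
pose Ce := c1 * 1 * Cr + c1 * Cr * (1 + Cf) + 2 * Cf.
have Ce0 : 0 <= Ce.
  have c1r : 0 <= c1 * Cr by rewrite mulr_ge0// ltW.
  by rewrite /Ce mulr1 addr_ge0 ?addr_ge0// mulr_ge0// addr_ge0.
pose cc := c1 * kap / 2.
have cc0 : 0 < cc by rewrite divr_gt0// mulr_gt0.
(* In order: steps and gains at most 1; the correction at most half of ip; the second-order loss at
   most half of the contraction, which leaves [cc]; and cc be <= 1/2 for [power_step]. *)
pose lim := Num.min 1 (Num.min (2^-1 / (c1 * Cr + 1)) (Num.min (cc / (Ce + 1)) (2^-1 / cc))).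
have p1 : 0 < c1 * Cr + 1 by apply: ltr_wpDl => //; apply: mulr_ge0 => //; exact: ltW.
have p2 : 0 < Ce + 1 by exact: ltr_wpDl.
have half0 : 0 < 2^-1 :> R by rewrite invr_gt0.
have lim0 : 0 < lim by rewrite /lim !lt_min ltr01 (divr_gt0 half0 p1) (divr_gt0 cc0 p2) (divr_gt0 half0 cc0).
have [k0 hk0] := be_small lim lim0.
exists c1, cc, k0; split => // om k k0k Ek X eta v v'.
have bp : 0 < be k.+1 by exact: be_gt0.
have blim : be k.+1 * k.+1%:R `^ nub <= lim by apply: hk0; exact: leqW.
have bl : be k.+1 <= lim by apply: le_trans blim; exact: be_le_bk.
have [l1 l2 l3 l4] : [/\ lim <= 1, lim <= 2^-1 / (c1 * Cr + 1), lim <= cc / (Ce + 1) & lim <= 2^-1 / cc].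
  by split; rewrite /lim !ge_min lexx ?orbT.
have b2 : be k.+1 * (c1 * Cr + 1) <= 2^-1.
  by rewrite -ler_pdivlMr//; exact: le_trans bl l2.
have b3 : be k.+1 * (Ce + 1) <= cc by rewrite -ler_pdivlMr//; exact: le_trans bl l3.
have b4 : be k.+1 * cc <= 2^-1 by rewrite -ler_pdivlMr//; exact: le_trans bl l4.
split; last first.
  by rewrite mulrC b4 (le_trans bl l1) (le_trans blim l1).
have loc i : `|usig theta k.+1 i X| <= U by exact: usig_bound.
have d1 := drift_ip_loc R N n m a nu b H theta be Ha_sym Ha_nneg Hnu_sym Hnu Hb_sym Hb be_ge0 Ca Ca1 HCa k.+1 X U isT U0 loc.
have d2 := drift_norm_loc R N n m a nu b H theta be Ha_nneg Hb Hbar Hbar0 H_bnd be_ge0 Ca Ca1 HCa k.+1 X U isT loc.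
have ly Y := lyapunov_step R E ip (Qf a H k.+1) (fun Y Z => \sum_(0 <= s < L) Qf a H (k.+2 + s) Y Z)
  (Rf k.+1) (Rf k.+2) c0 c1 kap L%:R Cr Cf 1 (be k.+1) (be k.+2) X (err_drift om k) Y
  (psdform_ip R N n) (psdform_Rf k.+2).
have {}ly Y : [/\ ip X X <= 2 * lyap c1 k X X, lyap c1 k X X <= ip X X,
    lyap c1 k.+1 (X + err_drift om k + Y) (X + err_drift om k + Y) <= lyap c1 k X X
        - (c1 * kap * be k.+1 - Ce * be k.+1 ^+ 2) * ip X X + 2 * lyap c1 k.+1 X Y + 2 * ip Y Y,
    0 <= lyap c1 k.+1 (X + err_drift om k + Y) (X + err_drift om k + Y) &
    lyap c1 k.+1 X Y ^+ 2 <= ip X X * ip Y Y].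
  apply: (ly Y) => //.
  - by move=> y z; exact: (window_shift (fun t => Qf a H t y z)).
  - by move=> y; exact: Rf_le.
  - by move=> y; exact: Rf_le.
  - exact: (form_ge0 _ _ _ (psdform_Qf R N n m a H _)).
  - exact: (form_ge0 _ _ _ (psdform_Rf _)).
  - by rewrite be_ge0 be_noninc.
  - exact: be_sub.
  - have : 0 <= be k.+1 by exact: ltW.
    by move: b2; rewrite mulrDr mulr1; lra.
have [q1 q2 q3 q4 _] := ly eta.
have Xst : err om k.+1 = X + err_drift om k + eta by exact: err_step.
split.
- exact: q1.
- exact: q2.
- rewrite /v' Xst; apply: (le_trans q3); rewrite lerD2r lerD2r -/v lerD2l lerN2.
  have V0 : 0 <= ip X X by exact: (form_ge0 _ _ _ (psdform_ip R N n)).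
  apply: (@le_trans _ _ (cc * be k.+1 * ip X X)).
    by rewrite ler_wpM2l// mulr_ge0// ltW.
  rewrite ler_wpM2r//.
  have : be k.+1 * (Ce * be k.+1) <= be k.+1 * cc.
    by rewrite ler_wpM2l ?(ltW bp)//; move: b3; rewrite mulrDr mulr1; have := ltW bp; lra.
  rewrite /cc; lra.
- by rewrite /v' Xst.
- by move=> Y; have [] := ly Y.
Qed.

(** This is where 2 q <= rho is used, through |w|^(2q) <= 1 + |w|^rho. *)
Lemma sum_vnorm_powR_le om k :
  (1 + \sum_i vnorm (w i k.+1 om) ^+ 2) `^ q <= 4 * (1 + N%:R ^+ 2 * (N%:R + 1)) * (1 + wmoment om k).
Proof.
have /andP[q1 q2] := q12; have q0 : 0 <= q by lra.
have q12' : 1 <= q <= 2 by apply/andP; split; lra.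
have W0 : 0 <= \sum_i vnorm (w i k.+1 om) ^+ 2 by apply: sumr_ge0 => i _; exact: sqr_ge0.
apply: (le_trans (powR_add_le R q 1 _ q12' ler01 W0)); rewrite powR1 -mulrA ler_wpM2l//.
have h1 : (\sum_i vnorm (w i k.+1 om) ^+ 2) `^ q <= N%:R ^+ 2 * (N%:R + wmoment om k).
  have := powR_sum_le R 'I_N q (fun i => vnorm (w i k.+1 om) ^+ 2) q12' (fun i => sqr_ge0 _).
  rewrite card_ord => /le_trans; apply; rewrite ler_wpM2l ?sqr_ge0//.
  apply: (@le_trans _ _ (\sum_i (1 + vnorm (w i k.+1 om) `^ rho))); last by rewrite big_split /= sumr_const card_ord.
  apply: ler_sum => i _; have x0 : 0 <= vnorm (w i k.+1 om) by exact: sqrtr_ge0.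
  move: (vnorm _) x0 => x x0.
  rewrite -powR_mulrn// -powRrM; have [x1|x1] := leP x 1.
    apply: (@le_trans _ _ 1); last by rewrite lerDl powR_ge0.
    by apply: powR_le1; [rewrite x0|rewrite mulr_ge0].
  apply: (@le_trans _ _ (x `^ rho)); last by rewrite lerDr.
  by apply: ler_powR => //; exact: ltW.
have Z0 := wmoment_ge0 om k; move: (wmoment om k) Z0 h1 => Z Z0 h1.
have N20 : 0 <= N%:R ^+ 2 :> R by exact: sqr_ge0.
have N0' : 0 <= N%:R :> R by [].
have := mulr_ge0 (mulr_ge0 N20 N0') Z0; lra.
Qed.

Lemma gfun_Qf k t (X Y : T -> E) : (forall i l, gfun (F k) (fun om => X om i l)) ->
  (forall i l, gfun (F k) (fun om => Y om i l)) -> gfun (F k) (fun om => Qf a H t (X om) (Y om)).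
Proof.
move=> GX GY; apply: gfunD; apply: gfun_sum => i; apply: gfun_sum => j; apply: gfunM.
- by apply: gfunB; exact: gfun_prj.
- by apply: gfunB; exact: gfun_prj.
- exact: gfun_hx.
- exact: gfun_hx.
Qed.

Lemma gfun_lyap c1 k t (X Y : T -> E) : (forall i l, gfun (F k) (fun om => X om i l)) ->
  (forall i l, gfun (F k) (fun om => Y om i l)) -> gfun (F k) (fun om => lyap c1 t (X om) (Y om)).
Proof.
move=> GX GY; apply: gfunB.
  by apply: gfun_sum => i; apply: gfun_sum => l; exact: gfunM.
apply: gfunM; first exact: gfun_cst.
by apply: gfun_sum => s; apply: gfunM; [exact: gfun_cst|exact: gfun_Qf].
Qed.

(** Expands the martingale term over matrix entries, giving the products of a past-measurable factor
    and a scalar martingale difference that [ae_bounded] expects. *)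
Lemma psdform_lyap_sum c1 t X (Y : E) :
  lyap c1 t X Y = \sum_i \sum_l lyap c1 t X (delta_mx i l) * Y i l.
Proof.
have e (Q : E -> E -> R) : psdform Q -> Q X Y = \sum_i \sum_l Q X (delta_mx i l) * Y i l.
  move=> pQ; rewrite {1}[Y]matrix_sum_delta (form_sumr _ _ _ pQ); apply: eq_bigr => i _.
  rewrite (form_sumr _ _ _ pQ); apply: eq_bigr => l _; by rewrite (formZr _ _ _ pQ) mulrC.
rewrite /lyap (e _ (psdform_ip R N n)) (e _ (psdform_Rf t.+1)) mulr_sumr -sumrB.
apply: eq_bigr => i _; rewrite mulr_sumr -sumrB; apply: eq_bigr => l _; ring.
Qed.

Lemma ip_delta i l : ip (delta_mx i l : E) (delta_mx i l) = 1.
Proof.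
rewrite ip_sqrE (bigD1 i)//= (bigD1 l)//= !mxE !eqxx expr1n !big1 ?addr0//.
- move=> i' /negPf ii'; apply: big1 => l' _; by rewrite mxE ii' expr0n.
- by move=> l' /negPf ll'; rewrite mxE ll' andbF expr0n.
Qed.

(** Zero off the edges, so that sums run over all pairs, a finite type as in [power_step]. *)
Definition edge_gain k (p : 'I_N * 'I_N) : R :=
  if 0 < a p.1 p.2 then alp nu be p.1 p.2 k.+1 else 0.

Definition edge_sent om k (p : 'I_N * 'I_N) : R :=
  bit_up nu b theta k.+1 (fun i => dd i k.+1 om) p.2 p.1 (err om k)
  + bit_down nu b theta k.+1 (fun i => dd i k.+1 om) p.2 p.1 (err om k).

Definition edge_prob om k (p : 'I_N * 'I_N) : R :=
  psend nu b k.+1 p.1 p.2 (usig theta k.+1 p.2 (err om k)).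

Lemma power_lyap_step (Kv : R) : 0 <= Kv -> exists c1 cc C1 C2 C3 : R, exists k0,
  [/\ 0 < c1, 0 < cc, 0 <= C3 & forall om k, (k0 <= k)%N -> energy om k <= Kv ->
  let X := err om k in let eta := err_noise om k in
  let v := lyap c1 k X X in let v' := lyap c1 k.+1 (err om k.+1) (err om k.+1) in
  let u := v - cc * be k.+1 * v in
  [/\ 0 <= v <= energy om k, energy om k <= 2 * v, 0 <= u <= v, 0 <= v' &
      forall Y, lyap c1 k.+1 X Y ^+ 2 <= energy om k * ip Y Y] /\
   v' `^ q <= (1 - cc / 2 * be k.+1) * v `^ q + q * u `^ (q - 1) * (2 * lyap c1 k.+1 X eta)
    + \sum_p (C1 * u `^ (q - 1) * edge_gain k p ^+ 2 + C2 * edge_gain k p `^ (1 + q))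
        * (edge_sent om k p - edge_prob om k p)
    + C3 * (be k.+1 `^ (1 + q) * (k.+1%:R `^ nub) `^ q) * (1 + wmoment om k)].
Proof.
move=> Kv0; have /andP[q1 q2] := q12.
have [c1 [cc [k0 [c10 cc0 hly]]]] := lyap_local Kv Kv0.
pose U := 2 + Kv + ip (\matrix_(i < N, l < n) theta l 0) (\matrix_(i < N, l < n) theta l 0 : E).
pose Cn := 4 * N%:R * Ca ^+ 2 + 2 * Hbar ^+ 2.
have Cn0 : 0 <= 2 * Cn.
  apply: mulr_ge0 => //; apply: addr_ge0; apply: mulr_ge0; rewrite ?sqr_ge0// mulr_ge0//.
have Cw0 : 0 <= 4 * (1 + N%:R ^+ 2 * (N%:R + 1)) :> R.
  by rewrite mulr_ge0// addr_ge0// mulr_ge0 ?sqr_ge0// addr_ge0.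
have q12' : 1 < q <= 2 by apply/andP; split; lra.
have [[[C1 C2] C3] /= [_ _ C30] hp] := power_step R ('I_N * 'I_N)%type q cc (2 * Cn) (expR (U * Ca)) _ q12' cc0 Cn0 (expR_ge0 _) Cw0.
exists c1, cc, C1, C2, C3, k0; split => // om k k0k Ek; cbv zeta.
set X := err om k; set eta := err_noise om k; set v := lyap c1 k X X.
set v' := lyap c1 k.+1 (err om k.+1) (err om k.+1); set u := v - cc * be k.+1 * v.
have [[y1 y2 y3 y4 y5] [s1 s2 s3]] := hly om k k0k Ek.
have bp : 0 < be k.+1 by exact: be_gt0.
have V0 := energy_ge0 om k.
have v0 : 0 <= v by move: y1; rewrite -/X -/v; lra.
have eta0 : 0 <= ip eta eta by exact: (form_ge0 _ _ _ (psdform_ip R N n)).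
have cbv : cc * be k.+1 * v <= 2^-1 * v by rewrite ler_wpM2r.
have cbv0 : 0 <= cc * be k.+1 * v by rewrite !mulr_ge0// ltW.
split.
  split => //; first by rewrite v0.
  by apply/andP; split; rewrite /u; lra.
have k1 : 1 <= k.+1%:R :> R by rewrite ler1n.
have tau1 : 1 <= k.+1%:R `^ nub :> R by have := @ler_powR R k.+1%:R k1 0 nub nub0; rewrite powRr0.
have loc i : `|usig theta k.+1 i X| <= U by exact: usig_bound.
have ps i j : 0 < a i j -> k.+1%:R `^ nu i j * psend nu b k.+1 i j (usig theta k.+1 j X) <= expR (U * Ca).
  exact: (alp_psend_loc R N n a nu b theta Hb Ca HCa k.+1 X U isT loc).
have pnu i j : 0 < a i j -> k.+1%:R `^ nu i j <= k.+1%:R `^ nub :> R.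
  by move=> aij; apply: ler_powR => //; exact: nu_nub.
have F0 := expR_ge0 (U * Ca).
apply: (hp (be k.+1) (k.+1%:R `^ nub) v v' (2 * lyap c1 k.+1 X eta) (2 * ip eta eta)
  (\sum_i vnorm (w i k.+1 om) ^+ 2) (wmoment om k) (edge_gain k) (edge_sent om k) (edge_prob om k)) => //.
- by rewrite bp s2.
- have := y5 eta; rewrite exprMn; move: y1; rewrite -/X -/v => z1 z2.
  have z3 : energy om k * ip eta eta <= 2 * v * ip eta eta by rewrite ler_wpM2r.
  lra.
- by rewrite mulr_ge0.
- rewrite -mulrA ler_wpM2l//.
  apply: (le_trans (noise_ip R N n m a nu b H theta be Ha_nneg Hbar Hbar0 H_bnd Ca Ca1 HCa k.+1
    (fun i => w i k.+1 om) (fun i => dd i k.+1 om) (err om k) isT)).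
  rewrite -/Cn le_eqVlt; apply/orP; left; apply/eqP; congr (_ * (_ + _)).
  rewrite -(pair_bigA _ (fun i j => edge_gain k (i, j) ^+ 2 * (edge_sent om k (i, j) + edge_prob om k (i, j)))) /=.
  apply: eq_bigr => i _; rewrite big_mkcond; apply: eq_bigr => j _; rewrite /edge_gain /=.
  by case: ifP => _; rewrite ?expr0n ?mul0r.
- move=> [i j]; split.
  + rewrite /edge_gain /=; case: ifPn => [aij|_]; last by rewrite lexx ler01.
    rewrite mulr_ge0 ?powR_ge0 ?(ltW bp)//=; apply: le_trans s3.
    by rewrite ler_wpM2l ?(ltW bp)// pnu.
  + by rewrite /edge_sent /bit_up /bit_down; move: (_ < _) (_ < _) => [] [] /=; apply/andP; split; lra.
  + by rewrite psend_ge0 sendp_le2.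
- move=> [i j]; rewrite /edge_gain /edge_prob /=; case: ifPn => [aij|_]; last first.
    by rewrite expr0n mul0r !mulr_ge0 ?powR_ge0 ?sqr_ge0.
  (* One factor k^nu is spent on [psend], whose product with it is bounded; the other is at most
     k^nubar. The next item does the same with k^(nu (1 + q)), leaving k^(nu q). *)
  have -> : alp nu be i j k.+1 ^+ 2 * psend nu b k.+1 i j (usig theta k.+1 j (err om k)) =
     be k.+1 ^+ 2 * k.+1%:R `^ nu i j * (k.+1%:R `^ nu i j * psend nu b k.+1 i j (usig theta k.+1 j X)).
    by rewrite /alp /X; ring.
  apply: ler_pM; rewrite ?ps//.
  + by rewrite mulr_ge0 ?powR_ge0 ?sqr_ge0.
  + by rewrite mulr_ge0 ?powR_ge0 ?psend_ge0.
  + by rewrite ler_wpM2l ?sqr_ge0// pnu.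
- move=> [i j]; rewrite /edge_gain /edge_prob /=; case: ifPn => [aij|_]; last first.
    rewrite powR0; last by rewrite gt_eqF//; lra.
    by rewrite mul0r !mulr_ge0 ?powR_ge0.
  have -> : alp nu be i j k.+1 `^ (1 + q) = be k.+1 `^ (1 + q) * (k.+1%:R `^ nu i j) `^ q * k.+1%:R `^ nu i j.
    rewrite /alp powRM ?powR_ge0 ?(ltW bp)// -mulrA; congr (_ * _).
    rewrite -[X in _ * X]powRr1 ?powR_ge0// -powRD ?[1 + q]addrC//.
    by apply/implyP => /eqP ?; exfalso; lra.
  rewrite -mulrA; apply: ler_pM; rewrite ?ps//.
  + by rewrite mulr_ge0 ?powR_ge0.
  + by rewrite mulr_ge0 ?powR_ge0 ?psend_ge0.
  + rewrite ler_wpM2l ?powR_ge0//; apply: ler_powRl; [lra|exact: powR_ge0|exact: pnu].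
- by apply: sumr_ge0 => i _; exact: sqr_ge0.
- exact: wmoment_ge0.
- exact: sum_vnorm_powR_le.
Qed.

Lemma powR_le_bound (x K : R) : 0 <= x -> x `^ q <= K -> x <= 1 + K.
Proof.
have /andP[q1 _] := q12; move=> x0 xK; have K0 : 0 <= K by exact: le_trans (powR_ge0 _ _) xK.
have [x1|x1] := leP x 1; first lra.
have : x <= x `^ q by rewrite -{1}[x]powRr1//; apply: ler_powR; exact: ltW.
lra.
Qed.

(** [ae_bounded] for (wt v)^q on the event that moments and energy have respected their bounds so
    far, with two families of martingale differences: the entries of the noise and the centred
    sending events. On that event the multipliers, powers of u and values of the form on basis
    matrices, are bounded. *)
Lemma weighted_energy_bounded (M Kv : R) : 0 <= M -> 0 <= Kv ->
  {ae P, forall om, (forall k, moment_ok M k om) -> (forall k, energy om k <= Kv) ->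
     exists K : R, forall k, wt k * energy om k <= K}.
Proof.
move=> M0 Kv0; have /andP[q1 q2] := q12; have q0 : 0 <= q by lra.
have [c1 [cc [C1 [C2 [C3 [k0 [c10 cc0 C30 hstep]]]]]]] := power_lyap_step Kv Kv0.
have [k1 hk1] := be_weight (cc / 2) (divr_gt0 cc0 (ltr0Sn R 1)).
have [Ce hCe] := be_err.
(* The process starts when both the local step and the decay of the weights are available. *)
pose s := maxn k0 k1.
pose B k := moment_ok M k `&` [set om | energy om k <= Kv].
have GB k : <<s F k >> (B k) by apply: genI; [exact: moment_okF|apply: gfun_setle; exact: gfun_energy].
have k0s k : (k0 <= k + s)%N by rewrite (leq_trans (leq_maxl k0 k1))// leq_addl.
have k1s k : (k1 <= k + s)%N by rewrite (leq_trans (leq_maxr k0 k1))// leq_addl.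
pose v k om := lyap c1 (k + s) (err om (k + s)) (err om (k + s)).
pose u k om := v k om - cc * be (k + s).+1 * v k om.
pose S k om : R := (wt (k + s) * v k om) `^ q.
pose w1 k : R := wt (k + s).+1 `^ q.
pose X k (p : ('I_N * 'I_n) + ('I_N * 'I_N)) om : R := match p with
  | inl p => w1 k * (q * u k om `^ (q - 1) * (2 * lyap c1 (k + s).+1 (err om (k + s)) (delta_mx p.1 p.2)))
  | inr p => w1 k * (C1 * u k om `^ (q - 1) * edge_gain (k + s) p ^+ 2 + C2 * edge_gain (k + s) p `^ (1 + q))
  end.
pose Y k (p : ('I_N * 'I_n) + ('I_N * 'I_N)) om : R := match p with
  | inl p => err_noise om (k + s) p.1 p.2
  | inr p => send_noise om (k + s) p.1 p.2
  end.
have stB k om : stay B (k + s) om -> energy om (k + s) <= Kv by move=> /stay_sub [].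
have Gv k : gfun (F (k + s)) (v k) by apply: gfun_lyap => i l; exact: gfun_err.
have Gu k : gfun (F (k + s)) (u k).
  by apply: gfunB => //; apply: gfunM => //; exact: gfun_cst.
have Gup k : gfun (F (k + s)) (fun om => u k om `^ (q - 1)) by exact: (gfun_comp _ (@powR R ^~ (q - 1))).
have w10 k : 0 <= w1 k by exact: powR_ge0.
have main : {ae P, forall om, (forall k, stay B (k + s) om) -> exists K, forall k, S k om <= K}.
  apply: (@ae_bounded _ _ _ P (fun k => F (k + s)) (fun k => stay B (k + s)) S
     (fun k om => wmoment om (k + s)) _ X Y
     (fun k => C3 * (be (k + s).+1 `^ (1 + q) * ((k + s).+1%:R `^ nub) `^ q * w1 k))
     (N%:R * M) (C3 * Ce) ((wt s * Kv) `^ q)).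
  - by move=> k; exact: Fm.
  - by move=> k; exact: genF_incr.
  - by move=> k; exact: stayF.
  - by move=> k om; exact: powR_ge0.
  - move=> k; apply: (gfun_comp _ (@powR R ^~ q)) => //.
    by apply: gfunM => //; exact: gfun_cst.
  - by move=> k [p|p]; [have [] := mds_noise (k + s) p.1 p.2|have [] := mds_send (k + s) p.1 p.2].
  - move=> k [p|p] A GA; [have [_] := mds_noise (k + s) p.1 p.2|have [_] := mds_send (k + s) p.1 p.2]; exact.
  - move=> k [p|p]; apply: gfunM; try exact: gfun_cst.
      apply: gfunM; first by apply: gfunM => //; exact: gfun_cst.
      apply: gfunM; first exact: gfun_cst.
      by apply: gfun_lyap => i l; [exact: gfun_err|exact: gfun_cst].
    apply: gfunD; last exact: gfun_cst.
    by apply: gfunM; [apply: gfunM => //|]; exact: gfun_cst.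
  - move=> k p.
    pose U1 := Kv `^ (q - 1).
    have ub om : stay B (k + s) om -> 0 <= u k om `^ (q - 1) <= U1.
      move=> /stB Ek; have [[/andP[_ v2] _ /andP[u1 u2] _ _] _] := hstep om (k + s)%N (k0s k) Ek.
      rewrite powR_ge0 /=; apply: ler_powRl; [lra|exact: u1|].
      by apply: (le_trans u2); apply: (le_trans v2).
    case: p => p.
      exists (w1 k * (q * U1 * (2 * (1 + Kv)))) => om Aom; have /andP[p0 p1] := ub om Aom.
      have Ek := stB k om Aom; have [[_ _ _ _ hY] _] := hstep om (k + s)%N (k0s k) Ek.
      have ly : `|lyap c1 (k + s).+1 (err om (k + s)) (delta_mx p.1 p.2)| <= 1 + Kv.
        have := hY (delta_mx p.1 p.2); rewrite ip_delta mulr1.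
        rewrite -(real_normK (num_real (lyap _ _ _ _))); set z := `|_| => h.
        have := sqr_ge0 (z - 1); nra.
      rewrite /X normrM (ger0_norm (w10 k)) ler_wpM2l// normrM.
      apply: ler_pM => //; first by rewrite ger0_norm ?mulr_ge0// ler_wpM2l.
      by rewrite normrM ger0_norm// ler_wpM2l.
    exists (w1 k * (`|C1| * U1 * edge_gain (k + s) p ^+ 2 + `|C2| * edge_gain (k + s) p `^ (1 + q))) => om Aom.
    have /andP[p0 p1] := ub om Aom.
    rewrite /X normrM (ger0_norm (w10 k)) ler_wpM2l//; apply: (le_trans (ler_normD _ _)); apply: lerD.
      rewrite normrM (ger0_norm (sqr_ge0 _)) ler_wpM2r ?sqr_ge0// normrM ler_wpM2l//.
      by rewrite ger0_norm.
    by rewrite normrM (ger0_norm (powR_ge0 _ _)).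
  - by move=> k om; exact: wmoment_ge0.
  - by move=> k; exact: measurable_wmoment.
  - by rewrite mulr_ge0.
  - by move=> k D GD Ds; apply: wmoment_bound => // om /Ds /stay_sub [].
  - by move=> k; rewrite !mulr_ge0 ?powR_ge0.
  - by move=> K; rewrite -mulr_sumr ler_wpM2l.
  - move=> k om /stB Ek.
    have [[/andP[v1 v2] _ /andP[u1 u2] v'0 _]] := hstep om (k + s)%N (k0s k) Ek.
    rewrite -/(v k om) -/(v k.+1 om) -/(u k om) in v1 v2 u1 u2 v'0 *.
    move=> h.
    have Sk1 : S k.+1 om = w1 k * v k.+1 om `^ q by rewrite /S powRM ?weight_ge0.
    have Sk : S k om = wt (k + s) `^ q * v k om `^ q by rewrite /S powRM ?weight_ge0.
    rewrite Sk1 Sk; apply: (le_trans (ler_wpM2l (w10 k) h)).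
    have hw : w1 k * ((1 - cc / 2 * be (k + s).+1) * v k om `^ q) <= wt (k + s) `^ q * v k om `^ q.
      rewrite mulrA ler_wpM2r ?powR_ge0// mulrC; exact: hk1.
    have e1 : \sum_(p : ('I_N * 'I_n) + ('I_N * 'I_N)) X k p om * Y k p om =
      w1 k * (q * u k om `^ (q - 1) * (2 * lyap c1 (k + s).+1 (err om (k + s)) (err_noise om (k + s)))) +
      w1 k * \sum_p (C1 * u k om `^ (q - 1) * edge_gain (k + s) p ^+ 2 + C2 * edge_gain (k + s) p `^ (1 + q))
        * (edge_sent om (k + s) p - edge_prob om (k + s) p).
      rewrite big_sumType /=; congr (_ + _).
        rewrite psdform_lyap_sum pair_bigA /= !mulr_sumr; apply: eq_bigr => p _; rewrite /X /Y; ring.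
      rewrite mulr_sumr; apply: eq_bigr => p _; rewrite /X /Y /send_noise /edge_gain /edge_sent /edge_prob.
      case: ifPn => [_|_]; first by rewrite mulrA.
      by rewrite mulr0 expr0n mulr0 powR0 ?mulr0 ?addr0 ?mul0r ?mulr0// gt_eqF//; lra.
    rewrite e1.
    move: (\sum_p _) => SS.
    move: hw; move: (v k om `^ q) (u k om `^ (q - 1)) (lyap _ _ _ (err_noise _ _)) => z1 z2 z3 hw.
    move: (be (k + s).+1 `^ (1 + q)) (((k + s).+1%:R `^ nub) `^ q) => y1 y2.
    lra.
  - move=> om Aom; rewrite /S; have Ek := stB 0%N om Aom.
    have [[/andP[v1 v2] _ _ _ _] _] := hstep om (0 + s)%N (k0s 0%N) Ek.
    apply: ler_powRl => //; first by rewrite mulr_ge0 ?weight_ge0.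
    by rewrite add0n ler_wpM2l ?weight_ge0//; exact: le_trans v2 Ek.
  - exact: powR_ge0.
apply: filterS main => om h ok Ek.
have allB k : B k om by split; [exact: ok|exact: Ek].
have [K hK] := h (fun k => stay_all B om allB (k + s)).
have wE0 k : 0 <= wt k * energy om k by rewrite mulr_ge0 ?weight_ge0 ?energy_ge0.
have K0 : 0 <= K by exact: le_trans (powR_ge0 _ _) (hK 0%N).
(* From time s on, the energy is at most 2 v and x <= 1 + x^q; the sum covers the finitely many
   earlier times. *)
exists (2 * (1 + K) + \sum_(0 <= j < s) wt j * energy om j) => k.
have sum0 : 0 <= \sum_(0 <= j < s) wt j * energy om j by exact: sumr_ge0.
have [sk|ks] := leqP s k; last first.
  have : wt k * energy om k <= \sum_(0 <= j < s) wt j * energy om j.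
    by rewrite big_mkord (bigD1 (Ordinal ks))//= lerDl sumr_ge0.
  lra.
have kE : (k - s + s = k)%N by rewrite subnK.
have := hK (k - s)%N; rewrite /S /v kE => hS.
have k0k : (k0 <= k)%N by rewrite (leq_trans (leq_maxl k0 k1)).
have [[/andP[v1 v2] v3 _ _ _] _] := hstep om k k0k (Ek k).
have := powR_le_bound _ _ (mulr_ge0 (weight_ge0 R nub k) v1) hS.
have := ler_wpM2l (weight_ge0 R nub k) v3.
move: (lyap _ _ _ _) => z; lra.
Qed.

(** The bounds M and Kv vary with the path. Exceptional sets are collected over all pairs of
    integers first, and each path then picks integers above its own bounds. *)
Lemma rate : {ae P, forall om, exists M : R, forall i k, (1 <= k)%N -> (g i k om <= M%:E)%E} ->
  {ae P, forall om, exists K : R, forall k, wt k * energy om k <= K}.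
Proof.
move=> gM.
have h1 : {ae P, forall om, forall j : nat, (forall k, moment_ok j%:R k om) ->
    exists K : R, forall k, energy om k <= K}.
  by apply/ae_foralln => j; exact: energy_bounded.
have h2 : {ae P, forall om, forall j l : nat, (forall k, moment_ok j%:R k om) ->
    (forall k, energy om k <= l%:R) -> exists K : R, forall k, wt k * energy om k <= K}.
  by apply/ae_foralln => j; apply/ae_foralln => l; exact: weighted_energy_bounded.
apply: filterS3 gM h1 h2 => om [M hM] e1 e2.
pose j := (Num.truncn `|M|).+1.
have ok k : moment_ok j%:R k om.
  move=> i; apply: (le_trans (hM i k.+1 isT)); rewrite lee_fin.
  by apply: (le_trans (ler_norm M)); apply: ltW; exact: truncnS_gt.
have [K hK] := e1 j ok.
pose l := (Num.truncn `|K|).+1.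
apply: (e2 j l ok) => k; apply: (le_trans (hK k)); apply: (le_trans (ler_norm K)).
by apply: ltW; exact: truncnS_gt.
Qed.

End Process.

(** * Choice of the parameters and conclusion *)

Lemma seqmin_const {R : realType} (c : R) (s : seq R) :
  s != [::] -> (forall x, x \in s -> x = c) -> seqmin s = c.
Proof.
have aux (t : seq R) : (forall x, x \in t -> x = c) -> \big[Num.min/c]_(x <- t) x = c.
  elim: t => [|x t IH] h; first by rewrite big_nil.
  rewrite big_cons (h x (mem_head x t)) IH ?minxx// => z zt.
  by apply: h; rewrite in_cons zt orbT.
case: s => // y s _ h; have yc := h y (mem_head y s).
by rewrite /seqmin /= [X in \big[_/X]_(_ <- _) _]yc; exact: aux.
Qed.

Lemma cvg_series_bounded {R : realType} (f : nat -> R) (C : R) : (forall k, 0 <= f k) ->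
  (forall K, \sum_(0 <= k < K) f k <= C) -> cvg (series f @ \oo).
Proof.
move=> f0 fC; apply: nondecreasing_is_cvgn.
  apply/nondecreasing_seqP => K; rewrite /series /= big_nat_recr//= lerDl; exact: f0.
by exists C => _ [K _ <-]; exact: fC.
Qed.

Section Nubar.
Variables (R : realType) (N : nat) (a nu : 'M[R]_N).

Lemma nubar_ge0 : 0 <= nubar a nu.
Proof.
rewrite /nubar; elim/big_ind: _ => //; first by move=> x y x0 y0; rewrite le_max x0.
by move=> i _; elim/big_rec: _ => // j x _ x0; rewrite le_max x0 orbT.
Qed.

Lemma le_nubar i j : 0 < a i j -> nu i j <= nubar a nu.
Proof.
move=> aij; apply: (@le_trans _ _ (\big[Num.max/0]_(j < N | 0 < a i j) nu i j)).
  exact: le_bigmax_cond.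
exact: (le_bigmax_cond _ (fun i => \big[Num.max/0]_(j < N | 0 < a i j) nu i j)).
Qed.

Lemma nubar_lt (c : R) : 0 < c -> (forall i j, 0 < a i j -> nu i j < c) -> nubar a nu < c.
Proof.
move=> c0 h; apply/bigmax_ltP; split => // i _; apply/bigmax_ltP; split => // j; exact: h.
Qed.

End Nubar.

Theorem theorem6p1
  (R : realType) (d : measure_display) (T : measurableType d)
  (P : probability T R)
  (N n : nat) (m : 'I_N -> nat)
  (a nu b : 'M[R]_N)
  (H : forall i : 'I_N, nat -> 'M[R]_(m i, n))
  (theta : 'cV[R]_n)
  (w : forall i : 'I_N, nat -> T -> 'cV[R]_(m i))
  (dd : 'I_N -> nat -> T -> R)
  (th0 : 'I_N -> 'cV[R]_n)
  (* network: undirected weighted graph on V = 'I_N, N >= 1 *)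
  (HN : (0 < N)%N)
  (Ha_sym : forall i j, a i j = a j i)
  (Ha_nneg : forall i j, 0 <= a i j)
  (Ha_diag : forall i, a i i = 0)
  (* (A1) *)
  (A1_bnd : exists Hbar : R, 0 < Hbar /\
      forall i k, (1 <= k)%N -> frob (H i k) <= Hbar)
  (A1_pe : exists (p : nat) (delta : R), [/\ (0 < p)%N, 0 < delta &
      forall k, (1 <= k)%N ->
        loewner_ge ((p%:R)^-1 *:
          \sum_(k <= t < k + p) \sum_(i < N) ((H i t)^T *m H i t)) delta])
  (* (A2) *)
  (A2_meas : forall i k (j : 'I_(m i)),
      measurable_fun setT (fun om => w i k om j 0))
  (A2_int : forall i k (j : 'I_(m i)), (1 <= k)%N ->
      P.-integrable setT (fun om => (w i k om j 0)%:E))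
  (A2_mds : forall i k (j : 'I_(m i)) (A : set T), (1 <= k)%N ->
      filtF w dd k.-1 A ->
      (\int[P]_(om in A) (w i k om j 0)%:E = 0)%E)
  (A2_mom : exists rho : R, 2 < rho /\
      exists g : 'I_N -> nat -> T -> \bar R,
        (forall i k, (1 <= k)%N ->
           [/\ (forall om, (0 <= g i k om)%E),
               (forall c : R, filtFw w k.-1 [set om | (g i k om <= c%:E)%E]) &
               (forall A, filtFw w k.-1 A ->
                  (\int[P]_(om in A) (powR (vnorm (w i k om)) rho)%:E
                   = \int[P]_(om in A) g i k om)%E)]) /\
        {ae P, forall om, exists M : R,
           forall i k, (1 <= k)%N -> (g i k om <= M%:E)%E})
  (* (A3) *)
  (A3 : \rank (laplacian a) = N.-1)
  (* (A4) *)
  (A4_meas : forall i k, measurable_fun setT (dd i k))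
  (A4_law : forall i k (x : R), (1 <= k)%N ->
      P [set om | dd i k om <= x] = (lapF x)%:E)
  (A4_indep : forall (S : seq ('I_N * nat)) (B : 'I_N * nat -> set R)
                     (A : set T),
      uniq S -> all (fun p => (1 <= p.2)%N) S ->
      (forall p, measurable (B p)) -> sigmaW w A ->
      P (A `&` \big[setI/setT]_(p <- S) (dd p.1 p.2 @^-1` B p))
      = (P A * \prod_(p <- S) P (dd p.1 p.2 @^-1` B p))%E)
  (* coefficients *)
  (Hnu_sym : forall i j, nu i j = nu j i)
  (Hnu : forall i j, 0 < a i j -> 0 <= nu i j < 2^-1)
  (Hb_sym : forall i j, b i j = b j i)
  (Hb : forall i j, 0 < a i j -> 0 < b i j) :
  exists (alpha : 'I_N -> 'I_N -> nat -> R) (beta : 'I_N -> nat -> R),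
    [/\ (forall i j k, 0 < a i j -> (1 <= k)%N ->
          alpha i j k = alpha j i k /\ 0 < alpha i j k) /\
        (forall i k, (1 <= k)%N -> 0 < beta i k),
        (* (i) *)
        (forall i j, 0 < a i j ->
          cvg (series (fun k => alpha i j k.+1 ^+ 2) @ \oo) /\
          exists M : R, forall k, (1 <= k)%N -> alpha i j k.+1 / alpha i j k <= M),
        (* (ii) *)
        (forall i,
          cvg (series (fun k => beta i k.+1 ^+ 2) @ \oo) /\
          exists M : R, forall k, (1 <= k)%N -> beta i k.+1 / beta i k <= M),
        (* (iii) *)
        series (fun k => minstep a nu alpha beta k.+1) @ \oo --> +oo &
        (* rate *)
        forall i : 'I_N,
          {ae P, forall om, exists C : R, forall k, (2 <= k)%N ->
             vnorm (sc_est a nu b alpha beta H theta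
                      (fun i t => w i t om) (fun i t => dd i t om) th0 k i - theta)
             <= C * (Num.sqrt (ln (k%:R)) / powR (k%:R) (2^-1 - nubar a nu / 2))}].
Proof.
have [Hbar [Hbar0 H_bnd]] := A1_bnd.
have [p [delta [p0 delta0 H_pe]]] := A1_pe.
have [rho [rho2 [g [g_cond g_bnd]]]] := A2_mom.
(* Greater than 1 because rho > 2. *)
pose q := Num.min (rho / 2) (3 / 2).
have q12 : 1 < q <= 3 / 2.
  by rewrite /q lt_min ge_min lexx orbT andbT; apply/andP; split; lra.
have q_rho : 2 * q <= rho.
  have : q <= rho / 2 by rewrite /q ge_min lexx.
  lra.
pose ep := (q - 1) / 4.
have ep01 : 0 < ep <= 1 := ep_bounds R q q12.
pose be := step R ep.
have be_ge0 := step_ge0 R ep : forall k, 0 <= be k.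
have be_gt0 := step_gt0 R ep ep01 : forall k, (0 < k)%N -> 0 < be k.
have be_noninc := step_noninc R ep ep01 : forall k, (0 < k)%N -> be k.+1 <= be k.
pose nub := nubar a nu.
have nub0 : 0 <= nub := nubar_ge0 R N a nu.
have nub_half : nub < 2^-1.
  by apply: nubar_lt => [|i j /Hnu /andP[]//]; rewrite invr_gt0.
have nub01 : 0 <= nub < 2^-1 by rewrite nub0.
pose Ca := 1 + \sum_(i < N) \sum_(j < N) (`|a i j| + `|(b i j)^-1| + `|b i j / a i j|).
have term_le i j : `|a i j| + `|(b i j)^-1| + `|b i j / a i j| <= Ca.
  rewrite /Ca (bigD1 i)//= (bigD1 j)//=.
  set x := `|_| + _ + _.
  have : 0 <= \sum_(j' < N | j' != j) (`|a i j'| + `|(b i j')^-1| + `|b i j' / a i j'|).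
    by apply: sumr_ge0 => j' _; rewrite !addr_ge0.
  have : 0 <= \sum_(i' < N | i' != i) \sum_(j < N) (`|a i' j| + `|(b i' j)^-1| + `|b i' j / a i' j|).
    by apply: sumr_ge0 => i' _; apply: sumr_ge0 => j' _; rewrite !addr_ge0.
  lra.
have Ca1 : 1 <= Ca.
  by rewrite /Ca lerDl; apply: sumr_ge0 => i _; apply: sumr_ge0 => j _; rewrite !addr_ge0.
have HCa i j : 0 < a i j -> [/\ a i j <= Ca, (b i j)^-1 <= Ca & b i j / a i j <= Ca].
  move=> _; have h := term_le i j.
  have := normr_ge0 (a i j); have := normr_ge0 (b i j)^-1; have := normr_ge0 (b i j / a i j).
  have := ler_norm (a i j); have := ler_norm (b i j)^-1; have := ler_norm (b i j / a i j).
  by move=> *; split; lra.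
have [kap kap0 excited] := excitation R N n m a H HN Ha_sym Ha_nneg A3 Hbar (ltW Hbar0) H_bnd
  p delta p0 delta0 H_pe.
have alp_gt0 i j k : (1 <= k)%N -> 0 < alp nu be i j k.
  by move=> k1; rewrite mulr_gt0 ?be_gt0// powR_gt0// ltr0n.
exists (alp nu be), (fun=> be); split.
- split=> [i j k aij k1|i k k1]; last exact: be_gt0.
  by split; [rewrite /alp Hnu_sym|exact: alp_gt0].
- move=> i j aij; split.
    have [C hC] := sum_sqr_step R ep ep01 (nu i j) (Hnu i j aij).
    by apply: (@cvg_series_bounded _ _ C) => // k; exact: sqr_ge0.
  (* The steps [be] do not increase, and (k + 1)^nu <= (2 k)^nu <= 2 k^nu. *)
  exists 2 => k k1; have kp : 0 < k%:R :> R by rewrite ltr0n.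
  have /andP[nu0 nu1] := Hnu i j aij.
  rewrite ler_pdivrMr ?alp_gt0// /alp mulrCA; apply: ler_pM => //.
    exact: be_noninc.
  apply: (@le_trans _ _ ((2 * k%:R) `^ nu i j)).
    by apply: ler_powRl => //; rewrite -natrM ler_nat mul2n -addnn -addn1 leq_add2l.
  rewrite powRM// ler_wpM2r ?powR_ge0//.
  rewrite -[leRHS]powRr1//; apply: ler_powR; lra.
- move=> i; split.
    have half0 : 0 <= (0 : R) < 2^-1 by rewrite lexx /= invr_gt0 ltr0n.
    have [C hC] := sum_sqr_step R ep ep01 0 half0.
    apply: (@cvg_series_bounded _ _ C) => [k|K]; first exact: sqr_ge0.
    apply: le_trans (hC K); rewrite le_eqVlt; apply/orP; left; apply/eqP.
    by apply: eq_bigr => k _; rewrite powRr0 mulr1.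
  by exists 1 => k k1; rewrite ler_pdivrMr ?mul1r ?be_noninc// be_gt0.
(* Dividing alpha by k^nu gives back [be], so all candidates for the minimum coincide, and [be]
   dominates the harmonic series. *)
- have mE k : minstep a nu (alp nu be) (fun=> be) k.+1 = be k.+1.
    apply: seqmin_const.
      by rewrite -size_eq0 size_cat size_map size_enum_ord addn_eq0 negb_and -lt0n HN.
    move=> x; rewrite mem_cat => /orP[/mapP[i _ ->]//|].
    move=> /allpairsPdep[i [j [_ _ ->]]].
    by rewrite /alp mulfK// gt_eqF// powR_gt0// ltr0n.
  apply: (@ger_cvgy _ _ _ _ (series (@harmonic R))).
    apply: nearW => K; rewrite /series /=; apply: ler_sum => k _; rewrite mE.
    exact: step_ge.
  apply: nondecreasing_dvgn_lt; last exact: dvg_harmonic.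
  by apply/nondecreasing_seqP => K; rewrite /series /= big_nat_recr//= lerDl invr_ge0.
move=> i.
have := @rate _ _ _ P N n m a nu b H theta w dd th0 be Ha_sym A2_meas A2_int A2_mds A4_meas A4_law A4_indep
  Hnu_sym Hnu Hb_sym Hb Ha_nneg Hbar Ca (ltW Hbar0) H_bnd Ca1 HCa be_ge0 nub nub0
  (le_nubar R N a nu) (sum_sqr_step R ep ep01 nub nub01) rho g (ltW rho2) g_cond (n + p)%N kap q kap0 excited
  q12 q_rho be_gt0 be_noninc (step_sub_le R ep ep01)
  (fun c c0 => step_small R ep ep01 nub c nub01 c0) (weight_decay R q nub q12 nub01)
  (sum_weight_err R q nub q12) g_bnd.
apply: filterS => om [K hK].
have K0 : 0 <= K.
  apply: le_trans (hK 0%N); rewrite mulr_ge0 ?weight_ge0//; exact: energy_ge0.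
have ln2 : 0 < ln 2 :> R by apply: ln_gt0; rewrite ltr1n.
(* Passes from 1 + ln k to ln k, which is possible from k = 2 on; at k = 1 the claimed bound would
   be 0. *)
pose c : R := 1 + (ln 2)^-1.
have c0 : 0 <= c by rewrite addr_ge0// invr_ge0 ltW.
exists (Num.sqrt (K * c)) => k k2.
have k0 : (0 < k)%N by exact: leq_trans k2.
have kp : 0 < k%:R :> R by rewrite ltr0n.
have lnk : ln 2 <= ln k%:R :> R by rewrite ler_ln ?posrE ?ltr0n// ler_nat.
have lnk0 : 0 < ln k%:R :> R by exact: lt_le_trans ln2 lnk.
have lgk : lg R k <= c * ln k%:R.
  rewrite /lg /c mulrDl mul1r addrC lerD2l -[leLHS](@divff _ (ln 2)) ?gt_eqF//.
  by rewrite mulrC ler_wpM2l// invr_ge0 ltW.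
have pk : 0 < k%:R `^ (1 - nub) :> R by exact: powR_gt0.
have en : energy N n m a nu b H theta w dd th0 be om k <= K * c * (ln k%:R / k%:R `^ (1 - nub)).
  have := hK k; rewrite /weight mulrAC ler_pdivrMr ?lg_gt0// => h.
  rewrite mulrA ler_pdivlMr// mulrC; apply: (le_trans h).
  by rewrite -mulrA ler_wpM2l.
have vn : vnorm (sc_est a nu b (alp nu be) (fun=> be) H theta (fun i t => w i t om)
    (fun i t => dd i t om) th0 k i - theta) <= Num.sqrt (energy N n m a nu b H theta w dd th0 be om k).
  apply: ler_wsqrtr; rewrite /energy ip_sqrE (bigD1 i)//= -[leLHS]addr0 lerD//.
    by rewrite le_eqVlt; apply/orP; left; apply/eqP; apply: eq_bigr => l _; rewrite !mxE.
  by apply: sumr_ge0 => j _; apply: sumr_ge0 => l _; exact: sqr_ge0.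
apply: (le_trans vn).
have -> : 2^-1 - nubar a nu / 2 = (1 - nub) * 2^-1 by rewrite /nub; ring.
rewrite powRrM powR12_sqrt ?powR_ge0//.
have Kc : 0 <= K * c by exact: mulr_ge0.
apply: (le_trans (ler_wsqrtr en)).
by rewrite (sqrtrM _ Kc) (sqrtrM _ (ltW lnk0)) sqrtrV ?powR_ge0.
Qed.
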